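(* Let $r:[0,+\infty[\to[0,+\infty[$ be a measurable non-decreasing function, $R(t)=\int_0^t r(s)\,ds$, and $\Lambda_r(\xi)=\int_0^\infty r(t)e^{-\xi t}\,dt\in[0,\infty]$ for $\xi\ge 0$. Assume $\tau_G<\infty$ almost surely. Then the following four conditions are equivalent: 1. $\mathbb{E}_\mu R(\tau_G)<\infty$; 2. for all $f\in\mathcal{B}_b$, the function $x\mapsto f(x)\times\mathbb{E}_x\int_0^{\tau_G}r(t)f(X_t)\,dt$ belongs to $L^1(\mathbf{1}_G\cdot\mu)$; 3. for all $f\in\mathcal{B}_b$, $\int_{[0,\infty[}\Lambda_r(\xi)\,d(E_\xi^G f,f)<\infty$; 4. for all $f\in\mathcal{B}_b$, $\int_0^\infty r(t)\,\|P_{t/2}^G f\|^2\,dt<\infty$. Moreover, for any $f\in\mathcal{B}_b$, $$\Big\|f\times\mathbb{E}_\cdot\int_0^{\tau_G}r(t)f(X_t)\,dt\Big\|_1=\int_{[0,\infty[}\Lambda_r(\xi)\,d(E_\xi^G f,f)=\int_0^\infty r(t)\,\|P_{t/2}^G f\|^2\,dt .$$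
   Context: Let $\mathtt{E}$ be a locally compact space with countable base (LCCB), $\mu$ a Radon probability measure on $\mathtt{E}$, and $X=(X_t)_{t\ge 0}$ a $\mu$-symmetric Hunt process on $\mathtt{E}$; $\mathbb{P}_x$ denotes the law of $X$ started at $x$, $\mathbb{E}_x$ the corresponding expectation, and $\mathbb{E}_\mu=\int\mathbb{E}_x\,\mu(dx)$. Let $G\subseteq\mathtt{E}$ be open and let $\tau_G=\inf\{t\ge 0: X_t\notin G\}$ be the exit time of $X$ from $G$. The semigroup of the process killed when it leaves $G$ is $P_t^G f(x)=\mathbb{E}_x[f(X_t)\mathbf{1}_{\{t<\tau_G\}}]$. It is symmetric on $L^2(\mathbf{1}_G\cdot\mu)$, whose scalar product and norm are denoted $(\cdot,\cdot)$ and $\|\cdot\|$. Its infinitesimal generator $A^G$ in $L^2(\mathbf{1}_G\cdot\mu)$ is a self-adjoint negative operator. $(E_\xi^G)_{\xi\ge 0}$ denotes the spectral family of $-A^G$ (a right-continuous increasing family of projections), so that $P_t^G u=\int_{[0,\infty[}e^{-\xi t}\,dE_\xi^G u$. Since $\tau_G<\infty$ almost surely, $E_0^G=0$, so integrals over $[0,\infty[$ against $d(E_\xi^G f,f)$ may be read as integrals over $]0,\infty[$. $\mathcal{B}_b$ is the space of bounded Borel-measurable real functions, and $\|\cdot\|_1$ is the norm of $L^1(\mathbf{1}_G\cdot\mu)$.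
   Formalization: The first equality of the ''Moreover'' fails for sign-changing f; the L1-norm equality is stated only for f ≥ 0, and for general f, assuming condition 1, the norm is replaced by the integral over G of f times the expectation; the second equality holds for all f. *)

(* Defs.v *)
From HB Require Import structures.
From mathcomp Require Import all_boot all_order all_algebra.
From mathcomp Require Import all_classical all_reals all_analysis.
From mathcomp Require Import measurable_realfun.

Set Implicit Arguments.
Unset Strict Implicit.
Unset Printing Implicit Defensive.

Import Order.TTheory GRing.Theory Num.Theory.
Import numFieldNormedType.Exports.

Local Open Scope classical_set_scope.
Local Open Scope ring_scope.

Notation borel E := (g_sigma_algebraType (@open E)).

Lemma open_borel (E : ptopologicalType) (G : set E) :
  open G -> measurable (G : set (borel E)).
Proof. by move=> oG; apply: sub_sigma_algebra. Qed.

Definition radon (R : realType) (E : ptopologicalType)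
    (mu : probability (borel E) R) : Prop :=
  forall B : set (borel E), measurable B ->
    mu B = ereal_sup [set mu K | K in [set K : set E | compact K /\ K `<=` B]].

Section stopping_times.
Context (R : realType) d (Omega : measurableType d).
Variable F : R -> set (set Omega).

Definition stopping_time (T : Omega -> \bar R) : Prop :=
  (forall w, (0 <= T w)%E) /\
  (forall t : R, 0 <= t -> F t [set w | (T w <= t%:E)%E]).

Definition stopped_sigma_algebra (T : Omega -> \bar R) : set (set Omega) :=
  [set A | measurable A /\
    forall t : R, 0 <= t -> F t (A `&` [set w | (T w <= t%:E)%E])].

End stopping_times.

(* The cemetery is the point [None] at infinity of the one-point
   compactification of [E]; it is isolated when [E] is compact. Only the times
   [t >= 0] are constrained. All the almost sure properties are required under
   each [P x], for a single admissible filtration, which need not be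
   complete. *)
Record hunt_process (R : realType) (E : ptopologicalType)
    (d : measure_display) (Omega : measurableType d) := HuntProcess {
  hX :> R -> Omega -> one_point_compactification E ;
  hP : one_point_compactification E -> probability Omega R ;
  hshift : R -> Omega -> Omega ;
  hF : R -> set (set Omega) ;
  hF_sigma_algebra : forall t : R, 0 <= t ->
    sigma_algebra setT (hF t) /\ hF t `<=` measurable ;
  hF_right_continuous : forall t : R, 0 <= t ->
    hF t = \bigcap_(s in [set s | t < s]) hF s ;
  hX_adapted : forall t : R, 0 <= t ->
    forall B : set (borel (one_point_compactification E)), measurable B ->
    hF t (hX t @^-1` B) ;
  hP_measurable : forall t : R, 0 <= t ->
    forall B : set (borel (one_point_compactification E)), measurable B ->
    measurable_fun setT
      (fun x : borel (one_point_compactification E) =>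
         hP x (hX t @^-1` B) : \bar R) ;
  hP_normal : forall x, hP x (hX 0 @^-1` [set x]) = 1%E ;
  hX_cemetery : forall (s t : R) w, 0 <= s -> s <= t ->
    hX s w = None -> hX t w = None ;
  hX_shift : forall (s t : R) w, 0 <= s -> 0 <= t ->
    hX s (hshift t w) = hX (s + t) w ;
  hX_right_continuous : forall (t : R) w, 0 <= t ->
    hX s w @[s --> t^'+] --> hX t w ;
  hX_left_limits : forall (t : R) w, 0 < t ->
    exists l : one_point_compactification E, hX s w @[s --> t^'-] --> l ;
  hX_strong_markov : forall x (T : Omega -> \bar R), stopping_time hF T ->
    forall s : R, 0 <= s ->
    forall B : set (borel (one_point_compactification E)), measurable B ->
    forall A, stopped_sigma_algebra hF T A ->
    hP x (A `&` [set w | (T w < +oo)%E /\ B (hX (fine (T w) + s) w)]) =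
    (\int[hP x]_(w in A `&` [set w | (T w < +oo)%E])
       hP (hX (fine (T w)) w) (hX s @^-1` B))%E ;
  hX_quasi_left_continuous : forall x (T_ : nat -> Omega -> \bar R),
    (forall n, stopping_time hF (T_ n)) ->
    (forall n w, (T_ n w <= T_ n.+1 w)%E) ->
    let T w := ereal_sup (range (T_ ^~ w)) in
    {ae hP x, forall w, (T w < +oo)%E ->
      hX (fine (T_ n w)) w @[n --> \oo] --> hX (fine (T w)) w}
}.

Section process.
Context (R : realType) (E : ptopologicalType) (d : measure_display).
Context (Omega : measurableType d) (X : hunt_process R E Omega).

Definition transition (t : R) (f : E -> \bar R) (x : E) : \bar R :=
  (\int[hP X (Some x)]_w oapp f 0 (X t w))%E.

Definition symmetric_process (mu : probability (borel E) R) : Prop :=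
  forall t : R, 0 <= t -> forall f g : borel E -> \bar R,
    measurable_fun setT f -> measurable_fun setT g ->
    (forall x, (0 <= f x)%E) -> (forall x, (0 <= g x)%E) ->
    (\int[mu]_x (f x * transition t g x) =
     \int[mu]_x (transition t f x * g x))%E.

Variable G : set E.

(* As usual [exit_time] is measurable only up to [P x]-negligible sets. The
   integrals below agree with those for the completion of [P x], since
   [\int[m]_x f x] is the supremum of the integrals of the measurable simple
   functions below [f] when [f] is nonnegative, and the difference of the
   integrals of the positive and negative parts of [f] otherwise. *)
Definition exit_time (w : Omega) : \bar R :=
  ereal_inf [set t%:E | t in [set t | 0 <= t /\ ~ (Some @` G) (X t w)]].

Definition killed_semigroup (t : R) (f : E -> R) (x : E) : R :=
  \int[hP X (Some x)]_w
    (oapp f 0 (X t w) * \1_[set w | (t%:E < exit_time w)%E] w).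

Variable r : R -> R.

Definition times_before (t : \bar R) : set R :=
  [set s | 0 <= s /\ (s%:E < t)%E].

(* The integral of [r] over [[0, t[]; the value at [t = +oo] is that of the
   integral over [[0, +oo[]. *)
Definition primitive (t : \bar R) : \bar R :=
  (\int[lebesgue_measure]_(s in times_before t) (r s)%:E)%E.

Definition killed_potential (f : E -> R) (x : E) : \bar R :=
  (\int[hP X (Some x)]_w
    \int[lebesgue_measure]_(t in times_before (exit_time w))
      (r t * oapp f 0 (X t w))%:E)%E.

Definition laplace (xi : R) : \bar R :=
  (\int[lebesgue_measure]_(t in `[0%R, +oo[) (r t * expR (- (xi * t)))%:E)%E.

End process.

(* [L2 mu] consists of functions rather than classes, so operators and vectors
   are compared up to [%[ae mu]]. *)
Notation L2 mu := (LfunType mu (lee1n 2)).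

Section hilbert.
Context (R : realType) (d : measure_display) (T : measurableType d).
Variable mu : {measure set T -> \bar R}.

Definition L2norm (f : T -> R) : \bar R := 'N[mu]_2%:E[EFin \o f]%E.

Definition L2dot (f g : T -> R) : R := \int[mu]_x (f x * g x).

(* A right-continuous resolution of the identity indexed by [[0, +oo[]. *)
Record spectral_family := SpectralFamily {
  sproj :> R -> L2 mu -> L2 mu ;
  sproj_ae : forall (xi : R) (f g : L2 mu), 0 <= xi ->
    f = g %[ae mu] -> sproj xi f = sproj xi g %[ae mu] ;
  sproj_linear : forall (xi a : R) (f g : L2 mu), 0 <= xi ->
    sproj xi (a *: f + g) = a *: sproj xi f + sproj xi g %[ae mu] ;
  sproj_idempotent : forall (xi : R) (f : L2 mu), 0 <= xi ->
    sproj xi (sproj xi f) = sproj xi f %[ae mu] ;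
  sproj_symmetric : forall (xi : R) (f g : L2 mu), 0 <= xi ->
    L2dot (sproj xi f) g = L2dot f (sproj xi g) ;
  sproj_nondecreasing : forall (xi eta : R) (f : L2 mu), 0 <= xi -> xi <= eta ->
    sproj eta (sproj xi f) = sproj xi f %[ae mu] ;
  sproj_right_continuous : forall (xi : R) (f : L2 mu), 0 <= xi ->
    L2norm (sproj eta f \- sproj xi f) @[eta --> xi^'+] --> 0%E ;
  sproj_identity : forall f : L2 mu,
    L2norm (sproj eta f \- f) @[eta --> +oo] --> 0%E
}.

Definition spectral_cdf (S : spectral_family) (f : L2 mu) (xi : R) : R :=
  if 0 <= xi then L2dot (S xi f) f else 0.

Lemma L2_mul_integrable (f g : L2 mu) :
  mu.-integrable setT (EFin \o (fun x => f x * g x)).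
Proof. by apply/Lfun1_integrable; apply: Lfun2_mul_Lfun1; exact: LfunP. Qed.

Lemma L2dotBl (f g h : L2 mu) : L2dot (f - g) h = L2dot f h - L2dot g h.
Proof.
rewrite /L2dot -RintegralB//; [|exact: L2_mul_integrable..].
by congr (fine _); apply: eq_integral => x _; rewrite /= mulrBl.
Qed.

Lemma L2dotBr (f g h : L2 mu) : L2dot h (f - g) = L2dot h f - L2dot h g.
Proof.
rewrite /L2dot -RintegralB//; [|exact: L2_mul_integrable..].
by congr (fine _); apply: eq_integral => x _; rewrite /= mulrBr.
Qed.

Lemma ae_eq_L2dotl (f g h : L2 mu) :
  f = g %[ae mu] -> L2dot f h = L2dot g h.
Proof.
move=> fg; congr (fine _); apply: ae_eq_integral => //.
- exact: measurable_int (L2_mul_integrable f h).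
- exact: measurable_int (L2_mul_integrable g h).
- by apply: filterS fg => x /(_ I) /= ->.
Qed.

Lemma L2norm_sqr (f : L2 mu) : (fine (L2norm f)) ^+ 2 = L2dot f f.
Proof.
have E : (L2norm f `^ 2 = \int[mu]_x (f x * f x)%:E)%E.
  rewrite poweR_Lnorm ?pnatr_eq0//; apply: eq_integral => x _ /=.
  by rewrite powR_mulrn// -normrX ger0_norm ?sqr_ge0// expr2.
rewrite /L2dot /Rintegral -E /L2norm -(@finite_norm_fine _ _ _ _ _ (lee1n 2) f) /=.
by rewrite powR_mulrn// fine_ge0// Lnorm_ge0.
Qed.

Lemma spectral_cdfB (S : spectral_family) (f : L2 mu) xi eta :
  0 <= xi -> xi <= eta ->
  spectral_cdf S f eta - spectral_cdf S f xi =
  fine (L2norm (S eta f \- S xi f)) ^+ 2.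
Proof.
move=> xi0 xieta; have eta0 := le_trans xi0 xieta.
have projE z : 0 <= z -> L2dot (S z f) (S z f) = L2dot (S z f) f.
  by move=> z0; rewrite -sproj_symmetric//; exact/ae_eq_L2dotl/sproj_idempotent.
have xietaE : L2dot (S xi f) (S eta f) = L2dot (S xi f) f.
  rewrite -sproj_symmetric//.
  exact/ae_eq_L2dotl/sproj_nondecreasing.
have etaxiE : L2dot (S eta f) (S xi f) = L2dot (S xi f) f.
  by rewrite -xietaE; congr (fine _); apply: eq_integral => x _; rewrite mulrC.
rewrite /spectral_cdf xi0 eta0.
have -> : S eta f \- S xi f = (S eta f - S xi f : L2 mu) by [].
by rewrite L2norm_sqr L2dotBl !L2dotBr projE// projE// xietaE etaxiE subrr subr0.
Qed.

Let spectral_cdf_nondecreasing S f : nondecreasing (spectral_cdf S f).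
Proof.
move=> xi eta xieta; have [xi0|xi0] := leP 0 xi.
  by rewrite -subr_ge0 spectral_cdfB// sqr_ge0.
have -> : spectral_cdf S f xi = 0 by rewrite /spectral_cdf leNgt xi0.
rewrite /spectral_cdf.
case: ifPn => // eta0.
by rewrite -(ae_eq_L2dotl f (sproj_idempotent S f eta0)) sproj_symmetric// -L2norm_sqr sqr_ge0.
Qed.

Let spectral_cdf_right_continuous S f : right_continuous (spectral_cdf S f).
Proof.
move=> xi; have [xi0|xi0] := leP 0 xi; last first.
  have -> : spectral_cdf S f xi = 0 by rewrite /spectral_cdf leNgt xi0.
  apply: cvg_near_cst; near=> eta.
  by rewrite /spectral_cdf leNgt (_ : eta < 0)//; near: eta; exact: nbhs_right_lt.
have /fine_cvgP[_ N0] := sproj_right_continuous S f xi0.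
rewrite -[X in _ --> X]add0r; apply: (@cvg_trans _
    ((fine (L2norm (S eta f \- S xi f)) ^+ 2 + spectral_cdf S f xi)
      @[eta --> xi^'+])).
  apply: near_eq_cvg; near=> eta.
  by rewrite -spectral_cdfB ?subrK//; near: eta; exact: nbhs_right_ge.
apply: cvgD; last exact: cvg_cst.
by rewrite -[X in _ --> X](mulr0 0); apply: cvgM; exact: N0.
Unshelve. all: by end_near. Qed.

HB.instance Definition _ S f := isCumulative.Build R _ R (spectral_cdf S f)
  (@spectral_cdf_nondecreasing S f) (@spectral_cdf_right_continuous S f).

(* The measure [d(S_xi f, f)] on [[0, +oo[]: as [spectral_cdf S f] vanishes on
   the negative half-line, it charges [0] with mass [(S_0 f, f)]. *)
Definition spectral_measure S f := lebesgue_stieltjes_measure (spectral_cdf S f).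

(* [\int xi d(S_xi u, v)], by polarization. *)
Definition spectral_form S (u v : L2 mu) : R :=
  4^-1 * (\int[spectral_measure S (u + v)]_(xi in `[0, +oo[) xi -
          \int[spectral_measure S (u - v)]_(xi in `[0, +oo[) xi).

(* [S] is the spectral family of the operator with graph [H]:
   [H = \int_[0, +oo[ xi dS_xi], whose domain consists of the [u] such that
   [\int xi^2 d(S_xi u, u)] is finite. As the domain is dense, it is enough to
   test [H u] against the elements of the domain. *)
Definition spectral_family_of S (H : L2 mu -> L2 mu -> Prop) : Prop :=
  (forall u, (exists v, H u v) <->
     (\int[spectral_measure S u]_(xi in `[0%R, +oo[) (xi ^+ 2)%:E < +oo)%E) /\
  (forall u Hu v Hv, H u Hu -> H v Hv -> L2dot Hu v = spectral_form S u v).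

End hilbert.

Definition bounded_borel (R : realType) (E : ptopologicalType) (f : E -> R) :=
  measurable_fun [set: borel E] f /\ exists M, forall x, `|f x| <= M.

Notation "mu \|_ oG" := (mrestr mu (open_borel oG))
  (at level 10, oG at level 9, format "mu \|_ oG").

Section restriction.
Context (R : realType) (E : ptopologicalType) (mu : probability (borel E) R).
Variables (G : set E) (oG : open G).

Lemma bounded_borel_Lfun f : bounded_borel f -> f \in Lfun (mu \|_ oG) 2%:E.
Proof.
move=> [mf [M fM]]; rewrite inE; apply/andP; split; rewrite inE//=.
rewrite /finite_norm unlock /=; apply: poweR_lty.
apply: (@le_lt_trans _ _ (\int[mu \|_ oG]_x (cst (M ^+ 2)%:E) x)%E).
  apply: ge0_le_integral => //=.
  - apply/measurable_EFinP; apply: (measurableT_comp (measurable_powR _)) => //.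
    exact: measurableT_comp.
  - move=> x _; rewrite powR_mulrn// lee_fin lerXn2r ?nnegrE//.
    exact: le_trans (fM x).
rewrite integral_cst// lte_mul_pinfty ?lee_fin ?sqr_ge0//.
exact: fin_num_fun_lty (fin_num_measure _).
Qed.

Definition toL2 f (fB : bounded_borel f) : L2 (mu \|_ oG) :=
  Lfun_Sub (lee1n 2) (bounded_borel_Lfun fB).

Variables (d : measure_display) (Omega : measurableType d).
Variable X : hunt_process R E Omega.

(* [generator u v] states that [u] belongs to the domain of the generator [A]
   of the killed semigroup and that [A u = v]. *)
Definition generator (u v : L2 (mu \|_ oG)) : Prop :=
  L2norm (mu \|_ oG)
    (fun x => t^-1 * (killed_semigroup X G t u x - u x) - v x)
    @[t --> 0^'+] --> 0%E.

End restriction.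

(* Main.v *)
Require Import Defs.
From HB Require Import structures.
From mathcomp Require Import all_boot all_order all_algebra.
From mathcomp Require Import all_classical all_reals all_analysis.
From mathcomp Require Import measurable_realfun.
From mathcomp Require Import ring lra.

Set Implicit Arguments.
Unset Strict Implicit.
Unset Printing Implicit Defensive.

Import Order.TTheory GRing.Theory Num.Theory.
Import numFieldNormedType.Exports.

Local Open Scope classical_set_scope.
Local Open Scope ring_scope.

(** Write [P_t] for the killed semigroup, [tau] for the exit time, [U f] for the
    killed potential [x |-> E_x (\int_0^tau r(t) f(X_t) dt)], and pair functions
    in [L^2] of [1_G * mu]. Everything reduces to the chain
[[
      \int f * U f = \int_0^oo r(t) (f, P_t f) dt = \int_0^oo r(t) |P_{t/2} f|^2 dt
                  = \int_0^oo r(t) \int exp (- xi t) d(S_xi f, f) dt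
                  = \int laplace r xi d(S_xi f, f).
]]
    The outer steps are applications of Tonelli's theorem, which for a bounded
    signed [f] becomes Fubini's theorem as soon as [U 1] is integrable. As
    [\int U 1 = E_mu R(tau)], and as [|f * U f| <= M^2 * U 1] when [|f| <= M],
    the four conditions all amount to the integrability of [U 1].

    Two facts have to be established before the chain makes sense.

    (1) The second and third steps use that [P_t] is symmetric and that it is
    [\int exp (- xi t) dS_xi], whereas [S] is only given as the spectral family
    of the generator, through its quadratic form. This is proved without
    functional calculus, for a contraction semigroup on a semi-inner product
    space. The generator [A] is symmetric, hence so is [P_t], as the derivative
    of [s |-> (P_s u, P_{t-s} v)] vanishes ([P_sym]). On the range of the
    projection [Q] onto [`]a, b]] the form of [- A] lies between [a] and [b]
    ([gen_cell]), so that [|Q P_t u|^2] decays at a rate between [2 a] and [2 b]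
    ([cell_decay]). Summing over a fine grid gives
    [|P_t u|^2 = \int exp (- 2 xi t) d(S_xi u, u)] ([semigroup_sqr_norm]).

    (2) The killed semigroup has to be a contraction semigroup on [L^2]. The
    exit time need not be measurable, so it is replaced by an almost surely equal
    time [T], the limit of the debuts out of an exhaustion of [G], by
    quasi-left-continuity ([exit_time_measurable_version]). The laws [P_x] are
    measurable in [x] on the sigma-algebra generated by the process, where the
    Markov property holds for events of the whole path ([markov_property]), and
    right-continuity makes [(t, w) |-> X_t(w)] jointly measurable
    ([measurable_Xpos]). The semigroup law is then the Markov property ([killedD]),
    and the contraction property follows from Jensen's inequality and the
    symmetry of the process ([integral_killed_sqr_le]). *)

(** * Preliminaries on limits *)

Lemma exists_natr_gt (R : realType) (x : R) : exists n : nat, x < n.+1%:R.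
Proof. by exists (Num.truncn x); exact: truncnS_gt. Qed.

Lemma cvg_at_left_rev (R : realType) (f : R -> R) (t l : R) :
  f s @[s --> 0^'+] --> l -> f (t - s) @[s --> t^'-] --> l.
Proof.
move=> fl; apply: cvg_comp fl => B [e /= e0 eB]; exists e => // s /= ts st.
by apply: eB; rewrite /= ?subr_gt0// sub0r normrN.
Qed.

Section squeeze0.
Context (R : realType) (I : Type) (F : set_system I) {FF : Filter F}.

Lemma squeeze_cvg0 (f g : I -> R) :
  (\forall i \near F, 0 <= f i <= g i) -> g i @[i --> F] --> 0 ->
  f i @[i --> F] --> 0.
Proof.
by move=> fg g0; apply: (@squeeze_cvgr _ _ _ _ (cst 0) g) => //; exact: cvg_cst.
Qed.

End squeeze0.

Lemma norm_cvg_at_right0 (R : realType) : `|h : R| @[h --> 0^'] --> (0:R)^'+.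
Proof.
move=> A /= [e e0 eA]; exists e => // h /= he h0.
apply: eA; last by rewrite normr_gt0.
by move: he; rewrite /= !sub0r !normrN normr_id.
Qed.

(** * Semi-inner product spaces *)

Section spectral_calculus.
Context (R : realType) (V : lmodType R) (dot : V -> V -> R).
Implicit Types (f g k u v w x : V) (y z : R -> V) (a b c h s t xi : R).
(** As [dot] may be degenerate, identities between vectors are assumed and
    proved after pairing with an arbitrary vector. *)
Hypothesis dotC : forall f g, dot f g = dot g f.
Hypothesis dot_linear : forall a f g k, dot (a *: f + g) k = a * dot f k + dot g k.
Hypothesis dot_ge0 : forall f, 0 <= dot f f.

Let dotBl f g k : dot (f - g) k = dot f k - dot g k.
Proof. by rewrite addrC -scaleN1r dot_linear mulN1r addrC. Qed.

Let dot0l k : dot 0 k = 0.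
Proof. by rewrite -(subrr (0 : V)) dotBl subrr. Qed.

Let dotNl f k : dot (- f) k = - dot f k.
Proof. by rewrite -[- f]add0r dotBl dot0l sub0r. Qed.

Let dotDl f g k : dot (f + g) k = dot f k + dot g k.
Proof. by rewrite -[g]opprK dotBl dotNl !opprK. Qed.

Let dotZl a f k : dot (a *: f) k = a * dot f k.
Proof. by rewrite -[a *: f]addr0 dot_linear dot0l addr0. Qed.

Let dot0r k : dot k 0 = 0. Proof. by rewrite dotC dot0l. Qed.
Let dotNr f k : dot k (- f) = - dot k f.
Proof. by rewrite dotC dotNl dotC. Qed.
Let dotBr f g k : dot k (f - g) = dot k f - dot k g.
Proof. by rewrite dotC dotBl dotC (dotC g). Qed.
Let dotDr f g k : dot k (f + g) = dot k f + dot k g.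
Proof. by rewrite dotC dotDl dotC (dotC g). Qed.
Let dotZr a f k : dot k (a *: f) = a * dot k f.
Proof. by rewrite dotC dotZl dotC. Qed.

Let dotE := (dotDl, dotDr, dotBl, dotBr, dotNl, dotNr, dotZl, dotZr,
  dot0l, dot0r).

(** Nonnegativity of [dot (f - t *: g) (f - t *: g)] at the minimising [t]. *)
Lemma dot_CauchySchwarz f g : dot f g ^+ 2 <= dot f f * dot g g.
Proof.
have [g0|g0] := eqVneq (dot g g) 0; last first.
  have := dot_ge0 (f - (dot f g / dot g g) *: g).
  rewrite !dotE (dotC g f) => H.
  have gp : 0 < dot g g by rewrite lt_neqAle eq_sym g0 dot_ge0.
  have := mulr_ge0 (ltW gp) H.
  rewrite [X in 0 <= X](_ : _ = dot f f * dot g g - dot f g ^+ 2) ?subr_ge0//.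
  by field.
rewrite g0 mulr0.
(* a null [g] gives a linear function of [t] that stays nonnegative *)
have H t : 0 <= dot f f - 2 * t * dot f g.
  by have := dot_ge0 (f - t *: g); rewrite !dotE (dotC g f) g0; lra.
have [->|fg0] := eqVneq (dot f g) 0; first by rewrite expr0n.
exfalso; have := H ((dot f f + 1) / (2 * dot f g)).
suff -> : 2 * ((dot f f + 1) / (2 * dot f g)) * dot f g = dot f f + 1 by lra.
by field.
Qed.

Lemma dot_CauchySchwarz_sqrt f g :
  `|dot f g| <= Num.sqrt (dot f f) * Num.sqrt (dot g g).
Proof.
rewrite -sqrtr_sqr -sqrtrM ?dot_ge0// ler_wsqrtr//.
exact: dot_CauchySchwarz.
Qed.

Lemma dot_le_add f g : `|dot f g| <= dot f f + dot g g.
Proof.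
have := dot_ge0 (f - g); have := dot_ge0 (f + g).
have := dot_ge0 f; have := dot_ge0 g.
rewrite !dotE (dotC g f) => *.
by rewrite ler_norml; apply/andP; split; lra.
Qed.

Lemma dot_cvg {I} (F : set_system I) {FF : Filter F} (u v : I -> V) f g :
  dot (u i - f) (u i - f) @[i --> F] --> 0 ->
  dot (v i - g) (v i - g) @[i --> F] --> 0 ->
  dot (u i) (v i) @[i --> F] --> dot f g.
Proof.
have c0 (w : I -> V) : dot (w i) (w i) @[i --> F] --> 0 ->
    forall k, dot (w i) k @[i --> F] --> 0.
  move=> wc k; apply/norm_cvg0P; apply: (@squeeze_cvgr _ _ _ _ (cst 0)
    (fun i => Num.sqrt (dot (w i) (w i)) * Num.sqrt (dot k k))).
  - by apply: nearW => i /=; rewrite normr_ge0 dot_CauchySchwarz_sqrt.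
  - exact: cvg_cst.
  - rewrite -[X in _ --> X](mul0r (Num.sqrt (dot k k))).
    apply: cvgM; last exact: cvg_cst.
    rewrite -sqrtr0; apply: (@cvg_comp _ _ _ (fun i => dot (w i) (w i)) Num.sqrt
      _ (nbhs (0:R))) => //; exact: sqrt_continuous.
move=> uc vc.
have E i : dot (u i) (v i) = dot (u i - f) (v i - g) + dot (u i - f) g +
    dot (v i - g) f + dot f g.
  by rewrite !dotE (dotC g f) (dotC (v i) f); ring.
have -> : (fun i => dot (u i) (v i)) = _ := funext E.
rewrite -[X in _ --> X]add0r; apply: cvgD; last exact: cvg_cst.
rewrite -[X in _ --> X]add0r; apply: cvgD; last exact: c0.
rewrite -[X in _ --> X]add0r; apply: cvgD; last exact: c0.
apply/norm_cvg0P; apply: (@squeeze_cvgr _ _ _ _ (cst 0)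
    (fun i => (dot (u i - f) (u i - f) + dot (v i - g) (v i - g)))).
- by apply: nearW => i; apply/andP; split; [exact: normr_ge0|exact: dot_le_add].
- exact: cvg_cst.
- by rewrite -[X in _ --> X](add0r 0); apply: cvgD.
Qed.

Lemma dot_cvgl {I} (F : set_system I) {FF : Filter F} (u : I -> V) f g :
  dot (u i - f) (u i - f) @[i --> F] --> 0 ->
  dot (u i) g @[i --> F] --> dot f g.
Proof.
move=> uf; apply: (@dot_cvg _ _ _ u (fun=> g)) => //.
by under eq_cvg do rewrite subrr dot0l; exact: cvg_cst.
Qed.

Lemma dot_parallelogram f g :
  dot (f + g) (f + g) + dot (f - g) (f - g) = 2 * dot f f + 2 * dot g g.
Proof. by rewrite !dotE (dotC g f); ring. Qed.

Lemma dot_leD f g : dot (f + g) (f + g) <= 2 * dot f f + 2 * dot g g.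
Proof. by have := dot_ge0 (f - g); have := dot_parallelogram f g; lra. Qed.

Lemma dot_leB f g : dot (f - g) (f - g) <= 2 * dot f f + 2 * dot g g.
Proof. have := dot_ge0 (f + g); have := dot_parallelogram f g; lra. Qed.

Lemma eq_dot f g : (forall k, dot f k = dot g k) -> dot f f = dot g g.
Proof. by move=> fg; rewrite fg dotC fg. Qed.

Definition norm_derivative y t f :=
  dot (h^-1 *: (y (h + t) - y t) - f) (h^-1 *: (y (h + t) - y t) - f)
    @[h --> 0^'] --> 0.

Lemma norm_derivative_continuous y t f : norm_derivative y t f ->
  dot (y (h + t) - y t) (y (h + t) - y t) @[h --> 0^'] --> 0.
Proof.
move=> yf.
pose D h := h^-1 *: (y (h + t) - y t).
apply: (@squeeze_cvg0 _ _ _ _ _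
    (fun h => h ^+ 2 * (2 * dot (D h - f) (D h - f) + 2 * dot f f))).
  near=> h; rewrite dot_ge0/=.
  have h0 : h != 0 by near: h; exact: nbhs_dnbhs_neq.
  have -> : y (h + t) - y t = h *: D h by rewrite scalerA divff// scale1r.
  rewrite dotZl dotZr mulrA -expr2 ler_wpM2l ?sqr_ge0//.
  by have := dot_leD (D h - f) f; rewrite subrK.
rewrite -[X in _ --> X](mul0r (2 * 0 + 2 * dot f f)).
apply: cvgM.
  rewrite [X in _ --> X](_ : _ = 0 ^+ 2); last by rewrite expr0n.
  by apply: cvg_within_filter; exact: exprn_continuous.
apply: cvgD; last exact: cvg_cst.
by apply: cvgM => //; exact: cvg_cst.
Unshelve. all: by end_near. Qed.

Lemma is_derive_dot y z t f g : norm_derivative y t f -> norm_derivative z t g ->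
  is_derive t 1 (fun s => dot (y s) (z s)) (dot f (z t) + dot (y t) g).
Proof.
move=> yf zg.
have H : h^-1 *: (dot (y (h *: 1 + t)) (z (h *: 1 + t)) - dot (y t) (z t))
    @[h --> 0^'] --> dot f (z t) + dot (y t) g.
  have -> : (fun h => h^-1 *: (dot (y (h *: 1 + t)) (z (h *: 1 + t)) -
      dot (y t) (z t))) = (fun h => dot (h^-1 *: (y (h + t) - y t)) (z (h + t)) +
      dot (h^-1 *: (z (h + t) - z t)) (y t)).
    apply/funext => h; rewrite [h%:A]mulr1.
    rewrite !dotE (dotC (z (h + t))) (dotC (z t)).
    by rewrite /GRing.scale/=; ring.
  apply: cvgD; first by apply: dot_cvg => //; exact: norm_derivative_continuous zg.
  by rewrite (dotC _ g); exact: dot_cvgl.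
apply: DeriveDef; first by apply/cvg_ex; eexists; exact: H.
by rewrite /derive; apply/cvg_lim.
Qed.

Lemma norm_derivative_rev y t s f : norm_derivative y (t - s) f ->
  norm_derivative (fun s => y (t - s)) s (- f).
Proof.
move=> yf; rewrite /norm_derivative.
pose D h := h^-1 *: (y (h + (t - s)) - y (t - s)).
have -> : (fun h => dot (h^-1 *: (y (t - (h + s)) - y (t - s)) - - f)
   (h^-1 *: (y (t - (h + s)) - y (t - s)) - - f)) =
   (fun h => dot (D h - f) (D h - f)) \o -%R.
  apply/funext => h /=; rewrite /D invrN scaleNr.
  rewrite (_ : - h + (t - s) = t - (h + s)); last by ring.
  by rewrite -opprD dotNl dotNr !opprK.
apply: cvg_comp; last exact: yf.
move=> A [e /= e0 eA]; exists e => // h /= he h0; apply: eA; rewrite ?oppr_eq0//=.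
by move: he; rewrite /= !sub0r normrN opprK.
Qed.

(** * Resolutions of the identity and their measures *)

Variable proj : R -> V -> V.
Hypothesis proj_linear : forall xi a f g k,
  dot (proj xi (a *: f + g)) k = a * dot (proj xi f) k + dot (proj xi g) k.
Hypothesis proj_sym : forall xi f g, dot (proj xi f) g = dot f (proj xi g).
Hypothesis proj_meet : forall a b f g,
  dot (proj a (proj b f)) g = dot (proj (Num.min a b) f) g.
Hypothesis proj_lt0 : forall xi f g, xi < 0 -> dot (proj xi f) g = 0.
Hypothesis proj_cvg : forall f,
  dot (proj xi f - f) (proj xi f - f) @[xi --> +oo] --> 0.
Variable cdf : V -> cumulative R R.
Hypothesis cdfE : forall f xi, cdf f xi = dot (proj xi f) f.
Local Notation sm f := (lebesgue_stieltjes_measure (cdf f)).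

Let cdf_lt0 f xi : xi < 0 -> cdf f xi = 0.
Proof. by move=> xi0; rewrite cdfE proj_lt0. Qed.

Let projB xi f g k : dot (proj xi (f - g)) k = dot (proj xi f) k - dot (proj xi g) k.
Proof. by rewrite addrC -scaleN1r proj_linear mulN1r addrC. Qed.

Lemma proj_sqr xi f : dot (proj xi f) (proj xi f) = dot (proj xi f) f.
Proof. by rewrite -proj_sym proj_meet minxx. Qed.

Lemma proj_contraction xi f : dot (proj xi f) f <= dot f f.
Proof.
have := dot_ge0 (f - proj xi f).
rewrite !dotE proj_sqr (dotC f (proj xi f)); lra.
Qed.

(** The spectral projection onto [`]a, b]]. *)
Definition cell a b f := proj b f - proj a f.

Lemma cell_sym a b f g : dot (cell a b f) g = dot f (cell a b g).
Proof. by rewrite /cell !dotE proj_sym (proj_sym a). Qed.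

Lemma cellB a b f g k :
  dot (cell a b (f - g)) k = dot (cell a b f) k - dot (cell a b g) k.
Proof. by rewrite /cell !dotE !projB; ring. Qed.

Lemma cellZ a b c f k : dot (cell a b (c *: f)) k = c * dot (cell a b f) k.
Proof. by rewrite cell_sym dotZl -cell_sym. Qed.

Lemma proj_cell xi a b f g : dot (proj xi (cell a b f)) g =
  dot (proj (Num.min xi b) f) g - dot (proj (Num.min xi a) f) g.
Proof. by rewrite /cell projB !proj_meet. Qed.

Lemma cell_idem a b f g : a <= b ->
  dot (cell a b (cell a b f)) g = dot (cell a b f) g.
Proof.
move=> ab; rewrite /cell !dotE -!/(cell _ _ _) !proj_cell !minxx.
by rewrite (min_r ab) (min_l ab); ring.
Qed.

Lemma cell_sqr a b f : a <= b ->
  dot (cell a b f) (cell a b f) = dot (cell a b f) f.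
Proof. by move=> ab; rewrite -cell_sym cell_idem. Qed.

Lemma cell_sqrE a b f : a <= b ->
  dot (cell a b f) (cell a b f) = cdf f b - cdf f a.
Proof. by move=> ab; rewrite cell_sqr// /cell !dotE !cdfE. Qed.

Lemma cdf_ge0 f xi : 0 <= cdf f xi.
Proof. by rewrite cdfE -proj_sqr dot_ge0. Qed.

Lemma cell_contraction a b f : a <= b ->
  dot (cell a b f) (cell a b f) <= dot f f.
Proof.
move=> ab; rewrite cell_sqrE// (@le_trans _ _ (cdf f b))//.
  by rewrite gerBl cdf_ge0.
by rewrite cdfE proj_contraction.
Qed.

Lemma cdf_cvg f : cdf f xi @[xi --> +oo] --> dot f f.
Proof.
rewrite (_ : cdf f = (fun xi => dot (proj xi f) f) :> (R -> R)); last first.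
  by apply/funext => xi; rewrite cdfE.
by apply: dot_cvgl; exact: proj_cvg.
Qed.

Lemma spectral_measure_itv f a b : a <= b ->
  sm f `]a, b]%classic = (cdf f b - cdf f a)%:E.
Proof.
move=> ab; rewrite /lebesgue_stieltjes_measure/=.
rewrite /measure_extension/= measurable_mu_extE//=; last exact: is_ocitv.
exact: wlength_itv_bnd.
Qed.

Lemma spectral_measure_cell f a b : a <= b ->
  sm f `]a, b]%classic = (dot (cell a b f) (cell a b f))%:E.
Proof. by move=> ab; rewrite spectral_measure_itv// cell_sqrE. Qed.

Lemma spectral_measure_bigcup0 f (A : (set R)^nat) :
  (forall n, measurable (A n)) -> (forall n, sm f (A n) = 0%E) ->
  sm f (\bigcup_n A n) = 0%E.
Proof.
move=> mA A0; apply/eqP; rewrite eq_le measure_ge0 andbT.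
have := @measure_sigma_subadditive _ _ _ (sm f) (\bigcup_n A n) A mA
  (bigcupT_measurable _ mA) (fun _ Ax => Ax).
by rewrite eseries0// => n _ _; exact: A0.
Qed.

Lemma spectral_measure_lt0 f : sm f `]-oo, 0[%classic = 0%E.
Proof.
apply/eqP; rewrite eq_le measure_ge0 andbT.
pose A n := `]- n.+1%:R, - (n.+1%:R^-1) : R]%classic.
have sub : `]-oo, 0[ `<=` \bigcup_n A n.
  move=> x /=; rewrite in_itv/= => x0.
  have nx0 : 0 < - x by rewrite oppr_gt0.
  have [n _ nx] := near_infty_natSinv_lt (PosNum nx0).
  have [k xk] := exists_natr_gt (- x).
  exists (maxn n k) => //; rewrite /A /= in_itv/=.
  have mx : (maxn n k).+1%:R^-1 < - x by apply: nx => /=; rewrite leq_maxl.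
  apply/andP; split; last by rewrite lerNr ltW.
  by rewrite ltrNl (lt_le_trans xk)// ler_nat ltnS leq_maxr.
apply: (@le_trans _ _ (sm f (\bigcup_n A n))).
  apply: le_measure; rewrite ?inE; [exact: measurable_itv| |exact: sub].
  by apply: bigcupT_measurable => n; exact: measurable_itv.
have A0 n : sm f (A n) = 0%E.
  have i0 : n.+1%:R^-1 > 0 :> R by rewrite invr_gt0.
  have le1 : - n.+1%:R <= - n.+1%:R^-1 :> R.
    by rewrite lerN2 (@le_trans _ _ 1)// ?invf_le1 ?ltr0n// ler1n.
  rewrite spectral_measure_itv// !cdf_lt0 ?subrr// ?oppr_lt0//.
by rewrite spectral_measure_bigcup0// => n; exact: measurable_itv.
Qed.

Lemma spectral_measure_setT f : sm f setT = (dot f f)%:E.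
Proof.
pose A n := `]- n.+1%:R, n.+1%:R : R]%classic.
have AT : \bigcup_n A n = setT.
  rewrite -subTset => x _; have [n xn] := exists_natr_gt `|x|.
  exists n => //; rewrite /A /= in_itv/=.
  by move: xn; rewrite ltr_norml => /andP[-> /ltW ->].
have c1 : sm f (A n) @[n --> \oo] --> sm f setT.
  rewrite -AT; apply: nondecreasing_cvg_mu => //.
  - by move=> n; exact: measurable_itv.
  - by apply: bigcupT_measurable => n; exact: measurable_itv.
  - move=> n m nm; apply/subsetPset => x; rewrite /A /= !in_itv/= => /andP[].
    have : n.+1%:R <= m.+1%:R :> R by rewrite ler_nat ltnS.
    by move=> ? ? ?; apply/andP; split; lra.
have c2 : sm f (A n) @[n --> \oo] --> (dot f f)%:E.
  rewrite (_ : (fun n => _) = (fun n => (cdf f n.+1%:R)%:E)).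
    apply: cvg_EFin; first exact: nearW.
    apply: (@cvg_comp _ _ _ (fun n => n.+1%:R : R) (cdf f) _ +oo).
      by have := @cvgr_idn R; rewrite -(cvg_shiftS (fun n => n%:R : R)).
    exact: cdf_cvg.
  apply/funext => n; rewrite spectral_measure_itv; last first.
    by rewrite (@le_trans _ _ 0)// oppr_le0.
  by rewrite (@cdf_lt0 _ (- _)) ?subr0// oppr_lt0.
exact: (cvg_unique _ c1 c2).
Qed.

Lemma eq_spectral_integral f g (D : set R) (k : R -> \bar R) :
  cdf f =1 cdf g ->
  (\int[sm f]_(xi in D) k xi = \int[sm g]_(xi in D) k xi)%E.
Proof.
move=> fg; apply: eq_measure_integral => A mA _.
have H X : ocitv X -> sm f X = sm g X.
  move=> /ocitvP[->|[x x12 ->]]; first by transitivity (0%E : \bar R); [|apply: esym]; exact: measure0.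
  by rewrite !(spectral_measure_itv _ (ltW x12)) !fg.
exact: (lebesgue_stieltjes_measure_unique H mA).
Qed.

Definition in_cell a b f := forall k, dot (cell a b f) k = dot f k.

Lemma cell_in_cell a b f : a <= b -> in_cell a b (cell a b f).
Proof. by move=> ab h; exact: cell_idem. Qed.

Lemma in_cellD a b f g : in_cell a b f -> in_cell a b g -> in_cell a b (f + g).
Proof.
move=> cf cg h; rewrite -[g in LHS]opprK cellB dotDl cf -[- g]sub0r cellB.
by rewrite cell_sym dot0l sub0r opprK cg.
Qed.

Lemma in_cellB a b f g : in_cell a b f -> in_cell a b g -> in_cell a b (f - g).
Proof. by move=> cf cg h; rewrite cellB dotBl cf cg. Qed.

Lemma proj_in_cell xi f : 0 <= xi -> in_cell (-1) xi (proj xi f).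
Proof.
move=> xi0 h; rewrite /cell dotBl !proj_meet minxx min_l; last lra.
by rewrite (@proj_lt0 (-1)) ?subr0// oppr_lt0.
Qed.

Lemma cell_projC xi a b f g :
  dot (proj xi (cell a b f)) g = dot (proj xi f) (cell a b g).
Proof.
by rewrite -cell_sym proj_cell /cell dotBl !proj_meet (minC b) (minC a).
Qed.

(** The projections commute with those of the cells, so that for a vector in the
    range of a cell only the part of the index inside the cell matters. *)
Lemma cdf_in_cell a b f xi : in_cell a b f ->
  cdf f xi =
  cdf f (Num.min xi b) - cdf f (Num.min xi a).
Proof.
move=> cf; rewrite !cdfE -proj_cell cell_projC.
by rewrite [RHS]dotC cf dotC.
Qed.

Lemma spectral_measure_in_cell a b f : a <= b -> in_cell a b f ->
  sm f (~` `]a, b]%classic) = 0%E.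
Proof.
move=> ab cf.
have cdf_lo (x : R) : x <= a -> cdf f x = 0.
  move=> xa; rewrite (cdf_in_cell _ cf) (min_l xa) min_l ?subrr//.
  exact: le_trans ab.
have cdf_hi (x : R) : b <= x -> cdf f x = cdf f b.
  move=> bx; rewrite (cdf_in_cell _ cf) (min_r bx) min_r.
    by rewrite (cdf_lo a)// subr0.
  exact: le_trans bx.
pose A n := (`]a - n.+1%:R, a] `|` `]b, b + n.+1%:R])%classic.
have mA n : measurable (A n) by apply: measurableU; exact: measurable_itv.
have sub : ~` `]a, b]%classic `<=` \bigcup_n A n.
  move=> x /=; rewrite in_itv/= => xab.
  have [n H] := exists_natr_gt (`|x - a| + `|x - b|); exists n => //.
  have := ler_norm (a - x); have := ler_norm (x - b).
  have := normr_ge0 (x - a); have := normr_ge0 (x - b).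
  rewrite (distrC a) => *; rewrite /A/= !in_itv/=.
  have [xa|ax] := leP x a; first by left; apply/andP; split => //; lra.
  by right; move: xab; rewrite ax/= => /negP; rewrite -ltNge => ->/=; lra.
apply/eqP; rewrite eq_le measure_ge0 andbT.
apply: (@le_trans _ _ (sm f (\bigcup_n A n))).
  apply: le_measure; rewrite ?inE; [|exact: bigcupT_measurable|exact: sub].
  by apply: measurableC; exact: measurable_itv.
rewrite spectral_measure_bigcup0// => n.
have n0 : 0 <= n.+1%:R :> R by [].
apply/eqP; rewrite eq_le measure_ge0 andbT.
apply: (@le_trans _ _ (sm f `](a - n.+1%:R)%R, a] + sm f `]b, (b + n.+1%:R)%R])%E).
  by apply: measureU2; exact: measurable_itv.
rewrite !spectral_measure_itv; [|lra..].
by rewrite (cdf_lo a)// (cdf_lo (a - _)) ?gerBl// cdf_hi ?lerDl// !subrr adde0.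
Qed.

Lemma spectral_measure_ge0 f : sm f `[0, +oo[%classic = (dot f f)%:E.
Proof.
rewrite -spectral_measure_setT -[LHS]add0e -(spectral_measure_lt0 f).
rewrite -measureU; [|exact: measurable_itv..|]; last first.
  by apply/seteqP; split=> // x []/=; rewrite !in_itv/= andbT leNgt => ->.
congr (sm f _); apply/seteqP; split=> // x _.
by rewrite /= !in_itv/= andbT; case: (ltP (x : R) 0) => ?; [left|right].
Qed.

(** On the range of a cell the measure sits on the cell, so that the moments
    lie between powers of its ends. *)
Lemma moment_in_cell a b f (k : nat) : a <= b -> in_cell a b f ->
  ((Num.max a 0 ^+ k * dot f f)%:E
     <= \int[sm f]_(xi in `[0%R, +oo[) (xi ^+ k)%:E
     <= (Num.max b 0 ^+ k * dot f f)%:E)%E.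
Proof.
move=> ab cf.
have mk : measurable_fun setT (fun xi : R => (xi ^+ k)%:E).
  by apply/measurable_EFinP; exact: measurable_funX.
have aeab (Q : R -> Prop) : (forall xi, a < xi <= b -> Q xi) ->
    {ae sm f, forall xi, Q xi}.
  move=> Qab; exists (~` `]a, b]%classic); split.
  - by apply: measurableC; exact: measurable_itv.
  - exact: spectral_measure_in_cell.
  - by move=> x /= nQ; rewrite in_itv/= => /Qab.
have cstE (c : R) : (c * dot f f)%:E = (\int[sm f]_(xi in `[0%R, +oo[) c%:E)%E.
  by rewrite integral_cst//= EFinM -spectral_measure_ge0.
rewrite !cstE; apply/andP; split; apply: ae_ge0_le_integral => //.
- by move=> x _; rewrite lee_fin exprn_ge0// le_max lexx orbT.
- by move=> x /=; rewrite in_itv/= andbT => x0; rewrite lee_fin exprn_ge0.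
- exact: measurable_funS mk.
- apply: aeab => x /andP[ax xb].
  rewrite /= in_itv/= andbT => x0; rewrite lee_fin lerXn2r ?nnegrE//.
    by rewrite le_max lexx orbT.
  by rewrite ge_max (ltW ax).
- by move=> x /=; rewrite in_itv/= andbT => x0; rewrite lee_fin exprn_ge0.
- exact: measurable_funS mk.
- by move=> x _; rewrite lee_fin exprn_ge0// le_max lexx orbT.
- apply: aeab => x /andP[ax xb].
  rewrite /= in_itv/= andbT => x0; rewrite lee_fin lerXn2r ?nnegrE//.
    by rewrite le_max lexx orbT.
  by rewrite le_max xb.
Qed.

(** * The semigroup of the operator with a given resolution *)

Variable P : R -> V -> V.
Hypothesis P_linear : forall t a u v k, 0 <= t ->
  dot (P t (a *: u + v)) k = a * dot (P t u) k + dot (P t v) k.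
Hypothesis P_semigroup : forall s t u k, 0 <= s -> 0 <= t ->
  dot (P (s + t) u) k = dot (P s (P t u)) k.
Hypothesis P_contraction : forall t u, 0 <= t -> dot (P t u) (P t u) <= dot u u.
Hypothesis P0 : forall u k, dot (P 0 u) k = dot u k.

Let P0r u k : dot k (P 0 u) = dot k u.
Proof. by rewrite dotC P0 dotC. Qed.

Definition quotient t u : V := t^-1 *: (P t u - u).

Definition infinitesimal_generator u v : Prop :=
  dot (quotient t u - v) (quotient t u - v) @[t --> 0^'+] --> 0.
Local Notation gen := infinitesimal_generator.

Hypothesis gen_domain : forall u,
  (\int[sm u]_(xi in `[0%R, +oo[) (xi ^+ 2)%:E < +oo)%E -> exists v, gen u v.
Hypothesis gen_form : forall u v u' v', gen u v -> gen u' v' ->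
  - dot v u' = 4^-1 * (\int[sm (u + u')]_(xi in `[0, +oo[) xi -
                       \int[sm (u - u')]_(xi in `[0, +oo[) xi).

Let PB t u v k : 0 <= t -> dot (P t (u - v)) k = dot (P t u) k - dot (P t v) k.
Proof. by move=> t0; rewrite addrC -scaleN1r P_linear// mulN1r addrC. Qed.

Let PZ t a u k : 0 <= t -> dot (P t (a *: u)) k = a * dot (P t u) k.
Proof.
move=> t0; rewrite -[a *: u]addr0 P_linear// -[X in _ + dot (P t X) k](subrr u).
by rewrite PB// subrr addr0.
Qed.

Let P_Bcontraction t u v : 0 <= t ->
  dot (P t u - P t v) (P t u - P t v) <= dot (u - v) (u - v).
Proof.
move=> t0; apply: le_trans (P_contraction (u - v) t0).
by rewrite (@eq_dot (P t u - P t v) (P t (u - v)))// => k; rewrite dotBl PB.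
Qed.

Let genB u v u' v' : gen u v -> gen u' v' -> gen (u - u') (v - v').
Proof.
move=> uv uv'; apply: (@squeeze_cvg0 _ _ _ _ _ (fun t =>
    2 * dot (quotient t u - v) (quotient t u - v) +
    2 * dot (quotient t u' - v') (quotient t u' - v'))).
  near=> t; rewrite dot_ge0/=; apply: le_trans (dot_leB _ _).
  rewrite le_eqVlt; apply/orP; left; apply/eqP/eq_dot => k.
  rewrite /quotient !dotE PB; last by near: t; exact: nbhs_right_ge.
  by ring.
rewrite -[X in _ --> X](add0r 0).
by apply: cvgD; rewrite -[X in _ --> X](mulr0 2); apply: cvgM => //; exact: cvg_cst.
Unshelve. all: by end_near. Qed.

Let P_stepE s t u k : 0 <= s -> s <= t -> dot (P t u) k = dot (P s (P (t - s) u)) k.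
Proof. by move=> s0 st; rewrite -P_semigroup ?subr_ge0// subrKC. Qed.

Let P_dist_le s t u : 0 <= s -> s <= t ->
  dot (P s u - P t u) (P s u - P t u) <=
  dot (P (t - s) u - u) (P (t - s) u - u).
Proof.
move=> s0 st; have -> : dot (P (t - s) u - u) (P (t - s) u - u) = dot (u - P (t - s) u) (u - P (t - s) u).
  by rewrite -opprB dotNl dotNr opprK.
 apply: le_trans (P_Bcontraction _ _ s0).
rewrite le_eqVlt; apply/orP; left; apply/eqP/eq_dot => k.
by rewrite !dotBl (P_stepE _ _ s0 st).
Qed.

Let gen_P u v s : 0 <= s -> gen u v -> gen (P s u) (P s v).
Proof.
move=> s0; apply: squeeze_cvg0; near=> t.
have t0 : 0 <= t by near: t; exact: nbhs_right_ge.
rewrite dot_ge0/=; apply: le_trans (P_Bcontraction _ _ s0).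
rewrite le_eqVlt; apply/orP; left; apply/eqP/eq_dot => k.
by rewrite /quotient !dotE PZ// PB// -!P_semigroup// (addrC s).
Unshelve. all: by end_near. Qed.

(** The spectral measure of such a vector has a finite second moment. *)
Let in_cell_domain a b u : a <= b -> in_cell a b u -> exists v, gen u v.
Proof.
move=> ab cu; apply: gen_domain.
have /andP[_ /le_lt_trans] := moment_in_cell 2 ab cu.
by apply; rewrite ltry.
Qed.

(** The spectral measures of [u - u'] and [u' - u] agree, so that the polarized
    form is symmetric. *)
Let gen_sym u v u' v' : gen u v -> gen u' v' -> dot v u' = dot u v'.
Proof.
move=> uv uv'; rewrite (dotC u); apply: oppr_inj.
rewrite (gen_form uv uv') (gen_form uv' uv).
have projN xi w k : dot (proj xi (- w)) k = - dot (proj xi w) k.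
  by rewrite -[- w]sub0r projB proj_sym dot0l sub0r.
have E : cdf (u - u') =1 cdf (u' - u).
  by move=> xi; rewrite !cdfE -[in RHS]opprB dotNr projN opprK.
by rewrite (addrC u) /Rintegral (eq_spectral_integral _ _ E).
Qed.

(** The generator is minus multiplication by the spectral parameter: on a cell
    its quadratic form lies between minus the ends. A vector orthogonal to the
    cell does not contribute, since adding or subtracting it gives the same
    distribution function. *)
Let gen_cell a b u v : a <= b -> gen u v ->
  a * dot (cell a b u) (cell a b u) <= - dot v (cell a b u)
  <= b * dot (cell a b u) (cell a b u).
Proof.
move=> ab uv; set x := cell a b u.
have cx : in_cell a b x := cell_in_cell u ab.
have [y xy] := in_cell_domain ab cx.
have uxvy := genB uv xy.
have orth : - dot y (u - x) = 0.
  rewrite (gen_form xy uxvy) /Rintegral.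
  have projN xi w k : dot (proj xi (- w)) k = - dot (proj xi w) k.
    by rewrite -[- w]sub0r projB proj_sym dot0l sub0r.
  have E : cdf (x + (u - x)) =1 cdf (x - (u - x)).
    move=> xi; have x0 : dot (proj xi x) (u - x) = 0.
      by rewrite {1}/x cell_projC dotC cellB cell_idem ?subrr.
    have x0' : dot (proj xi (u - x)) x = 0 by rewrite proj_sym dotC.
    have projD w k : dot (proj xi (x + w)) k = dot (proj xi x) k + dot (proj xi w) k.
      by rewrite -[in LHS](opprK w) projB projN opprK.
    move: (u - x) x0 x0' => w x0 x0'.
    clearbody x; rewrite !cdfE !projD !projN !dotDr !dotNr x0 x0'; ring.
  by rewrite (eq_spectral_integral _ _ E) subrr mulr0.
have vxE : - dot v x = - dot y x.
  rewrite (gen_sym uv xy) dotC; congr (- _).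
  by apply/eqP; rewrite -subr_eq0 -dotBr -oppr_eq0 orth.
rewrite vxE (gen_form xy xy) /Rintegral.
have /andP[m1 m2] := moment_in_cell 1 ab (in_cellD cx cx).
have /andP[n1 n2] := moment_in_cell 1 ab (in_cellB cx cx).
have n0 : (\int[sm (x - x)]_(xi in `[0%R, +oo[) (xi ^+ 1)%:E)%E = 0%E.
  by apply/eqP; rewrite eq_le; move: n1 n2; rewrite subrr dot0l !mulr0 => -> ->.
move: m1 m2; rewrite !expr1 in n0 *; rewrite n0/= subr0.
set I := (\int[_]_(_ in _) _)%E => m1 m2.
have If : I \is a fin_num.
  by rewrite fin_numElt (lt_le_trans _ m1) ?(le_lt_trans m2)// ?ltry ?ltNyr.
have q4 : dot (x + x) (x + x) = 4 * dot x x by rewrite !dotE; ring.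
move: m1 m2; rewrite -(fineK If) !lee_fin q4 => m1 m2.
have q0 := dot_ge0 x.
apply/andP; split.
  have : a * dot x x <= Num.max a 0 * dot x x by rewrite ler_wpM2r// le_max lexx.
  lra.
have [b0|b0] := leP 0 b; first by move: m2; rewrite (max_l b0); lra.
have x0 : dot x x = 0.
  by rewrite cell_sqrE// !cdf_lt0 ?subrr// (le_lt_trans ab b0).
by move: m2; rewrite x0; lra.
Qed.

Let quotientK t u : t != 0 -> t *: quotient t u = P t u - u.
Proof. by move=> t0; rewrite /quotient scalerA divff// scale1r. Qed.

Let gen_cvg u v : gen u v -> dot (P t u - u) (P t u - u) @[t --> 0^'+] --> 0.
Proof.
move=> uv; apply: (@squeeze_cvg0 _ _ _ _ _ (fun t => t ^+ 2 *
  (2 * dot (quotient t u - v) (quotient t u - v) + 2 * dot v v))).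
  near=> t; rewrite dot_ge0/= -quotientK; last first.
    by rewrite gt_eqF//; near: t; exact: nbhs_right_gt.
  rewrite dotZl dotZr mulrA -expr2 ler_wpM2l ?sqr_ge0//.
  by have := dot_leD (quotient t u - v) v; rewrite subrK.
rewrite -[X in _ --> X](mul0r (2 * 0 + 2 * dot v v)).
apply: cvgM.
  rewrite [X in _ --> X](_ : _ = 0 ^+ 2); last by rewrite expr0n.
  by apply: cvg_within_filter; exact: exprn_continuous.
apply: cvgD; last exact: cvg_cst.
by apply: cvgM => //; exact: cvg_cst.
Unshelve. all: by end_near. Qed.

Let proj_domain n u : 0 <= n -> exists v, gen (proj n u) v.
Proof.
by move=> n0; apply: in_cell_domain (proj_in_cell u n0); apply: le_trans n0.
Qed.

(** Strong continuity holds on the domain of the generator, which is dense, and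
    extends to the whole space as the operators are contractions. *)
Let P_cvg0 u : dot (P t u - u) (P t u - u) @[t --> 0^'+] --> 0.
Proof.
apply/cvgr0Pnorm_le => e e0.
have /cvgr0Pnorm_le /(_ (e / 12)) : dot (proj xi u - u) (proj xi u - u) @[xi --> +oo] --> 0.
  exact: proj_cvg.
rewrite divr_gt0// => /(_ isT) [M [_ HM]].
pose n := `|M| + 1; pose w := proj n u.
have wu : dot (u - w) (u - w) <= e / 12.
  rewrite -opprB dotNl dotNr opprK; apply: le_trans (HM n _); first exact: ler_norm.
  by rewrite /n (le_lt_trans (ler_norm _))// ltrDl.
have n0 : 0 <= n by rewrite addr_ge0.
have [v /gen_cvg /cvgr0Pnorm_le /(_ (e / 8))] := proj_domain u n0.
rewrite divr_gt0// => /(_ isT) wv; near=> t.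
have t0 : 0 <= t by near: t; exact: nbhs_right_ge.
have wt : dot (P t w - w) (P t w - w) <= e / 8.
  by apply: le_trans (ler_norm _) _; near: t.
rewrite ger0_norm ?dot_ge0//.
have -> : P t u - u = (P t u - P t w) + ((P t w - w) - (u - w)).
  rewrite [X in _ = _ + X](_ : _ = P t w - u); first by rewrite addrA subrK.
  by rewrite opprB addrA subrK.
apply: le_trans (dot_leD _ _) _.
have := dot_leB (P t w - w) (u - w); have := P_Bcontraction u w t0; lra.
Unshelve. all: by end_near. Qed.

Let P_cvg_left u t : 0 < t ->
  dot (P (t - s) u - P t u) (P (t - s) u - P t u) @[s --> 0^'+] --> 0.
Proof.
move=> t0; apply: squeeze_cvg0 (P_cvg0 u); near=> s.
have st : s <= t by near: s; exact: nbhs_right_le.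
have s0 : 0 <= s by near: s; exact: nbhs_right_ge.
have ts0 : 0 <= t - s by lra.
have tst : t - s <= t by lra.
have := P_dist_le u ts0 tst; rewrite subKr => ->.
by rewrite dot_ge0.
Unshelve. all: by end_near. Qed.

Let P_cvg_end u t : 0 < t ->
  dot (P s u - P t u) (P s u - P t u) @[s --> t^'-] --> 0.
Proof.
move=> /(P_cvg_left u) /cvg_at_left_rev => /(_ t).
by under eq_cvg do rewrite subKr.
Qed.

(** The difference quotient on the left of [t] is the one at [0] transported to
    time [t - k]; moving it on to [t] costs as little as one wishes by strong
    continuity. *)
Let P_derivative u v t : 0 < t -> gen u v ->
  norm_derivative (fun s => P s u) t (P t v).
Proof.
move=> t0 uv.
pose phi (k : R) := 2 * dot (quotient k u - v) (quotient k u - v) +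
   2 * dot (P k v - v) (P k v - v).
have phi0 : phi k @[k --> 0^'+] --> 0.
  rewrite -[X in _ --> X](add0r 0).
  by apply: cvgD; rewrite -[X in _ --> X](mulr0 2);
    apply: cvgM (cvg_cst _) _ => //; exact: P_cvg0.
have phih : (fun h : R => phi `|h|) @ 0^' --> 0.
  apply: (@cvg_comp _ _ _ (fun h : R => `|h|) phi _ (0^'+)) => //.
  exact: norm_cvg_at_right0.
apply: squeeze_cvg0 phih; near=> h.
have h0 : h != 0 by near: h; exact: nbhs_dnbhs_neq.
have ht : `|h| < t.
  near: h; apply: dnbhs0_lt => //.
rewrite dot_ge0/=.
have quotientP s (k : R) : 0 <= s -> k != 0 -> 0 <= k -> forall f,
    dot (k^-1 *: (P (s + k) u - P s u)) f = dot (P s (quotient k u)) f.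
  move=> s0 k0 k0' f; rewrite /quotient !dotE PZ// PB// P_semigroup//.
have [hp|hn] := ltP 0 h.
  rewrite gtr0_norm//; apply: (@le_trans _ _ (dot (quotient h u - v) (quotient h u - v))).
    apply: le_trans (P_Bcontraction _ _ (ltW t0)).
    rewrite le_eqVlt; apply/orP; left; apply/eqP/eq_dot => f.
    by rewrite !dotBl (addrC h) quotientP// ltW.
  rewrite /phi; have := dot_ge0 (quotient h u - v); have := dot_ge0 (P h v - v); lra.
rewrite ler0_norm// in ht *; set k := - h in ht *.
have k0 : 0 <= k by rewrite oppr_ge0.
have m0 : 0 <= t - k by lra.
apply: (@le_trans _ _ (dot ((P (t - k) (quotient k u) - P (t - k) v) +
    (P (t - k) v - P t v)) ((P (t - k) (quotient k u) - P (t - k) v) +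
    (P (t - k) v - P t v)))).
  rewrite le_eqVlt; apply/orP; left; apply/eqP/eq_dot => f.
  rewrite addrA subrK !dotBl; congr (_ - _).
  rewrite -quotientP ?oppr_eq0// subrK /k invrN opprK (addrC t).
  by rewrite -[P (h + t) u - _]opprB scalerN scaleNr.
apply: le_trans (dot_leD _ _) _.
have mt : t - k <= t by lra.
have := P_Bcontraction (quotient k u) v m0; have := P_dist_le v m0 mt.
rewrite subKr /phi; lra.
Unshelve. all: by end_near. Qed.

(** By symmetry of the generator [s |-> dot (P s u) (P (t - s) v)] has derivative
    [0], and its values at [t] and [0] are the two sides. *)
Let P_sym_domain u u' v v' t : 0 <= t -> gen u u' -> gen v v' ->
  dot (P t u) v = dot u (P t v).
Proof.
move=> t_ge0 uu' vv'; have [->|tn0] := eqVneq t 0; first by rewrite P0 P0r.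
have t0 : 0 < t by rewrite lt_neqAle eq_sym tn0.
pose f s := dot (P s u) (P (t - s) v).
have [c _] : exists2 c, c \in `]0, t[ & f t - f 0 = 0 * (t - 0).
  apply: (@MVT _ f (fun=> 0)) => //.
  - move=> s; rewrite in_itv/= => /andP[s0 st].
    have ts0 : 0 < t - s by rewrite subr_gt0.
    have := is_derive_dot (P_derivative s0 uu')
      (norm_derivative_rev (P_derivative ts0 vv')).
    have Pu := gen_P (ltW s0) uu'; have Pv := gen_P (ltW ts0) vv'.
    by rewrite (gen_sym Pu Pv) dotNr subrr.
  - apply/continuous_within_itvP => //; split.
    + move=> s; rewrite in_itv/= => /andP[s0 st].
      have ts0 : 0 < t - s by rewrite subr_gt0.
      have [df _] := is_derive_dot (P_derivative s0 uu')
        (norm_derivative_rev (P_derivative ts0 vv')).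
      exact/differentiable_continuous/derivable1_diffP.
    + rewrite /f subr0 P0; apply: dot_cvg; first exact: P_cvg0.
      exact: P_cvg_left.
    + rewrite /f subrr P0r; apply: dot_cvg; first exact: P_cvg_end.
      exact: (@cvg_at_left_rev _ (fun s => dot (P s v - v) (P s v - v)) t _ (P_cvg0 v)).
by rewrite mul0r => /eqP; rewrite subr_eq0 /f subrr subr0 P0 P0r => /eqP.
Qed.

(** The bounded cells have dense ranges, contained in the domain. *)
Lemma P_sym u v t : 0 <= t -> dot (P t u) v = dot u (P t v).
Proof.
move=> t0.
have cP w : dot (P t (proj n w) - P t w) (P t (proj n w) - P t w) @[n --> +oo] --> 0.
  apply: squeeze_cvg0 (proj_cvg w); apply: nearW => n.
  by rewrite dot_ge0 P_Bcontraction.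
have c1 : dot (P t (proj n u)) (proj n v) @[n --> +oo] --> dot (P t u) v.
  by apply: dot_cvg => //; exact: cP.
have c2 : dot (P t (proj n u)) (proj n v) @[n --> +oo] --> dot u (P t v).
  have c3 : dot (proj n u) (P t (proj n v)) @[n --> +oo] --> dot u (P t v).
    by apply: dot_cvg => //; exact: cP.
  apply: cvg_trans c3; apply: near_eq_cvg; near=> n.
  have n0 : 0 <= n by near: n; exact: nbhs_pinfty_ge.
  have [u' uu'] := proj_domain u n0; have [v' vv'] := proj_domain v n0.
  by rewrite (P_sym_domain t0 uu' vv').
exact: (cvg_unique _ c1 c2).
Unshelve. all: by end_near. Qed.

(** On a cell [y s := P s u] satisfies
    [- 2 b |y|^2 <= d/ds |y|^2 <= - 2 a |y|^2], hence decays at a rate between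
    [exp (- 2 b s)] and [exp (- 2 a s)]. *)
Let cell_decay_domain a b u v t : a <= b -> 0 <= t -> gen u v ->
  expR (- (2 * b * t)) * dot (cell a b u) (cell a b u)
    <= dot (cell a b (P t u)) (cell a b (P t u))
    <= expR (- (2 * a * t)) * dot (cell a b u) (cell a b u).
Proof.
move=> ab t_ge0 uv; have [->|tn0] := eqVneq t 0.
  rewrite !mulr0 oppr0 expR0 !mul1r.
  by rewrite (@eq_dot (cell a b (P 0 u)) (cell a b u)) ?lexx// => k; rewrite !cell_sym P0.
have t0 : 0 < t by rewrite lt_neqAle eq_sym tn0.
pose g s := dot (P s u) (cell a b (P s u)).
have gE s : g s = dot (cell a b (P s u)) (cell a b (P s u)).
  by rewrite /g dotC cell_sqr.
have cell_cvg (F : set_system R) (FF : Filter F) (w : R -> V) w0 :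
    dot (w i - w0) (w i - w0) @[i --> F] --> 0 ->
    dot (cell a b (w i) - cell a b w0) (cell a b (w i) - cell a b w0) @[i --> F] --> 0.
  apply: squeeze_cvg0; apply: nearW => i; rewrite dot_ge0/=.
  apply: le_trans (cell_contraction _ ab).
  rewrite le_eqVlt; apply/orP; left; apply/eqP/eq_dot => k.
  by rewrite cellB dotBl.
have cell_derive s : 0 < s -> norm_derivative (fun s => cell a b (P s u)) s (cell a b (P s v)).
  move=> s0; apply: squeeze_cvg0 (P_derivative s0 uv); apply: nearW => h.
  rewrite dot_ge0/=; apply: le_trans (cell_contraction _ ab).
  rewrite le_eqVlt; apply/orP; left; apply/eqP/eq_dot => k.
  rewrite [RHS]cellB dotBl cellZ dotZl cellB; congr (_ * _ - _); exact: dotBl.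
have dg s : 0 < s -> is_derive s 1 g (2 * dot (P s v) (cell a b (P s u))).
  move=> s0; apply: is_derive_eq (is_derive_dot (P_derivative s0 uv) (cell_derive _ s0)) _.
  by rewrite (dotC (P s u) (cell a b (P s v))) cell_sym; ring.
pose F c s := expR (2 * c * s) * g s.
have dF c s : 0 < s -> is_derive s 1 (F c)
    (expR (2 * c * s) * 2 * (c * g s + dot (P s v) (cell a b (P s u)))).
  move=> s0.
  have d1 : is_derive s 1 (fun s => expR (2 * c * s)) (expR (2 * c * s) * (2 * c)).
    apply: is_derive1_comp.
    have := @is_deriveZ _ _ _ id (2 * c) s 1 1 (is_derive_id _ _).
    by rewrite [_ *: 1]mulr1.
  have := is_deriveM d1 (dg _ s0).
  rewrite /GRing.scale/= => H; apply: is_derive_eq H _; ring.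
have cF c : {within `[0, t], continuous (F c)}.
  have cE : continuous (fun s : R => expR (2 * c * s)).
    move=> s; apply: (@continuous_comp _ _ _ (fun s => 2 * c * s) expR).
      exact: mulrl_continuous.
    exact: continuous_expR.
  apply/continuous_within_itvP => //; split.
  - move=> s; rewrite in_itv/= => /andP[s0 st].
    have [df _] := dF c s s0.
    exact/differentiable_continuous/derivable1_diffP.
  - apply: (@cvgM _ _ _ _ (fun s => expR (2 * c * s)) g).
      by apply: cvg_within_filter; exact: cE.
    have -> : g 0 = dot u (cell a b u) by rewrite /g P0 -cell_sym P0r cell_sym.
    apply: (@dot_cvg _ _ _ (fun s => P s u) (fun s => cell a b (P s u))).
      exact: P_cvg0.
    by apply: cell_cvg; exact: P_cvg0.
  - apply: (@cvgM _ _ _ _ (fun s => expR (2 * c * s)) g).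
      by apply: cvg_within_filter; exact: cE.
    apply: (@dot_cvg _ _ _ (fun s => P s u) (fun s => cell a b (P s u))).
      exact: P_cvg_end.
    by apply: cell_cvg; exact: P_cvg_end.
have mvt c : exists2 s, 0 < s & F c t - F c 0 =
    expR (2 * c * s) * 2 * (c * g s + dot (P s v) (cell a b (P s u))) * t.
  have [s sI|s sI ->] := @MVT _ (F c) (fun s => expR (2 * c * s) * 2 *
      (c * g s + dot (P s v) (cell a b (P s u)))) 0 t t0 _ (cF c).
    by apply: dF; move: sI; rewrite in_itv/= => /andP[].
  by exists s; [move: sI; rewrite in_itv/= => /andP[]|rewrite subr0].
have F0 c : F c 0 = dot (cell a b u) (cell a b u).
  by rewrite /F mulr0 expR0 mul1r /g P0 -cell_sym P0r cell_sym cell_sqr// cell_sym.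
have FE c : dot (cell a b (P t u)) (cell a b (P t u)) = expR (- (2 * c * t)) * F c t.
  by rewrite /F mulrA -expRD addNr expR0 mul1r gE.
apply/andP; split.
- rewrite (FE b) ler_wpM2l ?expR_ge0// -(F0 b) -subr_ge0.
  have [s s0 ->] := mvt b; rewrite !mulr_ge0 ?expR_ge0// ?(ltW t0)//.
  have /andP[_] := gen_cell ab (gen_P (ltW s0) uv).
  by rewrite -gE; lra.
- rewrite (FE a) ler_wpM2l ?expR_ge0// -(F0 a) -subr_le0.
  have [s s0 ->] := mvt a; rewrite mulr_le0_ge0 ?(ltW t0)// mulr_ge0_le0 ?mulr_ge0 ?expR_ge0//.
  have /andP[+ _] := gen_cell ab (gen_P (ltW s0) uv).
  by rewrite -gE; lra.
Qed.

(** The inequalities pass to the limit from [proj n u], which is in the domain. *)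
Lemma cell_decay a b u t : a <= b -> 0 <= t ->
  expR (- (2 * b * t)) * dot (cell a b u) (cell a b u)
    <= dot (cell a b (P t u)) (cell a b (P t u))
    <= expR (- (2 * a * t)) * dot (cell a b u) (cell a b u).
Proof.
move=> ab t0.
have cQ : dot (cell a b (proj n u)) (cell a b (proj n u)) @[n --> +oo] -->
    dot (cell a b u) (cell a b u).
  suff H : dot (cell a b (proj n u) - cell a b u)
      (cell a b (proj n u) - cell a b u) @[n --> +oo] --> 0 by exact: dot_cvg.
  apply: squeeze_cvg0 (proj_cvg u); apply: nearW => i; rewrite dot_ge0/=.
  apply: le_trans (cell_contraction _ ab).
  rewrite le_eqVlt; apply/orP; left; apply/eqP/eq_dot => k.
  by rewrite cellB dotBl.
have cP : dot (cell a b (P t (proj n u))) (cell a b (P t (proj n u))) @[n --> +oo] -->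
    dot (cell a b (P t u)) (cell a b (P t u)).
  suff H : dot (cell a b (P t (proj n u)) - cell a b (P t u))
      (cell a b (P t (proj n u)) - cell a b (P t u)) @[n --> +oo] --> 0 by exact: dot_cvg.
  apply: squeeze_cvg0 (proj_cvg u); apply: nearW => i; rewrite dot_ge0/=.
  apply: le_trans (P_Bcontraction _ _ t0).
  apply: le_trans (cell_contraction _ ab).
  rewrite le_eqVlt; apply/orP; left; apply/eqP/eq_dot => k.
  by rewrite cellB dotBl.
have cQ' c : expR c * dot (cell a b (proj n u)) (cell a b (proj n u)) @[n --> +oo]
    --> expR c * dot (cell a b u) (cell a b u).
  by apply: cvgM => //; exact: cvg_cst.
apply/andP; split; [apply: (ler_cvg_to (cQ' _) cP)|apply: (ler_cvg_to cP (cQ' _))];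
  near=> n; have n0 : 0 <= n by near: n; exact: nbhs_pinfty_ge.
- by have [v /(cell_decay_domain ab t0) /andP[]] := proj_domain u n0.
- by have [v /(cell_decay_domain ab t0) /andP[]] := proj_domain u n0.
Unshelve. all: by end_near. Qed.

(** Both sides are sums over the cells of a grid of mesh [delta]; by
    [cell_decay] corresponding terms agree up to the factor
    [exp (2 delta t)], which tends to [1] with [delta]. *)
Lemma semigroup_sqr_norm u t : 0 <= t ->
  (\int[sm u]_(xi in `[0%R, +oo[) (expR (- (2 * xi * t)))%:E =
   (dot (P t u) (P t u))%:E)%E.
Proof.
move=> t0; set J := (\int[_]_(_ in _) _)%E; set I := dot (P t u) (P t u).
pose b (delta : R) (k : nat) := k%:R * delta.
pose a delta (k : nat) := b delta k - delta.
pose c delta (k : nat) := `]a delta k, b delta k]%classic : set R.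
have ab delta (k : nat) : 0 < delta -> a delta k <= b delta k by rewrite /a; lra.
have mc delta (k : nat) : measurable (c delta k) by exact: measurable_itv.
have trivc delta : 0 < delta -> trivIset setT (c delta).
  move=> d0; apply: ltn_trivIset => n2 n1 n12; apply/seteqP; split => // x [].
  rewrite /c /a /b /= !in_itv/= => /andP[_ x1] /andP[x2 _].
  have : n1.+1%:R * delta <= n2%:R * delta by rewrite ler_pM2r// ler_nat.
  by rewrite -natr1 mulrDl mul1r; lra.
have coverc delta : 0 < delta ->
    (\bigcup_k c delta k) `\` `]-oo, 0[ = `[0, +oo[%classic.
  move=> d0; apply/seteqP; split => x /=; rewrite !in_itv/= andbT.
    by move=> [_ /negP]; rewrite -leNgt.
  move=> x0; split; last by apply/negP; rewrite -leNgt.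
  have ex : exists k : nat, x <= b delta k.
    have [n nx] := exists_natr_gt (x / delta); exists n.+1.
    by rewrite /b -ler_pdivrMr// ltW.
  exists (ex_minn ex) => //; case: ex_minnP => k xk kmin.
  rewrite /c /= in_itv/= xk andbT /a.
  case: k xk kmin => [|k] xk kmin; first by rewrite /b mul0r; lra.
  rewrite /b -natr1 mulrDl mul1r addrK ltNge; apply/negP => /kmin.
  by rewrite ltnn.
have mN : measurable (`]-oo, 0[%classic : set R) by exact: measurable_itv.
have mU delta : measurable (\bigcup_k c delta k) by exact: bigcupT_measurable.
have sumE w (e : R -> \bar R) (delta : R) : measurable_fun setT e ->
    (forall xi, (0 <= e xi)%E) -> 0 < delta ->
    (\int[sm w]_(xi in `[0%R, +oo[) e xi =
     \sum_(k <oo) \int[sm w]_(xi in c delta k) e xi)%E.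
  move=> me e0 d0; rewrite -(coverc _ d0).
  rewrite -(@ge0_negligible_integral _ _ _ (sm w) (\bigcup_k c delta k)) //.
  - rewrite ge0_integral_bigcup//; [exact: mc|exact: measurable_funTS|exact: trivc].
  - exact: mU.
  - exact: measurable_funTS.
  - exact: spectral_measure_lt0.
pose e xi := (expR (- (2 * xi * t)))%:E.
have me : measurable_fun setT e.
  apply/measurable_EFinP; apply: measurableT_comp => //.
  by apply: measurableT_comp => //; apply: measurable_funM => //.
have e0 xi : (0 <= e xi)%E by rewrite lee_fin expR_ge0.
have IE delta : 0 < delta -> I%:E = (\sum_(k <oo) sm (P t u) (c delta k))%E.
  move=> d0; rewrite -spectral_measure_ge0 -[LHS]mul1e -integral_cst//.
  rewrite (sumE _ (cst 1%E) _ _ _ d0)//.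
  apply: eq_eseriesr => k _.
  by rewrite integral_cst; [exact: mul1e|exact: mc].
(* on a cell [e] varies by the factor [exp (2 delta t)] *)
have ecell delta (k : nat) : 0 < delta ->
    ((expR (- (2 * b delta k * t)))%:E * sm u (c delta k) <=
      \int[sm u]_(xi in c delta k) e xi <=
     (expR (- (2 * a delta k * t)))%:E * sm u (c delta k))%E.
  move=> d0; have mck := mc delta k.
  have cE (l : R) : (l%:E * sm u (c delta k) = \int[sm u]_(xi in c delta k) l%:E)%E.
    by rewrite integral_cst.
  rewrite !cE; apply/andP; split.
    apply: ge0_le_integral => //; first exact: measurable_funTS.
    move=> x; rewrite /c/= in_itv/= => /andP[_ xb].
    by rewrite lee_fin ler_expR lerN2 ler_wpM2r// ler_pM2l.
  apply: ge0_le_integral => //; first exact: measurable_funTS.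
  move=> x; rewrite /c/= in_itv/= => /andP[/ltW ax _].
  by rewrite lee_fin ler_expR lerN2 ler_wpM2r// ler_pM2l.
have aE delta (k : nat) : expR (- (2 * a delta k * t)) =
    expR (2 * delta * t) * expR (- (2 * b delta k * t)).
  by rewrite -expRD /a; congr expR; ring.
have IJ delta : 0 < delta -> (I%:E <= (expR (2 * delta * t))%:E * J)%E.
  move=> d0; rewrite (IE _ d0) /J (sumE _ e _ me e0 d0) -nneseriesZl; last first.
    by move=> k _; exact: integral_ge0.
  apply: lee_nneseries => // k _; rewrite spectral_measure_cell; last exact: ab.
  have /andP[_] := cell_decay u (ab delta k d0) t0.
  rewrite -lee_fin => /le_trans; apply.
  rewrite aE -mulrA EFinM lee_pmul2l ?lte_fin ?expR_gt0//.
  have /andP[+ _] := ecell delta k d0; rewrite spectral_measure_cell; last exact: ab.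
  by [].
have JI delta : 0 < delta -> (J <= (expR (2 * delta * t))%:E * I%:E)%E.
  move=> d0; rewrite (IE _ d0) /J (sumE _ e _ me e0 d0) -nneseriesZl//.
  apply: lee_nneseries => [k _ _|k _]; first exact: integral_ge0.
  have /andP[_ /le_trans] := ecell delta k d0; apply.
  rewrite !spectral_measure_cell; [|exact: ab..].
  rewrite aE EFinM -muleA lee_pmul2l ?lte_fin ?expR_gt0//.
  by have /andP[+ _] := cell_decay u (ab delta k d0) t0; rewrite -lee_fin EFinM.
have Jfin : J \is a fin_num.
  rewrite ge0_fin_numE; last exact: integral_ge0.
  by apply: le_lt_trans (JI 1 ltr01) _; rewrite -EFinM ltry.
have lim1 (x y : R) : (forall delta : R, 0 < delta -> x <= expR (2 * delta * t) * y) -> x <= y.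
  move=> xy; have cE : continuous (fun d : R => expR (2 * d * t)).
    move=> d; apply: (@continuous_comp _ _ _ (fun d : R => 2 * d * t) expR).
      by apply: cvgM; [apply: cvgM; [exact: cvg_cst|exact: cvg_id]|exact: cvg_cst].
    exact: continuous_expR.
  have H : (fun delta : R => expR (2 * delta * t) * y) @ 0^'+ --> y.
    have yE : y = expR (2 * 0 * t) * y by rewrite mulr0 mul0r expR0 mul1r.
    rewrite [X in _ --> X]yE; apply: cvgM; last exact: cvg_cst.
    by apply: cvg_within_filter; exact: cE.
  apply: (ler_cvg_to (cvg_cst x) H).
  by near=> d; apply: xy; near: d; exact: nbhs_right_gt.
rewrite -(fineK Jfin); congr EFin; apply/le_anti/andP; split.
- by apply: lim1 => d d0; have := JI d d0; rewrite -{1}(fineK Jfin) -EFinM lee_fin.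
- by apply: lim1 => d d0; have := IJ d d0; rewrite -{1}(fineK Jfin) -EFinM lee_fin.
Unshelve. all: by end_near. Qed.

End spectral_calculus.

(** * Spectral families on spaces of square-integrable functions *)

Section L2_spectral.
Context (R : realType) d (T : measurableType d) (mu : {measure set T -> \bar R}).
Implicit Types f g k : L2 mu.

Definition ldot f g : R := L2dot mu f g.

Lemma ldotC f g : ldot f g = ldot g f.
Proof. by congr (fine _); apply: eq_integral => x _; rewrite mulrC. Qed.

Lemma ldot_linear a f g k : ldot (a *: f + g) k = a * ldot f k + ldot g k.
Proof.
rewrite /ldot /L2dot -RintegralZl//; last exact: L2_mul_integrable.
rewrite -RintegralD//; last exact: L2_mul_integrable.
  by congr (fine _); apply: eq_integral => x _ /=; rewrite mulrDl mulrA.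
rewrite (_ : EFin \o _ = (fun x => a%:E * (f x * k x)%:E)%E); last first.
  by apply/funext => x; rewrite /= EFinM.
by apply: integrableZl => //; exact: L2_mul_integrable.
Qed.

Lemma ldot_ge0 f : 0 <= ldot f f.
Proof. by rewrite /ldot -L2norm_sqr sqr_ge0. Qed.

Lemma ae_eq_ldot f g k : f = g %[ae mu] -> ldot f k = ldot g k.
Proof. exact: ae_eq_L2dotl. Qed.

Lemma L2norm_sqrt f : L2norm mu f = (Num.sqrt (ldot f f))%:E.
Proof.
rewrite /ldot -L2norm_sqr sqrtr_sqr ger0_norm ?fine_ge0 ?Lnorm_ge0//.
by rewrite /L2norm -(@finite_norm_fine _ _ _ _ _ (lee1n 2) f).
Qed.

Lemma L2norm_sqrE f : (L2norm mu f ^+ 2 = (ldot f f)%:E)%E.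
Proof. by rewrite L2norm_sqrt -EFin_expe sqr_sqrtr// ldot_ge0. Qed.

Lemma L2norm_cvg0 {I} (F : set_system I) {FF : Filter F} (u : I -> L2 mu) :
  (L2norm mu (u i) @[i --> F] --> 0%E) <->
  (ldot (u i) (u i) @[i --> F] --> 0).
Proof.
under eq_cvg do rewrite L2norm_sqrt.
split=> [/fine_cvgP[_] c|c].
  rewrite -[X in _ --> X](mulr0 0).
  under eq_cvg do rewrite -[ldot _ _]sqr_sqrtr ?ldot_ge0// expr2.
  exact: cvgM.
apply: cvg_EFin; first exact: nearW.
apply: (@cvg_trans _ (Num.sqrt (ldot (u i) (u i)) @[i --> F])).
  by apply: near_eq_cvg; apply: nearW.
rewrite -sqrtr0.
apply: (@cvg_comp _ _ _ (fun i => ldot (u i) (u i)) Num.sqrt _ (nbhs (0:R))) => //.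
exact: sqrt_continuous.
Qed.

Variable S : spectral_family mu.

(** Extending the family by [0] to negative indices lets half-open cells whose
    left end is negative carry the atom at [0]. *)
Definition lproj (xi : R) f : L2 mu := if 0 <= xi then S xi f else 0.

Lemma ldot0 k : ldot 0 k = 0.
Proof.
have := ldot_linear 1 0 0 k; rewrite scale1r addr0 mul1r => /eqP.
by rewrite -subr_eq subrr eq_sym => /eqP.
Qed.

Lemma lproj_linear xi a f g k :
  ldot (lproj xi (a *: f + g)) k = a * ldot (lproj xi f) k + ldot (lproj xi g) k.
Proof.
rewrite /lproj; case: ifPn => xi0; last by rewrite !ldot0 mulr0 addr0.
by rewrite (ae_eq_ldot k (sproj_linear S a f g xi0)) ldot_linear.
Qed.

Lemma lproj_sym xi f g : ldot (lproj xi f) g = ldot f (lproj xi g).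
Proof.
rewrite /lproj; case: ifPn => xi0; first exact: sproj_symmetric.
by rewrite ldot0 ldotC ldot0.
Qed.

Lemma lproj_lt0 xi f g : xi < 0 -> ldot (lproj xi f) g = 0.
Proof. by move=> xi0; rewrite /lproj leNgt xi0 ldot0. Qed.

Lemma lproj_meet a b f g :
  ldot (lproj a (lproj b f)) g = ldot (lproj (Num.min a b) f) g.
Proof.
have [a0|a0] := ltP a 0; first by rewrite !lproj_lt0// gt_min a0.
have [b0|b0] := ltP b 0.
  by rewrite (@lproj_lt0 (Num.min a b)) ?gt_min ?b0 ?orbT// lproj_sym lproj_lt0.
have sub x y k h : 0 <= x -> x <= y -> ldot (lproj y (lproj x k)) h = ldot (lproj x k) h.
  move=> x0 xy; rewrite /lproj x0 (le_trans x0 xy).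
  exact/ae_eq_ldot/sproj_nondecreasing.
have [ab|ba] := leP a b; last by rewrite sub// ltW.
by rewrite lproj_sym lproj_sym ldotC sub// lproj_sym ldotC.
Qed.

Lemma lproj_cvg f : ldot (lproj xi f - f) (lproj xi f - f) @[xi --> +oo] --> 0.
Proof.
apply/(L2norm_cvg0 (fun xi => lproj xi f - f)).
apply: cvg_trans (sproj_identity S f); apply: near_eq_cvg.
near=> xi; rewrite /lproj ifT//; near: xi; exact: nbhs_pinfty_ge.
Unshelve. all: by end_near. Qed.

Lemma spectral_cdfE f xi : spectral_cdf S f xi = ldot (lproj xi f) f.
Proof. by rewrite /spectral_cdf /lproj; case: ifPn => // _; rewrite ldot0. Qed.

Variable P : R -> L2 mu -> L2 mu.
Hypothesis P_linear : forall t a u v k, 0 <= t ->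
  ldot (P t (a *: u + v)) k = a * ldot (P t u) k + ldot (P t v) k.
Hypothesis P_semigroup : forall s t u k, 0 <= s -> 0 <= t ->
  ldot (P (s + t) u) k = ldot (P s (P t u)) k.
Hypothesis P_contraction : forall t u, 0 <= t ->
  ldot (P t u) (P t u) <= ldot u u.
Hypothesis P0 : forall u k, ldot (P 0 u) k = ldot u k.
Local Notation gen := (infinitesimal_generator ldot P).
Hypothesis S_spectral : spectral_family_of S (fun u v => gen u (- v)).

Let gen_domain u :
  (\int[spectral_measure S u]_(xi in `[0%R, +oo[) (xi ^+ 2)%:E < +oo)%E ->
  exists v, gen u v.
Proof. by move=> /(proj2 (S_spectral.1 u))[v uv]; exists (- v). Qed.

Let gen_form u v u' v' : gen u v -> gen u' v' ->
  - ldot v u' = 4^-1 * (\int[spectral_measure S (u + u')]_(xi in `[0, +oo[) xi -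
                        \int[spectral_measure S (u - u')]_(xi in `[0, +oo[) xi).
Proof.
move=> uv uv'.
have H := S_spectral.2 u (- v) u' (- v'); rewrite !opprK in H.
apply: etrans (H uv uv').
by rewrite -[LHS]add0r -(ldot0 u') -mulN1r addrC -ldot_linear scaleN1r addr0.
Qed.

Lemma L2_semigroup_sqr_norm u t : 0 <= t ->
  (\int[spectral_measure S u]_(xi in `[0%R, +oo[) (expR (- (2 * xi * t)))%:E =
   (ldot (P t u) (P t u))%:E)%E.
Proof.
exact: (semigroup_sqr_norm ldotC ldot_linear ldot_ge0 lproj_linear lproj_sym
  lproj_meet lproj_lt0 lproj_cvg spectral_cdfE P_linear P_semigroup
  P_contraction P0 gen_domain gen_form).
Qed.

Lemma L2_semigroup_sym u v t : 0 <= t -> ldot (P t u) v = ldot u (P t v).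
Proof.
exact: (P_sym ldotC ldot_linear ldot_ge0 lproj_linear lproj_sym
  lproj_meet lproj_lt0 lproj_cvg spectral_cdfE P_linear P_semigroup
  P_contraction P0 gen_domain gen_form).
Qed.

End L2_spectral.

(** * Integrals of functions that need not be measurable *)

Section ae_integral.
Context (R : realType) d (T : measurableType d) (mu : {measure set T -> \bar R}).
Local Open Scope ereal_scope.

Lemma ge0_le_integral_setT (f g : T -> \bar R) : (forall x, 0 <= f x) ->
  (forall x, f x <= g x) -> \int[mu]_x f x <= \int[mu]_x g x.
Proof.
move=> f0 fg; have g0 x : 0 <= g x := le_trans (f0 x) (fg x).
rewrite !ge0_integralTE//; apply: le_ereal_sup => _ [h /= hf <-].
by exists h => // x; exact: le_trans (hf x) (fg x).
Qed.

(** A function that agrees almost everywhere with a measurable one lies between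
    two measurable functions with the same integral. *)
Let ge0_ae_integral (f g : T -> \bar R) : measurable_fun setT g ->
  (forall x, 0 <= f x) -> (forall x, 0 <= g x) ->
  {ae mu, forall x, f x = g x} -> \int[mu]_x f x = \int[mu]_x g x.
Proof.
move=> mg f0 g0 [N [mN N0 fgN]].
have fg x : ~ N x -> f x = g x by move=> Nx; apply: contrapT => /fgN.
pose lo x := if x \in N then 0 else g x.
pose hi x := if x \in N then +oo else g x.
have mNb : measurable_fun setT (fun x => x \in N).
  by apply: (measurable_fun_bool true); rewrite setTI preimage_mem_true.
have mlo : measurable_fun setT lo.
  by apply: measurable_fun_ifT => //; exact: measurable_cst.
have mhi : measurable_fun setT hi.
  by apply: measurable_fun_ifT => //; exact: measurable_cst.
have loE : \int[mu]_x lo x = \int[mu]_x g x.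
  apply: ge0_ae_eq_integral => //.
  - by move=> x _; rewrite /lo; case: ifP.
  - exists N; split => // x /=; apply: contra_notP => Nx _.
    by rewrite /lo memNset.
have hiE : \int[mu]_x hi x = \int[mu]_x g x.
  apply: ge0_ae_eq_integral => //.
  - by move=> x _; rewrite /hi; case: ifP.
  - exists N; split => // x /=; apply: contra_notP => Nx _.
    by rewrite /hi memNset.
apply/eqP; rewrite eq_le -{1}hiE -loE; apply/andP; split.
- apply: ge0_le_integral_setT => // x; rewrite /hi.
  by case: ifPn => [_|/negP]; [exact: leey|rewrite inE => /fg ->].
- apply: ge0_le_integral_setT => x; rewrite /lo; case: ifPn => //.
  by move/negP; rewrite inE => /fg ->.
Qed.

(** Functions of the exit time are integrated in this way. *)
Lemma ae_integral (f g : T -> \bar R) : measurable_fun setT g ->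
  {ae mu, forall x, f x = g x} -> \int[mu]_x f x = \int[mu]_x g x.
Proof.
move=> mg fg; rewrite integralE [RHS]integralE; congr (_ - _).
- apply: ge0_ae_integral => //; first exact: measurable_funepos.
  by apply: filterS fg => x fgx; rewrite !funeposE fgx.
- apply: ge0_ae_integral => //; first exact: measurable_funeneg.
  by apply: filterS fg => x fgx; rewrite !funenegE fgx.
Qed.

End ae_integral.

(** * Disintegration *)

Section disintegration.
Context (R : realType) d1 d2 (T : measurableType d1) (Z : measurableType d2).
Variables (P : {measure set T -> \bar R}) (A : set T) (phi : T -> Z).
Variable k : T -> {measure set Z -> \bar R}.
Hypotheses (mA : measurable A) (mphi : measurable_fun setT phi).
Hypothesis mk : forall B, measurable B -> measurable_fun setT (k ^~ B).
Hypothesis kE : forall B, measurable B ->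
  (P (A `&` phi @^-1` B) = \int[P]_(w in A) k w B)%E.
Local Open Scope ereal_scope.
Import HBNNSimple.

Let disintegration_nnsfun (f : {nnsfun Z >-> R}) :
  \int[P]_(w in A) (f (phi w))%:E = \int[P]_(w in A) \int[k w]_z (f z)%:E.
Proof.
under [RHS]eq_integral do rewrite integralT_nnsfun sintegralE.
under [LHS]eq_integral do rewrite fimfunE -fsumEFin//.
have mf r : measurable (f @^-1` [set r]) by exact: measurable_sfunP.
rewrite ge0_integral_fsum//; last 2 first.
- by move=> r; apply: measurable_funTS; apply/measurable_EFinP/measurable_funM => //;
    exact: measurableT_comp mphi.
- by move=> r w _; rewrite EFinM nnfun_muleindic_ge0.
rewrite ge0_integral_fsum//; last 2 first.
- by move=> r; apply: measurable_funTS; apply: measurable_funeM; exact: mk.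
- move=> r w _; have := mulemu_ge0 (fun n => f @^-1` [set n]).
  by apply; exact: preimage_nnfun0.
apply: eq_fsbigr => r _.
have [r0|r0] := ltP r 0%R.
  rewrite [LHS]integral0_eq ?[RHS]integral0_eq// => w _.
    by rewrite preimage_nnfun0// measure0 mule0.
  by rewrite preimage_nnfun0// indic0 mulr0.
under eq_integral do rewrite EFinM.
have mphif : measurable (phi @^-1` (f @^-1` [set r])).
  by rewrite -[X in measurable X]setTI; exact: mphi.
rewrite ge0_integralZl//; last first.
  by apply: measurable_funTS; apply/measurable_EFinP; exact: measurableT_comp mphi.
rewrite ge0_integralZl//; last exact: measurable_funTS (mk _).
congr (_ * _); rewrite -kE//.
by rewrite (@integral_indic _ _ _ P A mA (phi @^-1` (f @^-1` [set r])))// setIC.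
Qed.

(** The identity for events extends to simple functions, then to monotone limits. *)
Lemma integral_disintegration (f : Z -> \bar R) : measurable_fun setT f ->
  (forall z, 0 <= f z) ->
  \int[P]_(w in A) f (phi w) = \int[P]_(w in A) \int[k w]_z f z.
Proof.
move=> mf f0; pose f_ := nnsfun_approx measurableT mf.
have fE z : f z = limn (fun n => (f_ n z)%:E).
  by apply/esym/cvg_lim => //; exact: cvg_nnsfun_approx.
have ndf z : {homo (fun n => (f_ n z)%:E) : a b / (a <= b)%N >-> a <= b}.
  by move=> a b ab; rewrite lee_fin; exact/lefP/nd_nnsfun_approx.
under [LHS]eq_integral do rewrite fE.
rewrite monotone_convergence//; last 2 first.
- move=> n; apply: measurable_funTS; apply/measurable_EFinP.
  exact: measurableT_comp mphi.
- by move=> n w _; rewrite lee_fin.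
under [RHS]eq_integral.
  move=> w _; under eq_integral do rewrite fE.
  rewrite monotone_convergence//; last 2 first.
  - by move=> n; exact/measurable_EFinP.
  - by move=> n z _; rewrite lee_fin.
  over.
rewrite monotone_convergence//; last 3 first.
- move=> n; apply: measurable_funTS; apply: measurable_fun_integral_kernel => //.
  + by move=> z; rewrite lee_fin.
  + exact/measurable_EFinP.
- by move=> n w _; apply: integral_ge0 => z _; rewrite lee_fin.
- move=> w _ a b ab; apply: ge0_le_integral => //.
  + by move=> z _; rewrite lee_fin.
  + exact/measurable_EFinP.
  + exact/measurable_EFinP.
  + by move=> z _; exact: ndf.
by congr (limn _); apply/funext => n; exact: disintegration_nnsfun.
Qed.

End disintegration.

(** * The one-point compactification of a locally compact space *)

Section compactification.
Context (E : ptopologicalType).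
Hypothesis E_hausdorff : hausdorff_space E.
Hypothesis E_locally_compact : locally_compact [set: E].
Local Notation opc := (one_point_compactification E).

Let opc_hausdorff : hausdorff_space opc.
Proof. exact: one_point_compactification_hausdorff. Qed.

Lemma measurable_opc_set1 (x : opc) : measurable ([set x] : set (borel opc)).
Proof.
rewrite -[[set x]]setCK; apply: measurableC; apply: open_borel.
by apply: closed_openC; apply: accessible_closed_set1; exact: hausdorff_accessible.
Qed.

Lemma measurable_image_Some (B : set (borel E)) :
  measurable B -> measurable (Some @` B : set (borel opc)).
Proof.
have SomeC (A : set E) : Some @` (~` A) = ~` ([set None] `|` (Some @` A)) :> set opc.
  apply/seteqP; split => [_ [x Ax <-] [//|[y Ay [yx]]]|[x|] /= nx].
  - by apply: Ax; rewrite -yx.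
  - by exists x => // Ax; apply: nx; right; exists x.
  - by exfalso; apply: nx; left.
have sH : sigma_algebra setT [set B : set E | measurable (Some @` B : set (borel opc))].
  split => [|A mA|F mF] /=.
  - by rewrite image_set0.
  - rewrite setTD SomeC; apply: measurableC; apply: measurableU => //.
    exact: measurable_opc_set1.
  - by rewrite image_bigcup; exact: bigcupT_measurable.
apply: (smallest_sub sH) => U oU.
by rewrite /=; apply: sub_sigma_algebra; exact: one_point_compactification_open_some.
Qed.

Lemma measurable_Some : measurable_fun setT (Some : borel E -> borel opc).
Proof.
apply: (@measurability _ _ (borel E) (borel opc) setT Some (@open opc)) => //.
move=> _ [U oU <-]; rewrite setTI; apply: open_borel.
apply: open_comp => // x _; exact: one_point_compactification_some_continuous.
Qed.

Lemma measurable_oapp d (Y : measurableType d) (f : borel E -> Y) (y : Y) :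
  measurable_fun setT f -> measurable_fun setT (oapp f y : borel opc -> Y).
Proof.
move=> mf _ B mB; rewrite setTI.
have -> : oapp f y @^-1` B =
    Some @` (f @^-1` B) `|` (if y \in B then [set None] else set0) :> set opc.
  apply/seteqP; split => [[x|] /= Bx|z [[x Bx <-]//|]].
  - by left; exists x.
  - by right; rewrite ifT// inE.
  - by case: ifPn => // yB -> /=; move: yB; rewrite inE.
apply: measurableU.
  by apply: measurable_image_Some; rewrite -[X in measurable X]setTI; exact: mf.
by case: ifP => // _; exact: measurable_opc_set1.
Qed.

Hypothesis E_second_countable : @second_countable E.

(** Regularity of the compactification and a countable base of [E] exhaust an
    open set by open sets whose closures stay inside. *)
Lemma open_exhaustion (G : set E) : open G ->
  exists V : nat -> set opc, [/\ forall n, open (V n),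
    forall n, V n `<=` V n.+1, forall n, closure (V n) `<=` Some @` G &
    Some @` G `<=` \bigcup_n V n].
Proof.
move=> oG; have [B cB [Bopen Bbase]] := E_second_countable.
have [f f_inj] := (countable_injP _) cB.
pose W k := \bigcup_(U in [set U | [/\ B U, f U = k &
  closure (Some @` U : set opc) `<=` Some @` G]]) (Some @` U) : set opc.
have oW k : open (W k).
  apply: bigcup_open => U [BU _ _].
  by apply: one_point_compactification_open_some; exact: Bopen.
have clW k : closure (W k) `<=` Some @` G.
  have [[U [BU fU clU]]|noU] := pselect (exists U, [/\ B U, f U = k &
      closure (Some @` U : set opc) `<=` Some @` G]).
    rewrite (_ : W k = Some @` U)//; apply/seteqP; split => [x [U' [BU' fU' _]]|x Ux].
      by rewrite (f_inj U' U) ?inE// fU fU'.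
    by exists U.
  rewrite (_ : W k = set0) ?closure0//; apply/seteqP; split => // x [U ? _].
  by apply: noU; exists U.
pose V n := \big[setU/set0]_(k < n) W k.
exists V; split.
- by elim=> [|n IH]; rewrite /V ?big_ord0 ?big_ord_recr; [exact: open0|exact: openU].
- by move=> n x Vx; rewrite /V big_ord_recr; left.
- elim=> [|n IH]; first by rewrite /V big_ord0 closure0.
  by rewrite /V big_ord_recr closureU => x [/IH|/clW].
move=> _ [g Gg <-].
have opc_regular : filter_from (nbhs (Some g : opc)) closure --> (Some g : opc).
  apply: (@compact_regular _ _ setT) => //; last exact: filterT.
  exact: one_point_compactification_compact.
have /opc_regular[W' W'g clW'] : nbhs (Some g : opc) (Some @` G).
  by apply: one_point_compactification_some_nbhs; exact: open_nbhs_nbhs.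
have [U [BU Ug] UW'] := Bbase g _ W'g.
exists (f U).+1 => //; rewrite /V big_ord_recr/=; right.
exists U; last by exists g.
split => //; apply: subset_trans clW'; apply: closureS => _ [y Uy <-].
exact: UW'.
Qed.

End compactification.

(** * Integrals over a subset and Jensen's inequality *)

Section restricted_integral.
Context (R : realType) d (T : measurableType d) (mu : {measure set T -> \bar R}).
Variables (D : set T) (mD : measurable D).
Local Open Scope ereal_scope.

Lemma ge0_integral_mrestr (f : T -> \bar R) : measurable_fun setT f ->
  (forall x, 0 <= f x) -> \int[mrestr mu mD]_x f x = \int[mu]_(x in D) f x.
Proof.
move=> mf f0; rewrite [LHS](ge0_negligible_integral (measurableC mD)) //.
- rewrite setTD setCK; apply: eq_measure_integral => A mA AD.
  by rewrite /= /mrestr setIidl.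
- by rewrite /= /mrestr setICl measure0.
Qed.

Lemma ae_mrestr (P : T -> Prop) : {ae mu, forall x, D x -> P x} ->
  {ae mrestr mu mD, forall x, P x}.
Proof.
move=> [N [mN N0 H]]; exists (N `|` ~` D); split.
- by apply: measurableU => //; exact: measurableC.
- rewrite /= /mrestr setIUl setICl setU0; apply/eqP; rewrite eq_le measure_ge0 andbT.
  by rewrite -N0 le_measure ?inE//; exact: measurableI.
- move=> x nP; have [Dx|] := pselect (D x); last by right.
  by left; apply: H => /= /(_ Dx).
Qed.

End restricted_integral.

(** Jensen's inequality for the square: [2 m f <= f ^ 2 + m ^ 2] integrates to
    [2 m ^ 2 <= \int f ^ 2 + m ^ 2] for the mean [m] of [f]. *)
Lemma sqr_integral_le (R : realType) d (T : measurableType d)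
    (P : probability T R) (f : T -> \bar R) : measurable_fun setT f ->
  (forall x, 0 <= f x)%E -> ((\int[P]_x f x) ^+ 2 <= \int[P]_x (f x ^+ 2))%E.
Proof.
move=> mf f0.
have mf2 : measurable_fun setT (fun x => f x ^+ 2)%E.
  under eq_fun do rewrite expe2.
  exact: emeasurable_funM.
have f20 x : (0 <= f x ^+ 2)%E by rewrite expe2 mule_ge0.
have amgm (m : R) (y : \bar R) : 0 <= m -> (0 <= y)%E ->
    ((2 * m)%:E * y <= y ^+ 2 + (m ^+ 2)%:E)%E.
  move=> m0; case: y => [y y0| _|//].
    rewrite -EFin_expe -EFinM -EFinD lee_fin; have := sqr_ge0 (y - m); nra.
  by rewrite expe2 mulyy addye// leey.
have H m : 0 <= m -> ((2 * m)%:E * \int[P]_x f x <= \int[P]_x (f x ^+ 2) + (m ^+ 2)%:E)%E.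
  move=> m0; rewrite -ge0_integralZl//; last by rewrite lee_fin mulr_ge0.
  rewrite -[X in (_ + X)%E](mule1) -(probability_setT P) -integral_cst//.
  rewrite -ge0_integralD//; last by move=> x _; rewrite lee_fin sqr_ge0.
  apply: ge0_le_integral => //.
  - by move=> x _; rewrite mule_ge0// lee_fin mulr_ge0.
  - by apply: measurable_funeM.
  - by apply: emeasurable_funD => //; exact: measurable_cst.
  - by move=> x _; exact: amgm.
have I0 : (0 <= \int[P]_x f x)%E by exact: integral_ge0.
have J0 : (0 <= \int[P]_x (f x ^+ 2))%E by exact: integral_ge0.
move: I0 J0 H; move: (\int[P]_x f x)%E (\int[P]_x (f x ^+ 2))%E.
case=> [a| |] [b| |] //= a0 b0 H.
- by have := H a a0; rewrite -!EFinM -EFinD !lee_fin; nra.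
- by rewrite leey.
- by have := H 1 ler01; rewrite gt0_muley// lte_fin mulr1.
Qed.

(** * The Markov property *)

Definition image_law (R : realType) d1 d2 (T : measurableType d1)
    (Z : measurableType d2) (P : probability T R) (f : T -> Z)
    (mf : measurable_fun setT f) : probability Z R :=
  distribution P (HB.pack f (isMeasurableFun.Build _ _ _ _ f mf) : {mfun T >-> Z}).

Section markov.
Context (R : realType) (E : ptopologicalType) (d : measure_display).
Context (Omega : measurableType d) (X : hunt_process R E Omega).
Hypothesis E_hausdorff : hausdorff_space E.
Hypothesis E_locally_compact : locally_compact [set: E].
Local Notation opc := (one_point_compactification E).

Lemma measurable_hX t : 0 <= t -> measurable_fun setT (X t : Omega -> borel opc).
Proof.
move=> t0 _ B mB; rewrite setTI.
have [_ sub] := hF_sigma_algebra X t0; apply: sub.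
exact: hX_adapted.
Qed.

Lemma hF_le s t : 0 <= s -> s <= t -> hF X s `<=` hF X t.
Proof.
move=> s0; rewrite le_eqVlt => /predU1P[->//|st] A.
by rewrite (hF_right_continuous X s0) => /(_ t st).
Qed.

Lemma hF_measurable t A : 0 <= t -> hF X t A -> measurable A.
Proof. by move=> t0; exact: (hF_sigma_algebra X t0).2. Qed.

Lemma hF_setI t A B : 0 <= t -> hF X t A -> hF X t B -> hF X t (A `&` B).
Proof.
move=> t0; have [sF _] := hF_sigma_algebra X t0.
rewrite -(sigma_algebra_id sF).
exact: (@measurableI _ (g_sigma_algebraType (hF X t))).
Qed.

Lemma ae_start y : {ae hP X y, forall w, X 0 w = y}.
Proof.
have mX0 : measurable (X 0 @^-1` [set y]).
  rewrite -[X in measurable X]setTI.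
  by apply: measurable_hX => //; exact: measurable_opc_set1.
exists (~` (X 0 @^-1` [set y])); split => //; first exact: measurableC.
by rewrite probability_setC ?hP_normal ?subee.
Qed.

(** The strong Markov property at a constant stopping time. *)
Let simple_markov x t s A B : 0 <= t -> 0 <= s -> hF X t A ->
  measurable (B : set (borel opc)) ->
  (hP X x (A `&` X (t + s)%R @^-1` B) =
   \int[hP X x]_(w in A) hP X (X t w) (X s @^-1` B))%E.
Proof.
move=> t0 s0 At mB.
have stT : stopping_time (hF X) (cst t%:E).
  split=> [w|u u0]; first by rewrite lee_fin.
  have [[s0' sC sU] _] := hF_sigma_algebra X u0.
  have [tu|ut] := leP t u.
    rewrite (_ : [set w | _] = setT); first by rewrite -[setT]setD0; exact: sC.
    by apply/seteqP; split => // w _ /=; rewrite lee_fin.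
  rewrite (_ : [set w | _] = set0)//.
  by apply/seteqP; split => // w /=; rewrite lee_fin leNgt ut.
have AT : stopped_sigma_algebra (hF X) (cst t%:E) A.
  split=> [|u u0]; first exact: hF_measurable At.
  have [tu|ut] := leP t u.
    rewrite (_ : [set w | _] = setT); first by rewrite setIT; exact: hF_le At.
    by apply/seteqP; split => // w _ /=; rewrite lee_fin.
  rewrite (_ : [set w | _] = set0); first by rewrite setI0; have [[]] := hF_sigma_algebra X u0.
  by apply/seteqP; split => // w /=; rewrite lee_fin leNgt ut.
have := hX_strong_markov x stT s0 mB AT.
rewrite (_ : A `&` [set w | (cst t%:E w < +oo)%E] = A); last first.
  by rewrite (_ : [set w | _] = setT) ?setIT//; apply/seteqP; split => // w _ /=; rewrite ltry.
move=> /= <-; congr (hP X x (_ `&` _)).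
by apply/seteqP; split => w /= Bw; [split; [rewrite ltry|]|case: Bw].
Qed.

Let markov_fun x t s A (g : borel opc -> \bar R) : 0 <= t -> 0 <= s ->
  hF X t A -> measurable_fun setT g -> (forall y, (0 <= g y)%E) ->
  (\int[hP X x]_(w in A) g (X (t + s)%R w) =
   \int[hP X x]_(w in A) \int[hP X (X t w)]_w' g (X s w'))%E.
Proof.
move=> t0 s0 At mg g0.
have ts0 : 0 <= t + s by rewrite addr_ge0.
have mA := hF_measurable t0 At.
pose k w := image_law (hP X (X t w)) (measurable_hX s0).
have mk (B : set (borel opc)) : measurable B -> measurable_fun setT (fun w => k w B).
  move=> mB; apply: (measurableT_comp (hP_measurable X s0 mB)); exact: measurable_hX.
rewrite (integral_disintegration mA (measurable_hX ts0) mk _ mg g0); last first.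
  by move=> B mB; exact: simple_markov.
apply: eq_integral => w _.
exact: (ge0_integral_pushforward (measurable_hX s0)).
Qed.

Lemma measurable_transition s (g : borel opc -> \bar R) : 0 <= s ->
  measurable_fun setT g -> (forall y, (0 <= g y)%E) ->
  measurable_fun setT (fun y : borel opc => (\int[hP X y]_w g (X s w))%E).
Proof.
move=> s0 mg g0.
pose k y := image_law (hP X y) (measurable_hX s0).
rewrite (_ : (fun y => _) = (fun y => (\int[k y]_z g z)%E)); last first.
  by apply/funext => y; apply/esym/(ge0_integral_pushforward (measurable_hX s0)).
apply: measurable_fun_integral_kernel => // U mU.
exact: hP_measurable.
Qed.

Definition cylinder (l : seq (R * set (borel opc))) : set Omega :=
  \big[setI/setT]_(p <- l) (X p.1 @^-1` p.2).

Definition cylinders : set (set Omega) :=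
  [set cylinder l | l in
    [set l : seq (R * set (borel opc)) |
      forall p, p \in l -> 0 <= p.1 /\ measurable p.2]].

(** The probability of a cylinder whose times increase from [t], given the
    position [y] at time [t]. *)
Fixpoint cylinder_law (t : R) (l : seq (R * set (borel opc))) (y : opc) : \bar R :=
  if l is p :: l' then
    (\int[hP X y]_w ((\1_(p.2) (X (p.1 - t)%R w))%:E * cylinder_law p.1 l' (X (p.1 - t)%R w)))%E
  else 1%E.

Let le_time : rel (R * set (borel opc)) := fun p q => p.1 <= q.1.

Let admissible (l : seq (R * set (borel opc))) : Prop :=
  forall p, p \in l -> 0 <= p.1 /\ measurable p.2.

Let cylinder_law_ge0 t l y : (0 <= cylinder_law t l y)%E.
Proof.
elim: l t y => [|p l IH] t y //=; apply: integral_ge0 => w _.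
by apply: mule_ge0; [rewrite lee_fin|exact: IH].
Qed.

Let cylinder_law_measurable t l : 0 <= t -> admissible l -> path le_time (t, setT) l ->
  measurable_fun setT (cylinder_law t l : borel opc -> \bar R).
Proof.
elim: l t => [|p l IH] t t0 adl /=; first by move=> _; exact: measurable_cst.
move=> /andP[tp pl].
have [p0 mp] : 0 <= p.1 /\ measurable p.2 by apply: adl; rewrite mem_head.
apply: (@measurable_transition (p.1 - t) (fun z => (\1_(p.2) z)%:E * cylinder_law p.1 l z)%E).
- by rewrite subr_ge0.
- apply: emeasurable_funM.
    by apply/measurable_EFinP; exact: measurable_indic.
  apply: IH => //; first by move=> q ql; apply: adl; rewrite in_cons ql orbT.
  by case: l pl {adl} => //= q l; rewrite /le_time.
- by move=> y; apply: mule_ge0; [rewrite lee_fin|exact: cylinder_law_ge0].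
Qed.

Let cylinder_lawE x t l A : 0 <= t -> hF X t A -> admissible l ->
  path le_time (t, setT) l ->
  (hP X x (A `&` cylinder l) = \int[hP X x]_(w in A) cylinder_law t l (X t w))%E.
Proof.
elim: l t A => [|p l IH] t A t0 At adl /=.
  rewrite /cylinder big_nil setIT integral_cst ?mul1e//.
  exact: hF_measurable At.
move=> /andP[tp pl].
have [p0 mp] : 0 <= p.1 /\ measurable p.2 by apply: adl; rewrite mem_head.
have adl' : admissible l by move=> q ql; apply: adl; rewrite in_cons ql orbT.
have pl' : path le_time (p.1, setT) l.
  by case: l pl {IH adl adl'} => //= q l; rewrite /le_time.
have Ap : hF X p.1 (A `&` X p.1 @^-1` p.2).
  by apply: hF_setI => //; [exact: hF_le At|exact: hX_adapted].
have pt0 : 0 <= p.1 - t by rewrite subr_ge0.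
rewrite /cylinder big_cons setIA (IH p.1)//.
rewrite integral_mkcondr.
have := @markov_fun x t (p.1 - t) A
  (fun z => (\1_(p.2) z)%:E * cylinder_law p.1 l z)%E t0 pt0 At.
rewrite subrKC => <-.
- apply: eq_integral => w _; rewrite /patch /= indicE.
  rewrite (_ : (w \in X p.1 @^-1` p.2) = (X p.1 w \in p.2)); last first.
    by apply/idP/idP; rewrite !inE.
  by case: ifP => _; rewrite ?mul1e ?mul0e.
- apply: emeasurable_funM; last exact: cylinder_law_measurable.
  by apply/measurable_EFinP; exact: measurable_indic.
- by move=> y; apply: mule_ge0; [rewrite lee_fin|exact: cylinder_law_ge0].
Qed.

Let cylinder_sort l : cylinder (sort le_time l) = cylinder l.
Proof. by apply: perm_big; rewrite perm_sort. Qed.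

Let admissible_sort l : admissible l -> admissible (sort le_time l).
Proof. by move=> adl p; rewrite mem_sort; exact: adl. Qed.

Let path_sort l : admissible l -> path le_time (0, setT) (sort le_time l).
Proof.
move=> adl; have tot : total le_time by move=> p q; exact: le_total.
have tr : transitive le_time by move=> q p u; exact: le_trans.
rewrite path_sortedE//; apply/andP; split; last exact: sort_sorted.
apply/allP => p pl; rewrite /le_time.
by have [] := admissible_sort adl pl.
Qed.

Let cylinders_setI : setI_closed cylinders.
Proof.
move=> _ _ [l adl <-] [l' adl' <-]; exists (l ++ l'); last by rewrite /cylinder big_cat.
by move=> p /=; rewrite mem_cat => /orP[/adl|/adl'].
Qed.

Let cylinder_measurable A : cylinders A -> measurable A.
Proof.
move=> [l adl <-]; rewrite /cylinder; elim: l adl => [|p l IH] adl.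
  by rewrite big_nil.
rewrite big_cons; apply: measurableI.
  have [p0 mp] : 0 <= p.1 /\ measurable p.2 by apply: adl; rewrite mem_head.
  by rewrite -[X in measurable X]setTI; exact: measurable_hX.
by apply: IH => q ql; apply: adl; rewrite in_cons ql orbT.
Qed.

Lemma hF_setT t : 0 <= t -> hF X t setT.
Proof.
move=> t0; have [[s0' sC sU] _] := hF_sigma_algebra X t0.
by rewrite -[setT]setD0; exact: sC.
Qed.

(** The process starts at [y], so that integrating a function of [X 0] evaluates
    it at [y]. *)
Let hP_cylinderE y l : admissible l ->
  hP X y (cylinder l) = cylinder_law 0 (sort le_time l) y.
Proof.
move=> adl; rewrite -cylinder_sort -[cylinder _]setTI.
rewrite (@cylinder_lawE y 0)//; [|exact: hF_setT|exact: admissible_sort|exact: path_sort].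
pose c := cylinder_law 0 (sort le_time l) : borel opc -> \bar R.
have mc : measurable_fun setT c.
  by apply: cylinder_law_measurable => //; [exact: admissible_sort|exact: path_sort].
have -> : cylinder_law 0 (sort le_time l) y = (\int[hP X y]_w cst (c y) w)%E.
  rewrite integral_cst; last exact: measurableT.
  transitivity (c y * 1)%E; first by rewrite mule1.
  by congr (_ * _)%E; apply/esym; exact: probability_setT.
apply: ae_eq_integral => //.
  by apply: (measurableT_comp mc); exact: measurable_hX.
by apply: filterS (ae_start y) => w /= -> _.
Qed.

(** On the sigma-algebra generated by the process the laws depend measurably on
    the starting point: this is so on cylinders, by iterating the transition
    probabilities, and extends by a monotone class argument. *)
Definition paths := g_sigma_algebraType cylinders.

Let paths_sub (A : set Omega) : measurable (A : set paths) -> measurable A.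
Proof.
move=> mA; apply: (smallest_sub _ _ mA); last by move=> B; exact: cylinder_measurable.
exact: sigma_algebra_measurable.
Qed.

Lemma measurable_idpaths : measurable_fun setT (id : Omega -> paths).
Proof. by move=> _ A mA; rewrite setTI; exact: paths_sub. Qed.

Lemma paths_measurable_X t : 0 <= t -> measurable_fun setT (X t : paths -> borel opc).
Proof.
move=> t0 _ B mB; rewrite setTI; apply: sub_sigma_algebra.
exists [:: (t, B)]; last by rewrite /cylinder big_seq1.
by move=> p; rewrite inE => /eqP ->.
Qed.

Lemma measurable_shift t : 0 <= t -> measurable_fun setT (hshift X t : Omega -> paths).
Proof.
move=> t0; apply: (@measurability _ _ Omega paths setT _ cylinders) => //.
move=> _ [_ [l adl <-] <-]; rewrite setTI /cylinder.
elim: l adl => [|p l IH] adl; first by rewrite big_nil preimage_setT.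
rewrite big_cons preimage_setI; apply: measurableI.
  have [p0 mp] : 0 <= p.1 /\ measurable p.2 by apply: adl; rewrite mem_head.
  rewrite (_ : _ @^-1` _ = X (p.1 + t) @^-1` p.2).
    by rewrite -[X in measurable X]setTI; apply: measurable_hX => //; exact: addr_ge0.
  by apply/seteqP; split => w /=; rewrite hX_shift.
by apply: IH => q ql; apply: adl; rewrite in_cons ql orbT.
Qed.

Definition path_law (y : borel opc) : probability paths R :=
  image_law (hP X y) measurable_idpaths.

Lemma path_lawE y (A : set paths) : path_law y A = hP X y A.
Proof. by []. Qed.

Let dynkin_paths (Q : set (set paths)) : Q setT ->
  (forall l, admissible l -> Q (cylinder l)) ->
  (forall A, measurable A -> Q A -> Q (~` A)) ->
  (forall F : (set paths)^nat, (forall n, measurable (F n)) ->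
    trivIset setT F -> (forall n, Q (F n)) -> Q (\bigcup_n F n)) ->
  forall A, measurable A -> Q A.
Proof.
move=> QT Qc QC QU A mA; apply: (@dynkin_induction _ paths cylinders Q) => //.
- by move=> _ [l adl <-]; exact: Qc.
Qed.

Lemma measurable_path_law (A : set paths) : measurable A ->
  measurable_fun setT (path_law ^~ A).
Proof.
move: A; apply: dynkin_paths.
- by rewrite (_ : path_law ^~ _ = cst 1%E) //; apply/funext => y; exact: probability_setT.
- move=> l adl; rewrite (_ : path_law ^~ _ = cylinder_law 0 (sort le_time l)).
    by apply: cylinder_law_measurable => //; [exact: admissible_sort|exact: path_sort].
  by apply/funext => y; exact: hP_cylinderE.
- move=> A mA mlA.
  rewrite (_ : path_law ^~ _ = (fun y => 1 - path_law y A)%E); last first.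
    by apply/funext => y; exact: probability_setC.
  by apply: emeasurable_funB => //; exact: measurable_cst.
- move=> F mF tF mlF.
  rewrite (_ : path_law ^~ _ = (fun y => \sum_(n <oo) path_law y (F n))%E); last first.
    apply/funext => y; apply: measure_semi_bigcup => //.
    exact: bigcupT_measurable.
  by apply: ge0_emeasurable_sum => // n y _.
Qed.

Let cylinder_law_shift t u l y :
  cylinder_law (u + t) [seq (p.1 + t, p.2) | p <- l] y = cylinder_law u l y.
Proof.
elim: l u y => [|p l IH] u y //=.
have -> : p.1 + t - (u + t) = p.1 - u by ring.
by apply: eq_integral => w _; rewrite IH.
Qed.

(** Both sides are measures in [B], and they agree on cylinders. *)
Let markov_event x t A (B : set paths) : 0 <= t -> hF X t A -> measurable B ->
  (hP X x (A `&` hshift X t @^-1` B) = \int[hP X x]_(w in A) path_law (X t w) B)%E.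
Proof.
move=> t0 At; have mA := hF_measurable t0 At.
have mpl (C : set paths) : measurable C ->
    measurable_fun A (fun w => path_law (X t w) C).
  move=> mC; apply: measurable_funTS.
  by apply: (measurableT_comp (measurable_path_law mC)); exact: measurable_hX.
have mshift (C : set paths) : measurable C -> measurable (A `&` hshift X t @^-1` C).
  move=> mC; apply: measurableI => //.
  by rewrite -[X in measurable X]setTI; apply: measurable_shift.
have total : (hP X x A = \int[hP X x]_(w in A) 1)%E by rewrite integral_cst ?mul1e.
move: B; apply: dynkin_paths.
- rewrite preimage_setT setIT total.
  by apply: eq_integral => w _; rewrite probability_setT.
- move=> l adl; pose l' := [seq (p.1 + t, p.2) | p <- sort le_time l].
  have adl' : admissible l'.
    move=> _ /mapP[p pl ->] /=; have [p0 mp] := admissible_sort adl pl.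
    by split => //; exact: addr_ge0.
  have pl' : path le_time (t, setT) l'.
    have := path_sort adl; rewrite /l'.
    case: (sort le_time l) => //= p s /andP[p0 ps]; apply/andP; split.
      by rewrite /le_time/= lerDr.
    rewrite path_map; apply: sub_path ps => q q'.
    by rewrite /le_time/= lerD2r.
  have -> : hshift X t @^-1` cylinder l = cylinder l'.
    rewrite -cylinder_sort /cylinder /l'; elim: (sort le_time l) (admissible_sort adl) => [|p s IH] ads.
      by rewrite !big_nil preimage_setT.
    have [p0 _] := ads p (mem_head _ _).
    rewrite big_cons/= big_cons preimage_setI IH; last first.
      by move=> q qs; apply: ads; rewrite in_cons qs orbT.
    by congr (_ `&` _); apply/seteqP; split => w /=; rewrite hX_shift.
  rewrite (cylinder_lawE x t0)//; apply: eq_integral => w _.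
  by rewrite path_lawE hP_cylinderE// -[t]add0r cylinder_law_shift.
- move=> B mB HB; have mBc : measurable (~` B : set paths) by exact: measurableC.
  have E1 : (hP X x A = hP X x (A `&` hshift X t @^-1` (~` B)) +
      hP X x (A `&` hshift X t @^-1` B))%E.
    rewrite [LHS](@measureDI _ _ _ (hP X x) A (hshift X t @^-1` B))//.
    by rewrite -[X in measurable X]setTI; apply: measurable_shift.
  have E2 : (hP X x A = \int[hP X x]_(w in A) path_law (X t w) (~` B) +
      \int[hP X x]_(w in A) path_law (X t w) B)%E.
    rewrite total -ge0_integralD//; [|exact: mpl..].
    apply: eq_integral => w _; rewrite probability_setC// subeK//.
    exact: fin_num_measure.
  have fB : hP X x (A `&` hshift X t @^-1` B) \is a fin_num.
    by apply: fin_num_measure; exact: mshift.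
  by move: E1; rewrite E2 -HB => /(congr1 (fun z => z - hP X x (A `&` hshift X t @^-1` B))%E);
    rewrite !addeK.
- move=> F mF tF HF; rewrite preimage_bigcup setI_bigcupr.
  rewrite measure_semi_bigcup//; last 3 first.
  + by move=> n; exact: mshift.
  + apply/trivIsetP => i j _ _ ij; apply/seteqP; split => // w [[_ Fi] [_ Fj]].
    suff : (F i `&` F j) (hshift X t w) by move/trivIsetP : tF => ->.
    by split.
  + by apply: bigcupT_measurable => n; exact: mshift.
  transitivity (\sum_(n <oo) \int[hP X x]_(w in A) path_law (X t w) (F n))%E.
    by apply: eq_eseriesr => n _; exact: HF.
  rewrite -integral_nneseries//; last by move=> n; exact: mpl.
  apply: eq_integral => w _; apply/esym/measure_semi_bigcup => //.
  exact: bigcupT_measurable.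
Qed.

Lemma markov_property x t A (f : paths -> \bar R) : 0 <= t -> hF X t A ->
  measurable_fun setT f -> (forall w, (0 <= f w)%E) ->
  (\int[hP X x]_(w in A) f (hshift X t w) =
   \int[hP X x]_(w in A) \int[path_law (X t w)]_w' f w')%E.
Proof.
move=> t0 At mf f0.
apply: integral_disintegration => //.
- exact: hF_measurable At.
- exact: measurable_shift.
- move=> B mB; apply: (measurableT_comp (measurable_path_law mB)); exact: measurable_hX.
- by move=> B mB; exact: markov_event.
Qed.

End markov.

(** * Exit times *)

Section exit_times.
Context (R : realType) (E : ptopologicalType) (d : measure_display).
Context (Omega : measurableType d) (X : hunt_process R E Omega).
Local Notation opc := (one_point_compactification E).

Definition debut (K : set opc) (w : Omega) : \bar R :=
  ereal_inf [set t%:E | t in [set t | 0 <= t /\ ~ K (X t w)]].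

Lemma debut_ge0 K w : (0 <= debut K w)%E.
Proof. by apply: le_ereal_inf_tmp => _ [t [t0 _] <-]; rewrite lee_fin. Qed.

Lemma debut_le K w t : 0 <= t -> ~ K (X t w) -> (debut K w <= t%:E)%E.
Proof. by move=> t0 Kt; apply: ereal_inf_lbound; exists t. Qed.

Lemma debut_subset K K' w : K `<=` K' -> (debut K w <= debut K' w)%E.
Proof.
move=> KK'; apply: le_ereal_inf => _ [t [t0 K't] <-].
by exists t => //; split => // /KK'.
Qed.

Lemma debut_ltE K w t : (debut K w < t%:E)%E ->
  exists2 s, 0 <= s < t & ~ K (X s w).
Proof.
move=> /ereal_inf_lt[_ [s [s0 Ks] <-]]; rewrite lte_fin => st.
by exists s => //; rewrite s0.
Qed.

Lemma open_right (U : set opc) t w : open U -> 0 <= t -> U (X t w) ->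
  exists2 e, 0 < e & forall s, t <= s -> s < t + e -> U (X s w).
Proof.
move=> oU t0 Ut.
have [e /= e0 eU] := @hX_right_continuous _ _ _ _ X t w t0 _ (open_nbhs_nbhs (conj oU Ut)).
exists e => // s; rewrite le_eqVlt => /predU1P[<- //|ts] ste.
by apply: eU => //=; rewrite ltr_norml; apply/andP; split; lra.
Qed.

Lemma debut_gtP (U : set opc) t w : open U -> 0 <= t ->
  (t%:E < debut U w)%E <-> forall s, 0 <= s -> s <= t -> U (X s w).
Proof.
move=> oU t0; split=> [tD s s0 st|H].
  apply: contrapT => nU; have := lt_le_trans tD (debut_le s0 nU).
  by rewrite lte_fin ltNge st.
have [e e0 eU] := open_right oU t0 (H t t0 (lexx t)).
apply: (@lt_le_trans _ _ (t + e)%:E); first by rewrite lte_fin ltrDl.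
apply: le_ereal_inf_tmp => _ [s [s0 nU] <-]; rewrite lee_fin leNgt.
apply/negP => ste; apply: nU; have [st|ts] := leP s t; first exact: H.
by apply: eU => //; exact: ltW.
Qed.

(** A path in [V] at its debut out of [K] would stay in [V] for a while, by
    right-continuity. *)
Lemma debut_notin (K V : set opc) w t : open V -> V `<=` K ->
  debut K w = t%:E -> ~ V (X t w).
Proof.
move=> oV VK Dt Vt.
have t0 : 0 <= t by rewrite -lee_fin -Dt debut_ge0.
have [e e0 eV] := open_right oV t0 Vt.
have : (debut K w < (t + e)%:E)%E by rewrite Dt lte_fin ltrDl.
move=> /debut_ltE[s /andP[s0 ste] nK].
have ts : t <= s by rewrite -lee_fin -Dt debut_le.
by apply/nK/VK/eV.
Qed.

(** By right-continuity a path that leaves the closed set [K] is outside [K] at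
    some rational time. *)
Lemma debut_lt_bigcup (K : set opc) t : closed K ->
  [set w | (debut K w < t%:E)%E] =
  \bigcup_(q : rat) (if 0 <= (ratr q : R) < t then X (ratr q) @^-1` (~` K) else set0).
Proof.
move=> cK; apply/seteqP; split => [w /debut_ltE[s /andP[s0 st] nK]|w [q _]].
  have [e e0 eK] := open_right (closed_openC cK) s0 nK.
  have : s < Num.min t (s + e) by rewrite lt_min st ltrDl.
  move=> /rat_in_itvoo[q]; rewrite in_itv/= lt_min => /andP[sq /andP[qt qse]].
  exists q => //; rewrite (le_trans s0 (ltW sq)) qt/=.
  by apply: eK => //; exact: ltW.
case: ifPn => // /andP[q0 qt] nK.
by apply: le_lt_trans (debut_le q0 nK) _; rewrite lte_fin.
Qed.

Lemma measurable_debut (K : set opc) : closed K ->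
  measurable_fun setT (debut K : paths X -> \bar R).
Proof.
move=> cK; apply: (measurability _ (ErealGenInftyO.measurableE R)) => //.
move=> _ [_ [t ->] <-]; rewrite setTI.
rewrite (_ : _ @^-1` _ = [set w | (debut K w < t%:E)%E]); last first.
  by apply/seteqP; split => w /=; rewrite in_itv.
rewrite debut_lt_bigcup//; apply: bigcupT_measurable_rat => q.
case: ifPn => // /andP[q0 qt].
rewrite -[X in measurable X]setTI; apply: paths_measurable_X => //.
apply: sub_sigma_algebra; exact: closed_openC.
Qed.

Let hF_bigcup_rat t (A : rat -> set Omega) : 0 <= t -> (forall q, hF X t (A q)) ->
  hF X t (\bigcup_q A q).
Proof.
move=> t0; have [sF _] := hF_sigma_algebra X t0; rewrite -(sigma_algebra_id sF).
exact: (@bigcupT_measurable_rat _ (g_sigma_algebraType (hF X t))).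
Qed.

Let hF_bigcap t (A : nat -> set Omega) : 0 <= t -> (forall q, hF X t (A q)) ->
  hF X t (\bigcap_q A q).
Proof.
move=> t0; have [sF _] := hF_sigma_algebra X t0; rewrite -(sigma_algebra_id sF).
exact: (@bigcapT_measurable _ (g_sigma_algebraType (hF X t))).
Qed.

(** As [debut K w < t] is determined by the path before time [t], the event
    [debut K w <= t] belongs to [hF X s] for every [s > t]. *)
Lemma stopping_time_debut (K : set opc) : closed K -> stopping_time (hF X) (debut K).
Proof.
move=> cK; split=> [w|t t0]; first exact: debut_ge0.
rewrite hF_right_continuous// => s /= ts.
have s0 : 0 <= s by rewrite (le_trans t0)// ltW.
pose u n := Num.min s (t + n.+1%:R^-1).
rewrite (_ : [set w | _] = \bigcap_n [set w | (debut K w < (u n)%:E)%E]); last first.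
  apply/seteqP; split => [w /= tK n _|w H] /=.
    apply: (le_lt_trans tK); rewrite lte_fin lt_min ts ltrDl invr_gt0.
    by rewrite ltr0n.
  apply/lee_addgt0Pr => e e0.
  have [n _ ne] := near_infty_natSinv_lt (PosNum e0).
  apply: le_trans (ltW (H n I)) _; rewrite -EFinD lee_fin.
  rewrite ge_min; apply/orP; right; rewrite lerD2l ltW//.
  by apply: ne => /=.
apply: hF_bigcap => // n; rewrite debut_lt_bigcup//.
have un : u n <= s by rewrite /u ge_min lexx.
apply: hF_bigcup_rat => // q; case: ifPn => [/andP[q0 qu]|_].
  apply: (@hF_le _ _ _ _ X (ratr q) s) => //; first by rewrite (le_trans (ltW qu)).
  by apply: hX_adapted => //; apply: sub_sigma_algebra; exact: closed_openC.
by have [[]] := hF_sigma_algebra X s0.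
Qed.

Hypothesis E_hausdorff : hausdorff_space E.
Hypothesis E_locally_compact : locally_compact [set: E].
Hypothesis E_second_countable : @second_countable E.
Variables (G : set E) (G_open : open G).

(** Exhausting [G] by open sets [V n] with closures in [G], the debuts out of
    the closures increase to a time at which, by quasi-left-continuity, the
    process is almost surely outside every [V n]. *)
Lemma exit_time_measurable_version : exists T : paths X -> \bar R,
  [/\ measurable_fun setT T, stopping_time (hF X) T,
      forall w, (T w <= exit_time X G w)%E,
      forall t w, 0 <= t -> (T w <= t%:E + T (hshift X t w))%E &
      forall x, {ae hP X x, forall w, exit_time X G w = T w}].
Proof.
have [V [oV VS clV VG]] := open_exhaustion E_hausdorff E_locally_compact
  E_second_countable G_open.
pose tau n := debut (closure (V n)).
pose T w := ereal_sup (range (tau ^~ w)).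
have Vmono m n : (m <= n)%N -> V m `<=` V n.
  move=> /subnK <-; elim: (n - m)%N => [|k IH]; first by rewrite add0n.
  by apply: subset_trans IH _; rewrite addSn; exact: VS.
have Tle w : (T w <= exit_time X G w)%E.
  by apply: ge_ereal_sup => _ [n _ <-]; exact: debut_subset.
have T_ge0 w : (0 <= T w)%E.
  by apply: le_trans (debut_ge0 _ w) _; apply: ereal_sup_ubound; exists 0%N.
have stop n : stopping_time (hF X) (tau n).
  by apply: stopping_time_debut; exact: closed_closure.
exists T; split => //.
- rewrite (_ : T = (fun w => esups (tau ^~ w) 0)).
    by apply: measurable_fun_esups => n; apply: measurable_debut; exact: closed_closure.
  apply/funext => w; rewrite /T /esups/=; congr ereal_sup.
  by apply/seteqP; split => _ [n _ <-]; exists n.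
- split=> // t t0; rewrite (_ : [set w | _] = \bigcap_n [set w | (tau n w <= t%:E)%E]).
    by apply: hF_bigcap => // n; exact: (stop n).2.
  apply/seteqP; split => [w /= Tt n _|w H] /=.
    by apply: le_trans Tt; apply: ereal_sup_ubound; exists n.
  by apply: ge_ereal_sup => _ [n _ <-]; exact: H.
- move=> t w t0; apply: ge_ereal_sup => _ [n _ <-].
  apply: (@le_trans _ _ (t%:E + tau n (hshift X t w))%E); last first.
    by rewrite leeD2l//; apply: ereal_sup_ubound; exists n.
  rewrite -leeBlDl//; apply: le_ereal_inf_tmp => _ [u [u0 Ku] <-].
  rewrite leeBlDl// -EFinD; apply: debut_le; first exact: addr_ge0.
  by rewrite addrC -hX_shift.
move=> x; have mono n w : (tau n w <= tau n.+1 w)%E.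
  by apply: debut_subset; apply: closureS; exact: VS.
apply: filterS (hX_quasi_left_continuous x stop mono) => w; rewrite -/(T w) => H.
apply/eqP; rewrite eq_le Tle andbT.
have [->|Tfin] := eqVneq (T w) +oo%E; first exact: leey.
have T0 := T_ge0 w.
have Tlty : (T w < +oo)%E by rewrite ltey.
have Tf : T w \is a fin_num by rewrite ge0_fin_numE.
rewrite -(fineK Tf); apply: debut_le; first exact: fine_ge0.
move=> /VG[m _ Vm].
have [N _ HN] := H Tlty _ (open_nbhs_nbhs (conj (oV m) Vm)).
pose n := maxn m N.
have tn : tau n w \is a fin_num.
  rewrite ge0_fin_numE ?debut_ge0//; apply: le_lt_trans Tlty.
  by apply: ereal_sup_ubound; exists n.
apply: (@debut_notin (closure (V n)) (V n) w (fine (tau n w))) => //.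
- exact: subset_closure.
- by rewrite fineK.
- by apply: (Vmono m n) (leq_maxl _ _) _ _; apply: HN => /=; exact: leq_maxr.
Qed.

End exit_times.

(** * Joint measurability of the process *)

Section joint_measurability.
Context (R : realType) (E : ptopologicalType) (d : measure_display).
Context (Omega : measurableType d) (X : hunt_process R E Omega).
Local Notation opc := (one_point_compactification E).
Hypothesis E_hausdorff : hausdorff_space E.
Hypothesis E_locally_compact : locally_compact [set: E].
Hypothesis E_second_countable : @second_countable E.

(** Extending the process to negative times by its value at [0] makes the domain a
    product of measurable spaces. *)
Definition Xpos (p : R * paths X) : borel opc := X (Num.max p.1 0) p.2.

(* the first point of the grid of mesh [1 / k.+1] after [t] *)
Let grid (k j : nat) : R := j.+1%:R / k.+1%:R.
Let slot (k j : nat) (t : R) : Prop := j%:R <= k.+1%:R * Num.max t 0 < j.+1%:R.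

Let slot_grid k j t : slot k j t ->
  Num.max t 0 < grid k j <= Num.max t 0 + k.+1%:R^-1.
Proof.
move=> /andP[jt tj]; have k0 : 0 < k.+1%:R :> R by rewrite ltr0n.
rewrite /grid ltr_pdivlMr// ler_pdivrMr// mulrC tj/= mulrDl mulVf ?gt_eqF//.
by rewrite -natr1 lerD2r mulrC.
Qed.

Let slot_ex k t : exists j, slot k j t.
Proof.
exists (Num.truncn (k.+1%:R * Num.max t 0)); apply/truncn_itv.
by rewrite mulr_ge0// le_max lexx orbT.
Qed.

(** By right-continuity the process is in [G] if and only if, for one of the sets
    [V m] exhausting [G], it is in [V m] at the grid point following the time,
    for all fine enough grids. *)
Let measurable_Xpos_open (G : set E) : open G ->
  measurable (Xpos @^-1` (Some @` G)).
Proof.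
move=> oG; have [V [oV VS clV VG]] := open_exhaustion E_hausdorff
  E_locally_compact E_second_countable oG.
have -> : Xpos @^-1` (Some @` G) = \bigcup_m \bigcup_N \bigcap_(k in [set k | (N <= k)%N])
    \bigcup_j ([set t | slot k j t] `*` (X (grid k j) @^-1` V m)).
  apply/seteqP; split => [[t w] /= /VG[m _ Vm]|[t w] /= [m _ [N _ H]]].
    have t0 : 0 <= Num.max t 0 by rewrite le_max lexx orbT.
    have [e e0 eV] := open_right (oV m) t0 Vm.
    have [N _ Ne] := near_infty_natSinv_lt (PosNum e0).
    exists m => //; exists N => // k Nk.
    have [j tj] := slot_ex k t; exists j => //; split => //=.
    have /andP[tg gt] := slot_grid tj.
    apply: eV; first exact: ltW.
    by apply: le_lt_trans gt _; rewrite ltrD2l; exact: Ne.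
  apply: (clV m) => U /= XU.
  have t0 : 0 <= Num.max t 0 by rewrite le_max lexx orbT.
  move: XU; rewrite /Xpos/= nbhsE => -[U' [oU' U't] U'U].
  have [e e0 eU] := open_right oU' t0 U't.
  have [N' _ Ne] := near_infty_natSinv_lt (PosNum e0).
  have [j _ [/= tj Vj]] := H (maxn N N') (leq_maxl _ _).
  exists (X (grid (maxn N N') j) w); split => //; apply: U'U.
  have /andP[tg gt] := slot_grid tj.
  apply: eU; first exact: ltW.
  by apply: le_lt_trans gt _; rewrite ltrD2l; apply: Ne => /=; exact: leq_maxr.
apply: bigcupT_measurable => m; apply: bigcupT_measurable => N.
apply: bigcap_measurableType => k _; apply: bigcupT_measurable => j.
apply: measurableX.
  have mf : measurable_fun setT (fun t : R => k.+1%:R * Num.max t 0).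
    by apply: measurable_funM => //; exact: measurable_maxr.
  rewrite (_ : [set t | _] = (fun t : R => k.+1%:R * Num.max t 0) @^-1` `[j%:R, j.+1%:R[%classic).
    by rewrite -[X in measurable X]setTI; apply: mf => //; exact: measurable_itv.
  by apply/seteqP; split => t /=; rewrite in_itv.
rewrite -[X in measurable X]setTI; apply: paths_measurable_X => //.
  by rewrite /grid divr_ge0.
apply: sub_sigma_algebra; exact: oV.
Qed.

(** A set that contains the cemetery is handled through its complement in [E]. *)
Lemma measurable_Xpos : measurable_fun setT Xpos.
Proof.
apply: (@measurability _ _ _ (borel opc) setT Xpos (@open opc)) => //.
move=> _ [U oU <-]; rewrite setTI.
have -> : Xpos @^-1` U = Xpos @^-1` (Some @` (Some @^-1` U)) `|`
    (if None \in U then ~` (Xpos @^-1` (Some @` [set: E])) else set0).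
  apply/seteqP; split => [p /= Up|p /=].
    case XE : (Xpos p) Up => [x|] Up; first by left; exists x.
    by right; rewrite ifT ?inE//= XE => -[].
  move=> [[x Ux <-]//|]; case: ifPn => // /set_mem UN /= nX.
  case: (Xpos p) nX => [x|//] nX.
  by exfalso; apply: nX; exists x.
apply: measurableU.
  apply: measurable_Xpos_open.
  apply: (@open_comp _ _ (Some : E -> opc) (U : set opc)) => // x _.
  exact: one_point_compactification_some_continuous.
case: ifPn => // _; apply: measurableC; apply: measurable_Xpos_open.
exact: openT.
Qed.

End joint_measurability.

(** * The killed semigroup *)

Section killed_semigroup.
Context (R : realType) (E : ptopologicalType) (d : measure_display).
Context (Omega : measurableType d) (X : hunt_process R E Omega).
Local Notation opc := (one_point_compactification E).
Hypothesis E_hausdorff : hausdorff_space E.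
Hypothesis E_locally_compact : locally_compact [set: E].
Hypothesis E_second_countable : @second_countable E.
Variables (G : set E) (G_open : open G).
Local Notation tau := (exit_time X G).
(** A measurable time almost surely equal to [tau], with the properties given by
    [exit_time_measurable_version]. *)
Variable T : paths X -> \bar R.
Hypothesis T_measurable : measurable_fun setT T.
Hypothesis T_stopping : stopping_time (hF X) T.
Hypothesis T_le : forall w, (T w <= tau w)%E.
Hypothesis T_shift : forall t w, 0 <= t -> (T w <= t%:E + T (hshift X t w))%E.
Hypothesis T_ae : forall x, {ae hP X x, forall w, tau w = T w}.

Local Open Scope ereal_scope.

Definition surviving (t : R) : set (paths X) := [set w | (t%:E < T w)%E].

Definition alive (f : E -> \bar R) (t : R) (w : Omega) : \bar R :=
  oapp f 0 (X t w) * (\1_(surviving t) w)%:E.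

Definition alive_joint (f : E -> \bar R) (p : R * paths X) : \bar R :=
  oapp f 0 (Xpos p) * (\1_[set p : R * paths X | (p.1%:E < T p.2)%E] p)%:E.

Let alive_jointE f t w : (0 <= t)%R -> alive_joint f (t, w) = alive f t w.
Proof. by move=> t0; rewrite /alive_joint /Xpos/= max_l// !indicE/=. Qed.

Let measurable_alive_joint (f : borel E -> \bar R) : measurable_fun setT f ->
  measurable_fun setT (alive_joint f).
Proof.
move=> mf; apply: emeasurable_funM.
  apply: (measurableT_comp (measurable_oapp E_hausdorff E_locally_compact 0 mf)).
  exact: measurable_Xpos.
apply/measurable_EFinP; apply: measurable_indic.
rewrite -[X in measurable X]setTI; apply: measurable_lte => //.
  by apply/measurable_EFinP; exact: measurable_fst.
exact: measurableT_comp T_measurable measurable_snd.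
Qed.

Let measurable_alive (f : borel E -> \bar R) t : (0 <= t)%R -> measurable_fun setT f ->
  measurable_fun setT (alive f t : paths X -> \bar R).
Proof.
move=> t0 mf; rewrite (_ : alive f t = (fun w => alive_joint f (t, w))).
  by apply: (measurableT_comp (measurable_alive_joint mf)); exact: measurable_pair1.
by apply/funext => w; rewrite alive_jointE.
Qed.

Let alive_ge0 f t w : (forall x, 0 <= f x) -> 0 <= alive f t w.
Proof.
by move=> f0; apply: mule_ge0; [case: (X t w) => //= x; exact: f0|rewrite lee_fin].
Qed.

(** As [tau] and [T] are almost surely equal, integrals against the process
    killed at [tau] can be computed with [T], on the path space. *)
Lemma integral_paths y (phi : paths X -> \bar R) (psi : Omega -> \bar R) :
  measurable_fun setT phi -> (forall w, tau w = T w -> psi w = phi w) ->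
  \int[hP X y]_w psi w = \int[path_law X y]_w phi w.
Proof.
move=> mphi H; transitivity (\int[hP X y]_w phi w).
  apply: ae_integral; last by apply: filterS (T_ae y) => w /H.
  by apply: (measurableT_comp mphi); exact: measurable_idpaths.
rewrite integralE [RHS]integralE; congr (_ - _); apply/esym.
- apply: (ge0_integral_pushforward (@measurable_idpaths _ _ _ _ X) _ measurableT) => //.
  exact: measurable_funepos.
- apply: (ge0_integral_pushforward (@measurable_idpaths _ _ _ _ X) _ measurableT) => //.
  exact: measurable_funeneg.
Qed.

(** The killed semigroup on extended-real functions, so that on nonnegative ones
    it can be iterated without any condition of integrability. *)
Definition killed (t : R) (f : E -> \bar R) (x : E) : \bar R :=
  \int[path_law X (Some x)]_w alive f t w.

Lemma killed_ge0 t f x : (forall x, 0 <= f x) -> 0 <= killed t f x.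
Proof. by move=> f0; apply: integral_ge0 => w _; exact: alive_ge0. Qed.

Lemma killed_le t (f g : borel E -> \bar R) x : (0 <= t)%R ->
  measurable_fun setT f -> measurable_fun setT g ->
  (forall x, 0 <= f x) -> (forall x, f x <= g x) -> killed t f x <= killed t g x.
Proof.
move=> t0 mf mg f0 fg; apply: ge0_le_integral => //.
- by move=> w _; exact: alive_ge0.
- exact: measurable_alive.
- exact: measurable_alive.
- move=> w _; apply: lee_wpmul2r; first by rewrite lee_fin.
  by case: (X t w).
Qed.

Let start_kernel (p : R * borel E) : {measure set paths X -> \bar R} :=
  path_law X (Some p.2).

Let measurable_start_kernel U : measurable U ->
  measurable_fun setT (start_kernel ^~ U).
Proof.
move=> mU.
apply: (measurableT_comp (measurable_path_law E_hausdorff E_locally_compact mU)).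
by apply: (measurableT_comp (@measurable_Some E)); exact: measurable_snd.
Qed.

HB.instance Definition _ :=
  isKernel.Build _ _ _ _ _ start_kernel measurable_start_kernel.

Let start_kernel_prob p : start_kernel p setT = 1.
Proof. exact: probability_setT. Qed.

HB.instance Definition _ :=
  Kernel_isProbability.Build _ _ _ _ _ start_kernel start_kernel_prob.

Lemma measurable_killed_joint (f : borel E -> \bar R) : measurable_fun setT f ->
  (forall x, 0 <= f x) ->
  measurable_fun setT (fun p : R * borel E => \int[path_law X (Some p.2)]_w alive_joint f (p.1, w)).
Proof.
move=> mf f0.
apply: (measurable_fun_integral_finite_kernel (fun q => alive_joint f (q.1.1, q.2)) start_kernel).
  move=> q; apply: mule_ge0; last by rewrite lee_fin.
  by case: (Xpos _) => //= x; exact: f0.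
apply: (measurableT_comp (measurable_alive_joint mf)).
apply: measurable_fun_pair; last exact: measurable_snd.
by apply: (measurableT_comp (@measurable_fst _ _ _ _)); exact: measurable_fst.
Qed.

Lemma measurable_killed t (f : borel E -> \bar R) : (0 <= t)%R ->
  measurable_fun setT f -> (forall x, 0 <= f x) ->
  measurable_fun setT (killed t f : borel E -> \bar R).
Proof.
move=> t0 mf f0.
rewrite (_ : killed t f = (fun x => (fun p : R * borel E =>
    \int[path_law X (Some p.2)]_w alive_joint f (p.1, w)) (t, x))).
  apply: (measurableT_comp (measurable_killed_joint mf f0)).
  exact: measurable_pair1.
by apply/funext => x; apply: eq_integral => w _; rewrite alive_jointE.
Qed.

Let exit_time_gtP t w : (0 <= t)%R ->
  t%:E < tau w <-> forall s, (0 <= s)%R -> (s <= t)%R -> (Some @` G) (X s w).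
Proof.
by move=> t0; apply: debut_gtP => //; exact: one_point_compactification_open_some.
Qed.

Lemma alive_inside t w : (0 <= t)%R -> t%:E < tau w -> exists2 x, G x & X t w = Some x.
Proof.
by move=> t0 /(exit_time_gtP _ t0)/(_ t t0 (lexx t))[x Gx <-]; exists x.
Qed.

(** [T_shift] gives one direction of the equivalence of [t + s < T] and
    [t < T] and [s < T] after time [t]. Conversely, a path that stays in [G] up
    to [t], and then for a further time [s], stays in [G] up to [t + s]. *)
Let alive_shift f s t w : (0 <= s)%R -> (0 <= t)%R -> tau w = T w ->
  alive f (s + t) w = alive f s (hshift X t w) * (\1_(surviving t) w)%:E.
Proof.
move=> s0 t0 TE; rewrite /alive hX_shift// -muleA; congr (_ * _).
rewrite !indicE -EFinM -natrM mulnb; congr (_%:R%:E); congr nat_of_bool.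
apply/idP/andP => [|[]]; rewrite !inE/=.
  move=> stT; split.
    have := lt_le_trans stT (T_shift w t0).
    by rewrite EFinD [X in X < _]addeC lteD2lE.
  by apply: le_lt_trans stT; rewrite lee_fin lerDr.
move=> sT tT; change ((s + t)%:E < T w); rewrite -TE.
apply/exit_time_gtP; first exact: addr_ge0.
move=> u u0 ust; have [ut|tu] := leP u t.
  move: tT; rewrite /surviving/= -TE => /(exit_time_gtP _ t0); exact.
have /(exit_time_gtP _ s0)/(_ (u - t)%R) := lt_le_trans sT (T_le _).
rewrite hX_shift ?subrK ?subr_ge0 ?(ltW tu)//.
by apply => //; rewrite lerBlDr.
Qed.

Let survival_event t : (0 <= t)%R -> hF X t (surviving t).
Proof.
move=> t0; have [sF _] := hF_sigma_algebra X t0; rewrite -(sigma_algebra_id sF).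
rewrite (_ : surviving t = ~` [set w : paths X | (T w <= t%:E)%E]).
  apply: (@measurableC _ (g_sigma_algebraType (hF X t))).
  by rewrite /measurable/= (sigma_algebra_id sF); exact: T_stopping.2.
by apply/seteqP; split => w; rewrite /surviving/= ltNge => /negP.
Qed.

(** The Markov property at time [t] on the event [t < T]. *)
Lemma killedD s t (f : borel E -> \bar R) x : (0 <= s)%R -> (0 <= t)%R ->
  measurable_fun setT f -> (forall x, 0 <= f x) ->
  killed (s + t) f x = killed t (killed s f) x.
Proof.
move=> s0 t0 mf f0.
have mk := measurable_killed s0 mf f0.
have k0 y : 0 <= killed s f y by exact: killed_ge0.
have := @markov_property _ _ _ _ X E_hausdorff E_locally_compact (Some x) t
  _ (alive f s) t0 (survival_event t0) (measurable_alive s0 mf) (fun w => alive_ge0 s w f0).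
rewrite integral_mkcond [RHS]integral_mkcond.
rewrite (@integral_paths _ (alive f (s + t))); last 2 first.
- by apply: measurable_alive => //; exact: addr_ge0.
- move=> w TE; rewrite alive_shift//= patchE indicE.
  by case: ifP => _; rewrite ?mule1 ?mule0.
rewrite (@integral_paths _ (alive (killed s f) t)) //.
- exact: measurable_alive.
- move=> w TE; rewrite patchE /alive indicE.
  case: ifPn => [|_]; last by rewrite mule0.
  rewrite inE/= mule1 /surviving/= -TE => /(alive_inside t0)[y _ ->]/=.
  by [].
Qed.

Let alive_abs f t w : `|alive f t w| = alive (abse \o f) t w.
Proof.
rewrite /alive abseM; congr (_ * _); first by case: (X t w) => //=; rewrite normr0.
by rewrite gee0_abs// lee_fin.
Qed.

Let alive_funepos f t : (alive f t)^\+ = alive f^\+ t.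
Proof.
apply/funext => w; rewrite funeposE /alive indicE; case: (w \in _); last by rewrite !mule0 maxxx.
by rewrite !mule1; case: (X t w) => [x|]//=; rewrite ?funeposE// maxxx.
Qed.

Let alive_funeneg f t : (alive f t)^\- = alive f^\- t.
Proof.
apply/funext => w; rewrite funenegE /alive indicE; case: (w \in _).
  by rewrite !mule1; case: (X t w) => [x|]//=; rewrite ?funenegE ?oppe0 ?oppr0 ?maxxx.
by rewrite !mule0 oppe0 maxxx.
Qed.

Lemma killedE t f x : killed t f x = killed t f^\+ x - killed t f^\- x.
Proof. by rewrite {1}/killed integralE alive_funepos alive_funeneg. Qed.

Lemma measurable_killed_signed t (f : borel E -> \bar R) : (0 <= t)%R ->
  measurable_fun setT f -> measurable_fun setT (killed t f : borel E -> \bar R).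
Proof.
move=> t0 mf; rewrite (_ : killed t f = (fun x => killed t f^\+ x - killed t f^\- x)).
  apply: emeasurable_funB; apply: measurable_killed => //.
  - exact: measurable_funepos.
  - exact: measurable_funeneg.
by apply/funext => x; rewrite killedE.
Qed.

Lemma killed_sqr_le t (f : borel E -> \bar R) x : (0 <= t)%R ->
  measurable_fun setT f -> (forall x, 0 <= f x) ->
  (killed t f x) ^+ 2 <= killed t (fun y => f y ^+ 2) x.
Proof.
move=> t0 mf f0.
apply: le_trans (sqr_integral_le _ (measurable_alive t0 mf) _) _.
  by move=> w; exact: alive_ge0.
rewrite le_eqVlt; apply/orP; left; apply/eqP; apply: eq_integral => w _.
rewrite /alive indicE; case: (w \in _); last by rewrite !mule0 expe2 mule0.
by rewrite !mule1; case: (X t w) => //=; rewrite mule0.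
Qed.

Lemma integrable_alive t (f : borel E -> \bar R) x : (0 <= t)%R ->
  measurable_fun setT f -> killed t (abse \o f) x < +oo ->
  (path_law X (Some x)).-integrable setT (alive f t : paths X -> \bar R).
Proof.
move=> t0 mf fy; apply/integrableP; split; first exact: measurable_alive.
by under eq_integral do rewrite alive_abs.
Qed.

Lemma abse_killed_le t (f : borel E -> \bar R) x : (0 <= t)%R ->
  measurable_fun setT f -> `|killed t f x| <= killed t (abse \o f) x.
Proof.
move=> t0 mf; apply: le_trans (le_abse_integral _ _ _) _ => //.
  exact: measurable_alive.
by rewrite le_eqVlt; apply/orP; left; apply/eqP; apply: eq_integral => w _; exact: alive_abs.
Qed.

Lemma killed_semigroupE t (u : borel E -> R) x : (0 <= t)%R ->
  measurable_fun setT u ->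
  killed_semigroup X G t u x = fine (killed t (EFin \o u) x).
Proof.
move=> t0 mu; congr (fine _); apply: integral_paths.
  by apply: measurable_alive => //; exact/measurable_EFinP.
move=> w TE; rewrite EFinM /alive; congr (_ * _).
  by case: (X t w).
by rewrite !indicE; congr (_%:R%:E); congr nat_of_bool; apply/idP/idP; rewrite !inE/= TE.
Qed.

Lemma measurable_killed_semigroup t (u : borel E -> R) : (0 <= t)%R ->
  measurable_fun setT u -> measurable_fun setT (killed_semigroup X G t u : borel E -> R).
Proof.
move=> t0 mu; rewrite (_ : killed_semigroup X G t u = (fun x => fine (killed t (EFin \o u) x))).
  apply: measurableT_comp => //; apply: measurable_killed_signed => //.
  exact/measurable_EFinP.
by apply/funext => x; rewrite killed_semigroupE.
Qed.

Lemma killed_semigroup_le t (u : borel E -> R) x : (0 <= t)%R ->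
  measurable_fun setT u ->
  `|killed_semigroup X G t u x|%:E <= killed t (abse \o (EFin \o u)) x.
Proof.
move=> t0 mu; rewrite killed_semigroupE//.
have := @abse_killed_le t (EFin \o u) x t0 ((measurable_EFinP _ _).2 mu).
by apply: le_trans; case: (killed t _ x) => //=; rewrite normr0 ?leey.
Qed.

Lemma killed_abse_le1 t (f : borel E -> R) M x : (0 <= t)%R ->
  measurable_fun setT f -> (forall x, (`|f x| <= M)%R) ->
  killed t (abse \o (EFin \o f)) x <= M%:E * killed t (cst 1) x.
Proof.
move=> t0 mf fM; have M0 : (0 <= M)%R by exact: le_trans (fM x).
rewrite /killed -ge0_integralZl//; last 2 first.
- exact: (@measurable_alive (cst 1)).
- by move=> w _; apply: alive_ge0.
apply: ge0_le_integral_setT => w; first by apply: alive_ge0 => y; exact: abse_ge0.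
rewrite /alive muleA; apply: lee_wpmul2r; first by rewrite lee_fin.
by case: (X t w) => [y|]/=; rewrite ?mule0// mule1 lee_fin.
Qed.

Lemma killed_abse_le t (f : borel E -> R) M x : (0 <= t)%R ->
  measurable_fun setT f -> (forall x, (`|f x| <= M)%R) ->
  killed t (abse \o (EFin \o f)) x <= M%:E.
Proof.
move=> t0 mf fM; have M0 : (0 <= M)%R by exact: le_trans (fM x).
apply: le_trans (killed_abse_le1 x t0 mf fM) _.
rewrite -[leRHS]mule1; apply: lee_wpmul2l; first by rewrite lee_fin.
apply: (@le_trans _ _ (\int[path_law X (Some x)]_w cst 1 w)).
  apply: ge0_le_integral_setT => w; first by apply: alive_ge0.
  rewrite /alive indicE; case: (w \in _); last by rewrite mule0.
  by rewrite mule1; case: (X t w) => [y|]/=; rewrite lee_fin.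
by rewrite integral_cst// mul1e probability_le1.
Qed.

Let killed_fin_num t (u : borel E -> R) x : (0 <= t)%R ->
  measurable_fun setT u -> killed t (abse \o (EFin \o u)) x < +oo ->
  killed t (EFin \o u) x \is a fin_num.
Proof.
move=> t0 mu uy; rewrite fin_num_abs; apply: le_lt_trans uy.
by apply: abse_killed_le => //; exact/measurable_EFinP.
Qed.

Lemma killed_semigroup_linear t a (u v : borel E -> R) x : (0 <= t)%R ->
  measurable_fun setT u -> measurable_fun setT v ->
  killed t (abse \o (EFin \o u)) x < +oo ->
  killed t (abse \o (EFin \o v)) x < +oo ->
  killed_semigroup X G t (fun y => a * u y + v y)%R x =
  (a * killed_semigroup X G t u x + killed_semigroup X G t v x)%R.
Proof.
move=> t0 mu mv uy vy.
have muE : measurable_fun setT (EFin \o u) by exact/measurable_EFinP.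
have mvE : measurable_fun setT (EFin \o v) by exact/measurable_EFinP.
rewrite !killed_semigroupE//; last first.
  by apply: measurable_funD => //; exact: measurable_funM.
rewrite -[a]/(fine a%:E) -fineM ?killed_fin_num//; last first.
rewrite -fineD ?fin_numM ?killed_fin_num//; congr fine.
have iu := integrable_alive t0 muE uy; have iv := integrable_alive t0 mvE vy.
rewrite /killed -integralZl// -integralD//; last exact: integrableZl.
apply: eq_integral => w _; rewrite /alive indicE.
case: (w \in _); last by rewrite !mule0 adde0.
by rewrite !mule1; case: (X t w) => //=; rewrite mule0 adde0.
Qed.

(** Where the signed integral converges absolutely, so does the inner one at
    almost every point visited at time [s]. *)
Lemma killed_semigroupD s t (u : borel E -> R) x : (0 <= s)%R -> (0 <= t)%R ->
  measurable_fun setT u -> killed (s + t) (abse \o (EFin \o u)) x < +oo ->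
  killed_semigroup X G s (killed_semigroup X G t u) x =
  killed_semigroup X G (s + t) u x.
Proof.
move=> s0 t0 mu uy.
have muE : measurable_fun setT (EFin \o u) by exact/measurable_EFinP.
have mp := measurable_funepos muE; have mn := measurable_funeneg muE.
have mua : measurable_fun setT (abse \o (EFin \o u)) by exact: measurableT_comp.
have mtu := measurable_killed_semigroup t0 mu.
rewrite (killed_semigroupE x s0 mtu) (killed_semigroupE x (addr_ge0 s0 t0) mu).
congr fine; rewrite [RHS]killedE.
rewrite [(s + t)%R]addrC !killedD//.
have mkp := measurable_killed t0 mp (funepos_ge0 _).
have mkn := measurable_killed t0 mn (funeneg_ge0 _).
have kp0 y : 0 <= killed t (EFin \o u)^\+ y by exact: killed_ge0.
have kn0 y : 0 <= killed t (EFin \o u)^\- y by exact: killed_ge0.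
have mka := measurable_killed t0 mua (fun x => abse_ge0 _).
have ka0 y : 0 <= killed t (abse \o (EFin \o u)) y.
  by apply: killed_ge0 => z; exact: abse_ge0.
have pa y : killed t (EFin \o u)^\+ y <= killed t (abse \o (EFin \o u)) y.
  by apply: killed_le => // z; rewrite funeposE ge_max lee_abs abse_ge0.
have na y : killed t (EFin \o u)^\- y <= killed t (abse \o (EFin \o u)) y.
  by apply: killed_le => // z; rewrite funenegE ge_max /= -normrN !lee_fin ler_norm normr_ge0.
rewrite addrC killedD// in uy; last by move=> y; exact: abse_ge0.
have intg (g : borel E -> \bar R) : measurable_fun setT g -> (forall y, 0 <= g y) ->
    (forall y, g y <= killed t (abse \o (EFin \o u)) y) ->
    (path_law X (Some x)).-integrable setT (alive g s : paths X -> \bar R).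
  move=> mg g0 ga; apply: integrable_alive => //; apply: le_lt_trans uy.
  apply: killed_le => // [|y|y].
  - exact: measurableT_comp.
  - exact: abse_ge0.
  - by rewrite /= gee0_abs.
have intp := intg _ mkp kp0 pa; have intn := intg _ mkn kn0 na.
rewrite /killed -integralB//; apply: ae_eq_integral => //.
- apply: measurable_alive => //; apply/measurable_EFinP.
  exact: measurable_killed_semigroup.
- by apply: emeasurable_funB; exact: measurable_alive.
- have [] := (@integrable_ae _ _ _ _ _ measurableT _ intp, @integrable_ae _ _ _ _ _ measurableT _ intn).
  apply: filterS2 => w fp fn _; move: (fp I) (fn I); rewrite /alive indicE.
  case: (w \in _); last by rewrite !mule0 oppe0 adde0.
  rewrite !mule1; case: (X s w) => [y|]/= fpy fny; last by rewrite sube0.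
  by rewrite killed_semigroupE// [X in fine X]killedE fineK// fin_numB; exact/andP.
Qed.

Variable mu : probability (borel E) R.
Hypothesis X_symmetric : symmetric_process X mu.
Local Notation nu := (mu \|_ G_open).

(** [killed t g] is at most [transition X t (g \_ G)], whose integral is by symmetry
    that of [g \_ G] times [transition X t 1], and the latter is at most [1]. *)
Lemma integral_killed_le t (g : borel E -> \bar R) : (0 <= t)%R ->
  measurable_fun setT g -> (forall x, 0 <= g x) ->
  \int[nu]_x killed t g x <= \int[nu]_x g x.
Proof.
move=> t0 mg g0.
have mG : measurable (G : set (borel E)) by exact: open_borel.
have mgG : measurable_fun setT (g \_ G : borel E -> \bar R).
  by apply/(measurable_restrictT g mG); exact: measurable_funTS.
have gG0 y : 0 <= (g \_ G) y by rewrite patchE; case: ifP.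
have mk := measurable_killed t0 mg g0.
have k0 y : 0 <= killed t g y by exact: killed_ge0.
rewrite !ge0_integral_mrestr// integral_mkcond [leRHS]integral_mkcond.
apply: (@le_trans _ _ (\int[mu]_x (cst 1 x * transition X t (g \_ G) x))).
  apply: ge0_le_integral_setT => x; first by rewrite patchE; case: ifP.
  rewrite mul1e; apply: (@le_trans _ _ (killed t g x)); first by rewrite patchE; case: ifP.
  rewrite /killed -(@integral_paths _ _ (fun w => oapp (g \_ G) 0 (X t w) * (\1_(surviving t) w)%:E)).
  - apply: ge0_le_integral_setT => w.
      by apply: mule_ge0; [case: (X t w)|rewrite lee_fin].
    rewrite indicE; case: (w \in _); first by rewrite mule1.
    by rewrite mule0; case: (X t w).
  - exact: measurable_alive.
  - move=> w TE; rewrite /alive indicE; case: (boolP (w \in surviving t)) => [|_]; last by rewrite !mule0.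
    rewrite inE /surviving/= -TE => /(alive_inside t0)[y Gy ->]/=.
    by rewrite patchE ifT ?inE.
rewrite X_symmetric//.
apply: ge0_le_integral_setT => x.
  apply: mule_ge0 => //; apply: integral_ge0 => w _.
  by case: (X t w).
rewrite -[leRHS]mul1e; apply: lee_wpmul2r => //.
apply: (@le_trans _ _ (\int[hP X (Some x)]_w cst 1 w)).
  by apply: ge0_le_integral_setT => w; case: (X t w) => //=; rewrite lee_fin.
by rewrite integral_cst// mul1e probability_le1.
Qed.

Lemma integral_killed_sqr_le t (f : borel E -> \bar R) : (0 <= t)%R ->
  measurable_fun setT f -> (forall x, 0 <= f x) ->
  \int[nu]_x (killed t f x) ^+ 2 <= \int[nu]_x (f x) ^+ 2.
Proof.
move=> t0 mf f0.
have mf2 : measurable_fun setT (fun x => f x ^+ 2).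
  by under eq_fun do rewrite expe2; exact: emeasurable_funM.
apply: le_trans (integral_killed_le t0 mf2 _); last by move=> x; exact: sqre_ge0.
apply: ge0_le_integral_setT => x; first exact: sqre_ge0.
exact: killed_sqr_le.
Qed.

(** * The killed semigroup on square-integrable functions *)

Lemma killed_semigroup0 (u : borel E -> R) x : G x -> killed_semigroup X G 0 u x = u x.
Proof.
move=> Gx; rewrite /killed_semigroup /Rintegral.
rewrite (@ae_integral _ _ _ _ _ (cst (u x)%:E)); last 2 first.
- exact: measurable_cst.
- apply: filterS (ae_start X E_hausdorff E_locally_compact (Some x)) => w Xw.
  rewrite Xw/= indicE mem_set ?mulr1//=.
  apply/exit_time_gtP => // s s0 s_0; have -> : s = 0%R by apply: le_anti; rewrite s_0.
  by rewrite Xw; exists x.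
transitivity (fine ((u x)%:E * hP X (Some x) setT)); first by rewrite integral_cst.
by rewrite probability_setT mule1.
Qed.

Lemma ldotE (u : L2 nu) : (ldot u u)%:E = \int[nu]_x (`|u x|%:E ^+ 2).
Proof.
rewrite /ldot /L2dot /Rintegral fineK; last first.
  apply: integrable_fin_num => //; exact: L2_mul_integrable.
apply: eq_integral => x _.
by rewrite expe2 -EFinM -normrM ger0_norm// -expr2 sqr_ge0.
Qed.

Let absL2 (u : L2 nu) : measurable_fun setT (abse \o (EFin \o u) : borel E -> \bar R).
Proof. by apply: measurableT_comp => //; exact/measurable_EFinP. Qed.

Let integral_killed_L2 t (u : L2 nu) : (0 <= t)%R ->
  \int[nu]_x (killed t (abse \o (EFin \o u)) x) ^+ 2 <= (ldot u u)%:E.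
Proof.
move=> t0; rewrite ldotE; apply: integral_killed_sqr_le => // x.
exact: abse_ge0.
Qed.

(** The square of the function is integrable by [integral_killed_sqr_le]. *)
Lemma ae_killed_lty t (u : L2 nu) : (0 <= t)%R ->
  {ae nu, forall x, killed t (abse \o (EFin \o u)) x < +oo}.
Proof.
move=> t0.
have mk : measurable_fun setT (fun x : borel E => killed t (abse \o (EFin \o u)) x ^+ 2).
  under eq_fun do rewrite expe2.
  by apply: emeasurable_funM; exact: measurable_killed_signed.
have k0 x : 0 <= killed t (abse \o (EFin \o u)) x.
  by apply: killed_ge0 => y; exact: abse_ge0.
have /integrable_ae : nu.-integrable setT (fun x => killed t (abse \o (EFin \o u)) x ^+ 2).
  apply/integrableP; split => //; apply: le_lt_trans (ltry (ldot u u)).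
  apply: le_trans (integral_killed_L2 u t0).
  by under eq_integral do rewrite gee0_abs ?sqre_ge0//.
move=> /(_ measurableT); apply: filterS => x /(_ I).
by have := k0 x; case: (killed t _ x) => //= y _; rewrite ltry.
Qed.

Let killed_semigroup_sqr_le t (u : L2 nu) : (0 <= t)%R ->
  \int[nu]_x (`|killed_semigroup X G t u x|%:E ^+ 2) <= (ldot u u)%:E.
Proof.
move=> t0; apply: le_trans (integral_killed_L2 u t0).
apply: ge0_le_integral_setT => x; first exact: sqre_ge0.
rewrite lee_sqr ?killed_semigroup_le ?lee_fin//.
by apply: killed_ge0 => y; exact: abse_ge0.
Qed.

Lemma killed_semigroup_Lfun t (u : L2 nu) : (0 <= t)%R ->
  killed_semigroup X G t u \in Lfun nu 2%:E.
Proof.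
move=> t0; rewrite inE; apply/andP; split; rewrite inE/=.
  exact: measurable_killed_semigroup.
rewrite /finite_norm unlock /=; apply: poweR_lty.
apply: le_lt_trans (ltry (ldot u u)); apply: le_trans (killed_semigroup_sqr_le u t0).
rewrite le_eqVlt; apply/orP; left; apply/eqP; apply: eq_integral => x _.
by rewrite powR_mulrn// -EFin_expe.
Qed.

Definition killed_L2 t (u : L2 nu) : L2 nu := insubd (0%R : L2 nu) (killed_semigroup X G t u).

Lemma killed_L2E t (u : L2 nu) : (0 <= t)%R ->
  (killed_L2 t u : E -> R) = killed_semigroup X G t u.
Proof. by move=> t0; exact: (insubdK (0%R : L2 nu) (killed_semigroup_Lfun u t0)). Qed.

Local Opaque killed_L2.

Let killed_L2_linear t a (u v k : L2 nu) : (0 <= t)%R ->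
  ldot (killed_L2 t (a *: u + v)%R) k = (a * ldot (killed_L2 t u) k + ldot (killed_L2 t v) k)%R.
Proof.
move=> t0; rewrite -ldot_linear; apply: ae_eq_ldot.
have aeF := ae_filter_ringOfSetsType nu.
move: (ae_killed_lty u t0) (ae_killed_lty v t0); apply: filterS2 => x uy vy _.
have at_x w := congr1 (@^~ x) (killed_L2E w t0).
apply: etrans (at_x _) _; apply: etrans (killed_semigroup_linear a t0 _ _ uy vy) _ => //.
by congr (_ * _ + _)%R; exact/esym/at_x.
Qed.

Let killed_L2_semigroup s t (u k : L2 nu) : (0 <= s)%R -> (0 <= t)%R ->
  ldot (killed_L2 (s + t) u) k = ldot (killed_L2 s (killed_L2 t u)) k.
Proof.
move=> s0 t0; apply: ae_eq_ldot.
have aeF := ae_filter_ringOfSetsType nu.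
move: (ae_killed_lty u (addr_ge0 s0 t0)); apply: filterS => x uy _.
apply: etrans (congr1 (@^~ x) (killed_L2E u (addr_ge0 s0 t0))) _.
apply: etrans (esym (killed_semigroupD s0 t0 _ uy)) _ => //.
apply: etrans _ (esym (congr1 (@^~ x) (killed_L2E (killed_L2 t u) s0))).
exact: (congr1 (fun f => killed_semigroup X G s f x) (esym (killed_L2E u t0))).
Qed.

Let killed_L2_contraction t (u : L2 nu) : (0 <= t)%R ->
  (ldot (killed_L2 t u) (killed_L2 t u) <= ldot u u)%R.
Proof.
by move=> t0; rewrite -lee_fin ldotE killed_L2E//; exact: killed_semigroup_sqr_le.
Qed.

Let killed_L2_0 (u k : L2 nu) : ldot (killed_L2 0%R u) k = ldot u k.
Proof.
apply: ae_eq_ldot; apply: ae_mrestr.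
by apply: nearW => x Gx _; rewrite killed_L2E// killed_semigroup0.
Qed.

Lemma generatorE (u v : L2 nu) :
  generator X u v <-> infinitesimal_generator (@ldot _ _ _ nu) killed_L2 u v.
Proof.
rewrite /infinitesimal_generator -L2norm_cvg0 /generator.
suff E0 : \forall t \near 0^'+, L2norm nu (quotient killed_L2 t u - v)%R =
    L2norm nu (fun x => t^-1 * (killed_semigroup X G t u x - u x) - v x)%R.
  split; apply: cvg_trans; apply: near_eq_cvg.
    by apply: filterS E0 => t ->.
  by apply: filterS E0 => t ->.
near=> t; congr (L2norm nu _); apply/funext => x.
have t0 : (0 <= t)%R by near: t; exact: nbhs_right_ge.
by rewrite -(killed_L2E u t0).
Unshelve. all: by end_near. Qed.

Section spectral.
Variable S : spectral_family nu.
Hypothesis S_spectral : spectral_family_of S (fun u v => generator X u (- v)%R).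

Let S_spectral' : spectral_family_of S
  (fun u v => infinitesimal_generator (@ldot _ _ _ nu) killed_L2 u (- v)%R).
Proof.
rewrite (_ : (fun u v : L2 nu => _) = (fun u v : L2 nu => generator X u (- v)%R)) //.
by apply/funext => u; apply/funext => v; apply/propext; rewrite generatorE.
Qed.

Lemma killed_semigroup_sqr_norm (u : L2 nu) t : (0 <= t)%R ->
  L2norm nu (killed_semigroup X G t u) ^+ 2 =
  \int[spectral_measure S u]_(xi in `[0%R, +oo[) (expR (- (2 * xi * t)))%:E.
Proof.
move=> t0; rewrite -(killed_L2E u t0) L2norm_sqrE; apply/esym.
exact: (L2_semigroup_sqr_norm killed_L2_linear killed_L2_semigroup
  killed_L2_contraction killed_L2_0 S_spectral').
Qed.

Lemma killed_semigroup_sym (u v : L2 nu) t : (0 <= t)%R ->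
  ldot (killed_L2 t u) v = ldot u (killed_L2 t v).
Proof.
exact: (L2_semigroup_sym killed_L2_linear killed_L2_semigroup
  killed_L2_contraction killed_L2_0 S_spectral').
Qed.

(** Half of the semigroup is moved to the other side by symmetry. *)
Lemma ldot_killed_L2 (u : L2 nu) t : (0 <= t)%R ->
  (ldot u (killed_L2 t u))%:E = L2norm nu (killed_semigroup X G (t / 2) u) ^+ 2.
Proof.
move=> t0; have t20 : (0 <= t / 2)%R by rewrite divr_ge0.
rewrite -(killed_L2E u t20) L2norm_sqrE.
have E1 := killed_semigroup_sym u (killed_L2 (t / 2) u) t20.
have := killed_L2_semigroup u u t20 t20; rewrite -splitr => E2.
exact: (congr1 EFin (etrans (ldotC _ _) (etrans E2 (etrans (ldotC _ _) (esym E1))))).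
Qed.

End spectral.

(** * The killed potential *)

Section potential.
Variable r : R -> R.
Hypothesis r_ge0 : forall t, (0 <= t)%R -> (0 <= r t)%R.
Hypothesis r_measurable : measurable_fun (`[0%R, +oo[%classic : set R) r.

Let rpos : R -> R := r \_ `[0%R, +oo[%classic.

Let rpos_ge0 t : (0 <= rpos t)%R.
Proof. by rewrite /rpos patchE; case: ifPn => //; rewrite inE/= in_itv/= andbT => /r_ge0. Qed.

Let rpos_lt0 t : (t < 0)%R -> rpos t = 0%R.
Proof.
by move=> t0; rewrite /rpos patchE; case: ifPn => //; rewrite inE/= in_itv/= andbT leNgt t0.
Qed.

Let measurable_rpos : measurable_fun setT rpos.
Proof. exact/(measurable_restrictT r (measurable_itv _)). Qed.

Let integral_rpos (g : R -> \bar R) :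
  \int[lebesgue_measure]_(t in `[0%R, +oo[) ((r t)%:E * g t) =
  \int[lebesgue_measure]_t ((rpos t)%:E * g t).
Proof.
rewrite integral_mkcond; apply: eq_integral => t _; rewrite /rpos !patchE.
by case: ifP => // _; rewrite mul0e.
Qed.

Let weighted f (p : R * paths X) : \bar R := (rpos p.1)%:E * alive_joint f p.

Let measurable_weighted (f : borel E -> \bar R) : measurable_fun setT f ->
  measurable_fun setT (weighted f).
Proof.
move=> mf; apply: emeasurable_funM; last exact: measurable_alive_joint.
by apply/measurable_EFinP; apply: measurableT_comp => //; exact: measurable_fst.
Qed.

Let weightedE f t w : weighted f (t, w) = (rpos t)%:E * alive f t w.
Proof.
have [t0|t0] := leP 0%R t; first by rewrite /weighted/= alive_jointE.
by rewrite /weighted/= rpos_lt0// !mul0e.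
Qed.

Let weighted_ge0 f p : (forall x, 0 <= f x) -> 0 <= weighted f p.
Proof.
by move=> f0; case: p => t w; rewrite weightedE mule_ge0 ?alive_ge0// lee_fin.
Qed.

Definition lifetime_integral (f : E -> \bar R) (w : paths X) : \bar R :=
  \int[lebesgue_measure]_(t in `[0%R, +oo[) ((r t)%:E * alive f t w).

Let lifetime_integralE f w :
  lifetime_integral f w = \int[lebesgue_measure]_t weighted f (t, w).
Proof.
by rewrite /lifetime_integral integral_rpos; apply: eq_integral => t _; rewrite weightedE.
Qed.

Let measurable_lifetime_integral (f : borel E -> \bar R) : measurable_fun setT f ->
  measurable_fun setT (lifetime_integral f).
Proof.
move=> mf; have mw := measurable_weighted mf.
rewrite (_ : lifetime_integral f = (fun w =>
  \int[lebesgue_measure]_t (weighted f)^\+ (t, w) -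
  \int[lebesgue_measure]_t (weighted f)^\- (t, w))).
  apply: emeasurable_funB.
  - apply: (@measurable_fun_fubini_tonelli_G _ _ _ _ _ (@lebesgue_measure R) (weighted f)^\+) => //.
    exact: measurable_funepos.
  - apply: (@measurable_fun_fubini_tonelli_G _ _ _ _ _ (@lebesgue_measure R) (weighted f)^\-) => //.
    exact: measurable_funeneg.
by apply/funext => w; rewrite lifetime_integralE; apply: etrans (integralE _ _ _) _;
  congr (_ - _); apply: eq_integral => t _; rewrite ?funeposE ?funenegE.
Qed.

Lemma killed_potentialE (f : borel E -> R) x : measurable_fun setT f ->
  killed_potential X G r f x = \int[path_law X (Some x)]_w lifetime_integral (EFin \o f) w.
Proof.
move=> mf; apply: integral_paths.
  by apply: measurable_lifetime_integral; exact/measurable_EFinP.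
move=> w TE; rewrite integral_mkcond /lifetime_integral [RHS]integral_mkcond.
apply: eq_integral => t _; rewrite !patchE mem_setE in_itv/= andbT /alive indicE.
have [t0|t0] := leP 0%R t; last first.
  by rewrite ifF//; apply/negP; rewrite inE => -[]; rewrite leNgt t0.
case: (boolP (t \in _)) => [|tT].
  rewrite inE => -[_]; rewrite TE => tT.
  by rewrite mem_set// mule1 EFinM; case: (X t w).
rewrite memNset ?mule0 ?mule0// => tT'.
by move/negP: tT; apply; rewrite inE; split => //; rewrite TE.
Qed.

Let measurable_path_integral (g : paths X -> \bar R) : measurable_fun setT g ->
  measurable_fun setT (fun x : borel E => \int[path_law X (Some x)]_w g w).
Proof.
have ge0_measurable (h : paths X -> \bar R) : measurable_fun setT h ->
    (forall w, 0 <= h w) ->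
    measurable_fun setT (fun x : borel E => \int[path_law X (Some x)]_w h w).
  move=> mh h0; apply: measurable_fun_integral_kernel => // U mU.
  apply: (measurableT_comp (measurable_path_law E_hausdorff E_locally_compact mU)).
  exact: measurable_Some.
move=> mg; under eq_fun do rewrite integralE.
by apply: emeasurable_funB; apply: ge0_measurable => //;
  [exact: measurable_funepos|exact: measurable_funeneg].
Qed.

Lemma measurable_killed_potential (f : borel E -> R) : measurable_fun setT f ->
  measurable_fun setT (killed_potential X G r f : borel E -> \bar R).
Proof.
move=> mf; rewrite (_ : killed_potential X G r f =
  (fun x : borel E => \int[path_law X (Some x)]_w lifetime_integral (EFin \o f) w)).
  apply: measurable_path_integral; apply: measurable_lifetime_integral.
  exact/measurable_EFinP.
by apply/funext => x; rewrite killed_potentialE.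
Qed.

(** Tonelli in time and path. *)
Lemma ge0_killed_potential (f : borel E -> R) x : measurable_fun setT f ->
  (forall x, (0 <= f x)%R) ->
  killed_potential X G r f x =
  \int[lebesgue_measure]_(t in `[0%R, +oo[) ((r t)%:E * killed t (EFin \o f) x).
Proof.
move=> mf f0; have mfE : measurable_fun setT (EFin \o f) by exact/measurable_EFinP.
rewrite killed_potentialE// integral_rpos.
under eq_integral do rewrite lifetime_integralE.
rewrite -(@fubini_tonelli _ _ _ _ R (@lebesgue_measure R) (path_law X (Some x)) _
  (measurable_weighted mfE)); last first.
  by move=> p; apply: weighted_ge0 => y; rewrite lee_fin.
apply: eq_integral => t _.
under eq_integral do rewrite weightedE.
have [t0|t0] := leP 0%R t; last first.
  by rewrite rpos_lt0//; under eq_integral do rewrite mul0e; rewrite integral0 mul0e.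
rewrite ge0_integralZl ?lee_fin//; first exact: measurable_alive.
by move=> w _; apply: alive_ge0 => y; rewrite lee_fin.
Qed.

Lemma killed_potential_ge0 (f : borel E -> R) x : measurable_fun setT f ->
  (forall x, (0 <= f x)%R) -> 0 <= killed_potential X G r f x.
Proof.
move=> mf f0; rewrite killed_potentialE//; apply: integral_ge0 => w _.
rewrite lifetime_integralE; apply: integral_ge0 => t _.
by apply: weighted_ge0 => y; rewrite lee_fin.
Qed.

(** Up to the exit [r(t) * f(X_t)] is dominated by [M * r(t)]. *)
Lemma integral_abse_weighted_le (f : borel E -> R) M x : measurable_fun setT f ->
  (forall x, (`|f x| <= M)%R) ->
  \int[path_law X (Some x)]_w \int[lebesgue_measure]_t `|weighted (EFin \o f) (t, w)| <=
  M%:E * killed_potential X G r (cst 1%R) x.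
Proof.
move=> mf fM; have M0 : (0 <= M)%R by exact: le_trans (fM x).
have mw := measurable_weighted ((measurable_EFinP _ _).2 mf).
have m1E : measurable_fun setT (EFin \o cst 1%R : borel E -> \bar R).
  by apply/measurable_EFinP; exact: measurable_cst.
have mw1 := measurable_weighted m1E.
have w10 p : 0 <= weighted (EFin \o cst 1%R) p.
  by apply: weighted_ge0 => y; rewrite lee_fin.
rewrite killed_potentialE// -ge0_integralZl//; last 2 first.
- exact: measurable_lifetime_integral m1E.
- by move=> w _; rewrite lifetime_integralE; exact: integral_ge0.
apply: ge0_le_integral_setT => w; first by apply: integral_ge0.
rewrite lifetime_integralE -ge0_integralZl//; last first.
  exact: (measurableT_comp mw1).
apply: ge0_le_integral_setT => t //.
rewrite !weightedE abseM gee0_abs ?lee_fin// muleCA; apply: lee_wpmul2l; first by rewrite lee_fin.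
rewrite alive_abs /alive muleA; apply: lee_wpmul2r; first by rewrite lee_fin.
by case: (X t w) => [y|]/=; rewrite ?mule0// mule1 lee_fin.
Qed.

Lemma abse_killed_potential_le (f : borel E -> R) M x : measurable_fun setT f ->
  (forall x, (`|f x| <= M)%R) ->
  `|killed_potential X G r f x| <= M%:E * killed_potential X G r (cst 1%R) x.
Proof.
move=> mf fM; apply: le_trans (integral_abse_weighted_le x mf fM).
have mfE := (measurable_EFinP _ _).2 mf.
rewrite killed_potentialE//; apply: le_trans (le_abse_integral _ _ _) _ => //.
  exact: measurable_lifetime_integral.
apply: ge0_le_integral_setT => // w; rewrite lifetime_integralE.
apply: le_abse_integral => //.
by apply: (measurableT_comp (measurable_weighted mfE)).
Qed.

(** Fubini in time and path, the integral being absolutely convergent by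
    [integral_abse_weighted_le]. *)
Lemma killed_potential_Fubini (f : borel E -> R) x : bounded_borel f ->
  killed_potential X G r (cst 1%R) x < +oo ->
  killed_potential X G r f x =
  \int[lebesgue_measure]_(t in `[0%R, +oo[) ((r t)%:E * killed t (EFin \o f) x).
Proof.
move=> [mf [M fM]] fin1; have mfE := (measurable_EFinP _ _).2 mf.
have M0 : (0 <= M)%R by exact: le_trans (fM x).
have mw := measurable_weighted mfE.
have iw : ((@lebesgue_measure R) \x path_law X (Some x)).-integrable setT (weighted (EFin \o f)).
  apply/integrable21ltyP => //.
  apply: le_lt_trans (integral_abse_weighted_le x mf fM) _.
  by apply: lte_mul_pinfty; rewrite ?lee_fin.
rewrite killed_potentialE// integral_rpos.
under eq_integral do rewrite lifetime_integralE.
rewrite -(Fubini iw); apply: eq_integral => t _.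
under eq_integral do rewrite weightedE.
have [t0|t0] := leP 0%R t; last first.
  by rewrite rpos_lt0//; under eq_integral do rewrite mul0e; rewrite integral0 mul0e.
rewrite integralZl//; apply: integrable_alive => //.
exact: le_lt_trans (killed_abse_le x t0 mf fM) (ltry M).
Qed.

(** * Energy identities *)

Variable S : spectral_family nu.
Hypothesis S_spectral : spectral_family_of S (fun u v => generator X u (- v)%R).

Lemma integral_killed_mul t f (fB : bounded_borel f) : (0 <= t)%R ->
  \int[nu]_x ((f x)%:E * killed t (EFin \o f) x) =
  L2norm nu (killed_semigroup X G (t / 2) f) ^+ 2.
Proof.
move=> t0; have [mf [M fM]] := fB; pose u : L2 nu := toL2 mu G_open fB.
rewrite -(ldot_killed_L2 S_spectral u t0) /ldot /L2dot /Rintegral fineK; last first.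
  by apply: integrable_fin_num => //; exact: (L2_mul_integrable u (killed_L2 t u)).
apply: eq_integral => x _.
rewrite (killed_L2E u t0) killed_semigroupE// EFinM fineK//.
by apply: killed_fin_num => //; exact: le_lt_trans (killed_abse_le x t0 mf fM) (ltry M).
Qed.

(* a version of [r t * killed t f x] that is measurable in [(t, x)] *)
Let rate (f : borel E -> R) (p : R * borel E) : \bar R :=
  (rpos p.1)%:E *
  (\int[path_law X (Some p.2)]_w alive_joint (EFin \o f)^\+ (p.1, w) -
   \int[path_law X (Some p.2)]_w alive_joint (EFin \o f)^\- (p.1, w)).

Let measurable_rate f : measurable_fun setT f -> measurable_fun setT (rate f).
Proof.
move=> mf; have mfE := (measurable_EFinP _ _).2 mf.
apply: emeasurable_funM.
  by apply/measurable_EFinP; apply: measurableT_comp => //; exact: measurable_fst.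
apply: emeasurable_funB; apply: measurable_killed_joint => //.
- exact: measurable_funepos.
- exact: measurable_funeneg.
Qed.

Let rateE f t x : rate f (t, x) = (rpos t)%:E * killed t (EFin \o f) x.
Proof.
have [t0|t0] := leP 0%R t; last by rewrite /rate/= rpos_lt0// !mul0e.
rewrite killedE /rate/=; congr (_ * (_ - _)); apply: eq_integral => w _;
  exact: alive_jointE.
Qed.

Let rate_ge0 f p : (forall x, (0 <= f x)%R) -> 0 <= rate f p.
Proof.
move=> f0; case: p => t x; rewrite rateE mule_ge0 ?lee_fin//.
by apply: killed_ge0 => y; rewrite lee_fin.
Qed.

Let integral_abse_rate_le (f : borel E -> R) M x : measurable_fun setT f ->
  (forall x, (`|f x| <= M)%R) ->
  \int[lebesgue_measure]_t `|rate f (t, x)| <= M%:E * killed_potential X G r (cst 1%R) x.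
Proof.
move=> mf fM; have M0 : (0 <= M)%R by exact: le_trans (fM x).
have m1 : measurable_fun setT (cst 1%R : borel E -> R) by exact: measurable_cst.
rewrite ge0_killed_potential// integral_rpos -ge0_integralZl//.
- apply: ge0_le_integral_setT => t //; rewrite rateE abseM gee0_abs ?lee_fin// muleCA.
  have [t0|t0] := leP 0%R t; last by rewrite rpos_lt0// !mul0e.
  apply: lee_wpmul2l; rewrite ?lee_fin//.
  apply: le_trans (killed_abse_le1 x t0 mf fM).
  by apply: abse_killed_le => //; exact/measurable_EFinP.
- under eq_fun do rewrite -rateE.
  by apply: (measurableT_comp (measurable_rate m1)).
- by move=> t _; rewrite -rateE rate_ge0.
Qed.

Let density (f : borel E -> R) (p : R * borel E) : \bar R := (f p.2)%:E * rate f p.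

Let measurable_density f : measurable_fun setT f -> measurable_fun setT (density f).
Proof.
move=> mf; apply: emeasurable_funM; last exact: measurable_rate.
by apply: (measurableT_comp ((measurable_EFinP _ _).2 mf)); exact: measurable_snd.
Qed.

Let integral_density_space f t : bounded_borel f ->
  \int[nu]_x density f (t, x) =
  (rpos t)%:E * L2norm nu (killed_semigroup X G (t / 2) f) ^+ 2.
Proof.
move=> fB; under eq_integral do rewrite /density rateE.
have [t0|t0] := leP 0%R t; last first.
  rewrite rpos_lt0// mul0e.
  by under eq_integral do rewrite mul0e mule0; rewrite integral0.
rewrite -integral_killed_mul//; have [mf [M fM]] := fB.
have mfE := (measurable_EFinP _ _).2 mf.
under eq_integral do rewrite muleCA; rewrite integralZl//.
apply/integrableP; split.
  by apply: emeasurable_funM => //; exact: measurable_killed_signed.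
apply: (@le_lt_trans _ _ (\int[nu]_x cst (M * M)%:E x)).
  apply: ge0_le_integral_setT => x; first exact: abse_ge0.
  rewrite abseM EFinM; apply: lee_pmul; rewrite ?abse_ge0 ?lee_fin//.
  by apply: le_trans (killed_abse_le x t0 mf fM); exact: abse_killed_le.
rewrite integral_cst// lte_mul_pinfty ?lee_fin ?mulr_ge0 ?(le_trans _ (fM point))//.
exact: fin_num_fun_lty (fin_num_measure _).
Qed.

(** Tonelli in time and space. *)
Lemma ge0_integral_killed_potential f : bounded_borel f ->
  (forall x, (0 <= f x)%R) ->
  \int[nu]_x ((f x)%:E * killed_potential X G r f x) =
  \int[lebesgue_measure]_(t in `[0%R, +oo[)
    ((r t)%:E * L2norm nu (killed_semigroup X G (t / 2) f) ^+ 2).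
Proof.
move=> fB f0; have [mf _] := fB.
rewrite integral_rpos.
under [RHS]eq_integral do rewrite -integral_density_space//.
rewrite (@fubini_tonelli _ _ _ _ R (@lebesgue_measure R) nu _ (measurable_density mf)); last first.
  by move=> p; apply: mule_ge0; rewrite ?lee_fin// rate_ge0.
apply: eq_integral => x _; rewrite ge0_killed_potential// integral_rpos.
rewrite -ge0_integralZl ?lee_fin//.
- by apply: eq_integral => t _; rewrite /density rateE.
- under eq_fun do rewrite -rateE.
  by apply: (measurableT_comp (measurable_rate mf)).
- by move=> t _; rewrite -rateE rate_ge0.
Qed.

(** Fubini in time and space, the integral being dominated by that of [M * M]
    times the potential of [1]. *)
Lemma integral_killed_potential f : bounded_borel f ->
  \int[nu]_x killed_potential X G r (cst 1%R) x < +oo ->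
  \int[nu]_x ((f x)%:E * killed_potential X G r f x) =
  \int[lebesgue_measure]_(t in `[0%R, +oo[)
    ((r t)%:E * L2norm nu (killed_semigroup X G (t / 2) f) ^+ 2).
Proof.
move=> fB fin1; have [mf [M fM]] := fB.
have M0 : (0 <= M)%R by exact: le_trans (fM point).
have m1 : measurable_fun setT (cst 1%R : borel E -> R) by exact: measurable_cst.
have mk1 := measurable_killed_potential m1.
have k10 x : 0 <= killed_potential X G r (cst 1%R) x by exact: killed_potential_ge0.
have md := measurable_density mf.
have dens x : \int[lebesgue_measure]_t `|density f (t, x)| <=
    (M * M)%:E * killed_potential X G r (cst 1%R) x.
  apply: (@le_trans _ _ (\int[lebesgue_measure]_t (M%:E * `|rate f (t, x)|))).
    apply: ge0_le_integral_setT => t //; rewrite /density abseM.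
    by apply: lee_wpmul2r; rewrite ?lee_fin.
  rewrite ge0_integralZl ?lee_fin//; last first.
    by apply: measurableT_comp => //; exact: (measurableT_comp (measurable_rate mf)).
  rewrite EFinM -muleA; apply: lee_wpmul2l; rewrite ?lee_fin//.
  exact: integral_abse_rate_le.
have idens : ((@lebesgue_measure R) \x nu).-integrable setT (density f).
  apply/integrable21ltyP => //.
  apply: (@le_lt_trans _ _ (\int[nu]_x ((M * M)%:E * killed_potential X G r (cst 1%R) x))).
    by apply: ge0_le_integral_setT => x; [exact: integral_ge0|exact: dens].
  rewrite ge0_integralZl ?lee_fin ?mulr_ge0//.
  by rewrite lte_mul_pinfty ?lee_fin ?mulr_ge0.
rewrite integral_rpos.
under [RHS]eq_integral do rewrite -integral_density_space//.
rewrite (Fubini idens); apply: ae_integral.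
  exact: measurable_fubini_G idens.
have /integrable_ae : nu.-integrable setT (killed_potential X G r (cst 1%R)).
  apply/integrableP; split => //.
  by under eq_integral do rewrite gee0_abs//.
move=> /(_ measurableT); apply: filterS => x /(_ I) kx.
have kxy : killed_potential X G r (cst 1%R) x < +oo by rewrite ltey_eq kx.
rewrite killed_potential_Fubini// integral_rpos /density/= integralZl//.
  by congr (_ * _); apply: eq_integral => t _; rewrite rateE.
apply/integrableP; split; first exact: (measurableT_comp (measurable_rate mf)).
apply: le_lt_trans (integral_abse_rate_le x mf fM) _.
by rewrite lte_mul_pinfty ?lee_fin.
Qed.

(** Tonelli in time and in the spectral parameter. *)
Lemma integral_laplace f (fB : bounded_borel f) :
  \int[spectral_measure S (toL2 mu G_open fB)]_(xi in `[0%R, +oo[) laplace r xi =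
  \int[lebesgue_measure]_(t in `[0%R, +oo[)
    ((r t)%:E * L2norm nu (killed_semigroup X G (t / 2) f) ^+ 2).
Proof.
rewrite integral_rpos.
pose h (p : R * R) : \bar R :=
  (\1_(`[0%R, +oo[%classic) p.2 * (rpos p.1 * expR (- (p.2 * p.1))))%:E.
have mh : measurable_fun setT h.
  apply/measurable_EFinP; apply: measurable_funM.
    apply: (measurableT_comp (measurable_indic _)) => //.
  apply: measurable_funM.
    by apply: measurableT_comp => //; exact: measurable_fst.
  apply: measurableT_comp => //; apply: measurable_funN.
  by apply: measurable_funM; [exact: measurable_snd|exact: measurable_fst].
transitivity (\int[lebesgue_measure]_t
    \int[spectral_measure S (toL2 mu G_open fB)]_xi h (t, xi)); last first.
  apply: eq_integral => t _.
  have [t0|t0] := leP 0%R t; last first.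
    under eq_integral do rewrite /h/= rpos_lt0// mul0r mulr0.
    by rewrite integral0 rpos_lt0// mul0e.
  rewrite (killed_semigroup_sqr_norm S_spectral (toL2 mu G_open fB)) ?divr_ge0//.
  have me : measurable_fun (`[0%R, +oo[%classic : set R)
      (fun xi : R => (expR (- (2 * xi * (t / 2))))%:E).
    apply/measurable_EFinP; apply: measurableT_comp => //.
    apply: measurable_funTS; apply: measurable_funN; apply: measurable_funM => //.
  rewrite -(@ge0_integralZl _ _ R (spectral_measure S (toL2 mu G_open fB)) _
    (measurable_itv `[0%R, +oo[) _ me); last 2 first.
  - by move=> xi _; rewrite lee_fin expR_ge0.
  - by rewrite lee_fin.
  rewrite integral_mkcond; apply: eq_integral => xi _.
  rewrite /h/= patchE indicE; case: ifP => _; last by rewrite mul0r.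
  by rewrite mul1r EFinM; congr (_ * (expR (- _))%:E); field.
rewrite (@fubini_tonelli _ _ _ _ R (@lebesgue_measure R) (spectral_measure S (toL2 mu G_open fB)) h mh); last first.
  by move=> p; rewrite lee_fin !mulr_ge0 ?expR_ge0.
rewrite integral_mkcond; apply: eq_integral => xi _.
rewrite patchE /h/= indicE; case: ifP => _.
  rewrite /laplace integral_mkcond; apply: eq_integral => t _.
  by rewrite /rpos !patchE mul1r; case: ifP => _; rewrite ?mul0r.
by under eq_integral do rewrite mul0r; rewrite integral0.
Qed.

(** Until its exit the process is in [G], where the potential of [1] integrates
    [r]; a process started outside [G] exits at once. *)
Lemma integral_primitive :
  \int[mu]_x \int[hP X (Some x)]_w primitive r (tau w) =
  \int[nu]_x killed_potential X G r (cst 1%R) x.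
Proof.
have m1 : measurable_fun setT (cst 1%R : borel E -> R) by exact: measurable_cst.
rewrite [RHS]ge0_integral_mrestr; last 2 first.
- exact: measurable_killed_potential.
- by move=> x; apply: killed_potential_ge0.
rewrite [RHS]integral_mkcond; apply: eq_integral => x _; rewrite patchE.
transitivity (killed_potential X G r (cst 1%R) x).
  apply: eq_integral => w _; apply: eq_integral => t.
  rewrite inE => -[t0 /(alive_inside t0)[y _ ->]]/=.
  by rewrite mulr1.
case: ifPn => // /negP xG.
rewrite /killed_potential (@ae_integral _ _ _ _ _ (cst 0)).
- by rewrite integral0.
- exact: measurable_cst.
- apply: filterS (ae_start X E_hausdorff E_locally_compact (Some x)) => w Xw.
  rewrite (_ : times_before _ = set0) ?integral_set0//.
  apply/seteqP; split => // t [t0 /(exit_time_gtP _ t0)/(_ 0%R (lexx _) t0)].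
  by rewrite Xw => -[y Gy [yx]]; apply: xG; rewrite inE -yx.
Qed.

End potential.
End killed_semigroup.

(** * The equivalence *)

Theorem theorem2p2
    (R : realType)
    (E : ptopologicalType)
    (E_hausdorff : hausdorff_space E)
    (E_locally_compact : locally_compact [set: E])
    (E_second_countable : @second_countable E)
    (mu : probability (borel E) R) (mu_radon : radon mu)
    (d : measure_display) (Omega : measurableType d)
    (X : hunt_process R E Omega) (X_symmetric : symmetric_process X mu)
    (G : set E) (G_open : open G)
    (S : spectral_family (mu \|_ G_open))
    (S_spectral : spectral_family_of S (fun u v => generator X u (- v)))
    (r : R -> R)
    (r_ge0 : forall t : R, 0 <= t -> 0 <= r t)
    (r_measurable : measurable_fun (`[0, +oo[%classic : set R) r)
    (r_nondecreasing : forall s t : R, 0 <= s -> s <= t -> r s <= r t)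
    (tau_finite : {ae mu, forall x : borel E,
       {ae hP X (Some x), forall w, (exit_time X G w < +oo)%E}}) :
  [<-> (\int[mu]_x \int[hP X (Some x)]_w primitive r (exit_time X G w)
          < +oo)%E ;
       forall f, bounded_borel f ->
         (mu \|_ G_open).-integrable [set: borel E]
           (fun x => (f x)%:E * killed_potential X G r f x)%E ;
       forall f (fB : bounded_borel f),
         (\int[spectral_measure S (toL2 mu G_open fB)]_(xi in `[0%R, +oo[)
            laplace r xi < +oo)%E ;
       forall f, bounded_borel f ->
         (\int[lebesgue_measure]_(t in `[0%R, +oo[)
            ((r t)%:E *
             L2norm (mu \|_ G_open) (killed_semigroup X G (t / 2) f) ^+ 2)
          < +oo)%E ]
  /\
  (forall f (fB : bounded_borel f),
     (\int[spectral_measure S (toL2 mu G_open fB)]_(xi in `[0%R, +oo[)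
        laplace r xi =
      \int[lebesgue_measure]_(t in `[0%R, +oo[)
        ((r t)%:E *
         L2norm (mu \|_ G_open) (killed_semigroup X G (t / 2) f) ^+ 2))%E)
  /\
  (forall f (fB : bounded_borel f), (forall x, 0 <= f x) ->
     ('N[mu \|_ G_open]_1[
         (fun x => (f x)%:E * killed_potential X G r f x)] =
      \int[spectral_measure S (toL2 mu G_open fB)]_(xi in `[0%R, +oo[)
        laplace r xi)%E)
  /\
  ((\int[mu]_x \int[hP X (Some x)]_w primitive r (exit_time X G w)
      < +oo)%E ->
   forall f (fB : bounded_borel f),
     (\int[mu \|_ G_open]_x ((f x)%:E * killed_potential X G r f x) =
      \int[spectral_measure S (toL2 mu G_open fB)]_(xi in `[0%R, +oo[)
        laplace r xi)%E).
Proof.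
have [T [mT sT T_le T_shift T_ae]] :=
  exit_time_measurable_version X E_hausdorff E_locally_compact E_second_countable G_open.
have primE := integral_primitive E_hausdorff E_locally_compact E_second_countable
  G_open mT T_ae mu r_ge0 r_measurable.
have m_kp := measurable_killed_potential E_hausdorff E_locally_compact
  E_second_countable mT T_ae r_measurable.
have kp_le := abse_killed_potential_le E_hausdorff E_locally_compact
  E_second_countable mT T_ae r_ge0 r_measurable.
have kp_ge0 := killed_potential_ge0 E_hausdorff E_locally_compact
  E_second_countable mT T_ae r_ge0 r_measurable.
have lapE := integral_laplace E_hausdorff E_locally_compact E_second_countable
  mT sT T_le T_shift T_ae X_symmetric r_ge0 r_measurable S_spectral.
have ge0E := ge0_integral_killed_potential E_hausdorff E_locally_compact
  E_second_countable mT sT T_le T_shift T_ae X_symmetric r_ge0 r_measurable S_spectral.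
have signedE := integral_killed_potential E_hausdorff E_locally_compact
  E_second_countable mT sT T_le T_shift T_ae X_symmetric r_ge0 r_measurable S_spectral.
have B1 : bounded_borel (cst 1 : E -> R).
  by split; [exact: measurable_cst|exists 1 => x; rewrite normr1].
have kp1_ge0 x : (0 <= killed_potential X G r (cst 1%R) x)%E by exact: kp_ge0.
have mfkp f : bounded_borel f -> measurable_fun setT
    (fun x : borel E => (f x)%:E * killed_potential X G r f x)%E.
  move=> [mf _]; apply: emeasurable_funM; last exact: m_kp.
  exact/measurable_EFinP.
split; last split; last split.
- tfae.
  + rewrite primE => fin1 f fB; have [mf [M fM]] := fB.
    have M0 : 0 <= M by exact: le_trans (fM point).
    apply/integrableP; split; first exact: mfkp.
    apply: (@le_lt_trans _ _ (\int[mu \|_ G_open]_x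
        ((M * M)%:E * killed_potential X G r (cst 1%R) x))%E).
      apply: ge0_le_integral_setT => x; first exact: abse_ge0.
      rewrite abseM EFinM -muleA; apply: lee_pmul; rewrite ?abse_ge0 ?lee_fin//.
      exact: kp_le.
    rewrite ge0_integralZl ?lee_fin ?mulr_ge0//; last exact: m_kp.
    by rewrite lte_mul_pinfty ?lee_fin ?mulr_ge0 ?integral_ge0.
  (* the function [1] gives the first condition, hence the identity for all [f] *)
  + move=> H f fB; rewrite lapE -signedE//.
      have /integrableP[_] := H f fB; apply: le_lt_trans.
      by apply: le_trans (lee_abs _) (le_abse_integral _ _ _) => //; exact: mfkp.
    have [_] := integrableP _ _ _ (H _ B1); apply: le_lt_trans.
    by apply: ge0_le_integral_setT => // x; rewrite mul1e lee_abs.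
  + by move=> H f fB; rewrite -lapE.
  + move=> H; rewrite primE; apply: le_lt_trans (H _ B1).
    rewrite -ge0E//.
    by apply: ge0_le_integral_setT => // x; rewrite mul1e.
- exact: lapE.
- move=> f fB f0; rewrite lapE -ge0E// Lnorm1; apply: eq_integral => x _.
  by rewrite gee0_abs// mule_ge0 ?lee_fin// kp_ge0//; have [] := fB.
- by rewrite primE => fin1 f fB; rewrite lapE signedE.
Qed.
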